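(* Let $\mathcal B$ be a set operad with $\mathcal B(0)=\emptyset$ and $\mathcal P=\mathbb F[\mathcal B]$ the (reduced) operad spanned by it. The functor $P_{\mathcal P}:\beta(\mathcal P)\to\gamma(\mathcal P)$, $(A,\beta)\mapsto(A,\gamma)$ with $\gamma_{[x]_{\underline r},{\underline r}}=\beta_{\mathscr O_{\Sigma_{\underline r}}([x]_{\underline r}),{\underline r}}$ (identity on morphisms), restricts to a functor $\beta'(\mathcal P)\to\gamma'(\mathcal P)$, and this restricted functor is an isomorphism of categories.
   Context: $[n]=\{1,\dots,n\}$; $\mathcal P(n)=\mathbb F[\mathcal B(n)]$ with basis $\mathcal B(n)$ stable under $\Sigma_n$; $1\in\mathcal B(1)$ the unit and $\mu(x\otimes y_1\otimes\dots\otimes y_n)$ the full operadic composition. Compositions ${\underline r}\in\mathrm{Comp}_p(n)$ (nonnegative $p$-tuples with sum $n$) are identified with the partitions of $[n]$ into consecutive intervals ${\underline r}_i$ of lengths $r_i$; $\Sigma_{\underline r}\subseteq\Sigma_n$ preserves each ${\underline r}_i$; for an ordered partition $R$ of $[n]$, $\Sigma_R=\prod\Sigma_{R_i}$, $\sigma(R)=(\sigma(R_i))_i$. $[x]_H,\Omega_H(x),\mathrm{Stab}_H(x)$: class, orbit, stabiliser; subscripts ${\underline r}$ or $R$ mean $H=\Sigma_{\underline r}$ or $\Sigma_R$. $\mathscr O_{\Sigma_{\underline r}}([x]_{\underline r})=\sum_{y\in\Omega_{\Sigma_{\underline r}}(x)}y$. Sums over $G/H$ run over left coset representatives; integers are mapped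 to $\mathbb F$. For $\rho\in\Sigma_p$: ${\underline r}^\rho=(r_{\rho^{-1}(i)})_i$, $\rho^*$ the associated block permutation with blocks of sizes $r_i$. ${\underline q}\rhd{\underline r}=(\sum_{i\in{\underline q}_j}r_i)_{j\in[s]}$ for ${\underline q}\in\mathrm{Comp}_s(p)$. ${\underline r}\circ_1(l,m)=(l,m,r_2,\dots,r_p)$. Partition operations: for an ordered partition $Q=(Q_1,\dots,Q_s)$ of $[m]$ and $k\ge0$, $\gamma_k(Q)=(\bigsqcup_{t=0}^{k-1}(Q_j+tm))_j$; $R\otimes Q=(R_1,\dots,R_p,Q_1+n,\dots,Q_s+n)$ for $R$ a partition of $[n]$; ${\underline r}\diamond({\underline q}_i)_{i\in[p]}=\gamma_{r_1}({\underline q}_1)\otimes\dots\otimes\gamma_{r_p}({\underline q}_p)$ for ${\underline q}_i\in\mathrm{Comp}_{k_i}(m_i)$, a partition of $[M]$, $M=\sum r_im_i$. $\prod_i\Sigma_{r_i}\wr\Sigma_{{\underline q}_i}\subseteq\Sigma_{{\underline r}\diamond({\underline q}_i)}\subseteq\Sigma_M$: cutting $[M]$ into consecutive segments of lengths $r_im_i$ and segment $i$ into $r_i$ consecutive blocks of length $m_i$, the permutations preserving segments, permuting blocks within a segment order-preservingly, and acting inside each block of segment $i$ by an element of $\Sigma_{{\underline q}_i}$. $\beta(\mathcal P)$: objects $(A,\beta)$, $\beta_{x,{\underline r}}:A^p\to A$ for $x\in\mathcal P(n)^{\Sigma_{\underline r}}$, with ($\beta$1) $\beta_{x,{\underline r}}(a_1,\dots,a_p)=\beta_{\rho^*\cdot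 x,{\underline r}^\rho}(a_{\rho^{-1}(1)},\dots,a_{\rho^{-1}(p)})$; ($\beta$2) $\beta_{x,(0,{\underline r})}(a_0,a_1,\dots)=\beta_{x,{\underline r}}(a_1,\dots)$; ($\beta$3) $\beta_{x,{\underline r}}(\lambda a_1,\dots)=\lambda^{r_1}\beta_{x,{\underline r}}(a_1,\dots)$; ($\beta$4) $\beta_{x,{\underline r}}$ at ($a_j$ repeated $q_j$ times)$_j$ equals $\beta_{\sum_{\sigma\in\Sigma_{{\underline q}\rhd{\underline r}}/\Sigma_{\underline r}}\sigma\cdot x,{\underline q}\rhd{\underline r}}(a_1,\dots,a_s)$; ($\beta$5) $\beta_{x,{\underline r}}(a_0+a_1,a_2,\dots)=\sum_{l+m=r_1}\beta_{x,{\underline r}\circ_1(l,m)}(a_0,a_1,a_2,\dots)$; ($\beta$6) linearity in $x$. With $\beta_{y,R}:=\beta_{\tau\cdot y,{\underline r}}$ for $\tau(R)={\underline r}$, $\beta'(\mathcal P)$ is the full subcategory satisfying ($\beta$7a) $\beta_{1,(1)}(a)=a$ and ($\beta$7b) $\beta_{x,{\underline r}}(\beta_{x_1,{\underline q}_1}(b_1),\dots,\beta_{x_p,{\underline q}_p}(b_p))=\beta_{\sum_\tau\tau\cdot\mu(x\otimes x_1^{\otimes r_1}\otimes\dots\otimes x_p^{\otimes r_p}),{\underline r}\diamond({\underline q}_i)}((b_{ij})_{i,j})$ for $x\in\mathcal P(n)^{\Sigma_{\underline r}}$, $x_i\in\mathcal P(m_i)^{\Sigma_{{\underline q}_i}}$,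 $b_i\in A^{k_i}$, $\tau$ over $\Sigma_{{\underline r}\diamond({\underline q}_i)}/\prod_i\Sigma_{r_i}\wr\Sigma_{{\underline q}_i}$. $\gamma(\mathcal P)$: objects $(A,\gamma)$, $\gamma_{[x]_{\underline r},{\underline r}}:A^p\to A$ for $[x]_{\underline r}\in\Sigma_{\underline r}\backslash\mathcal B(n)$, with ($\gamma$1) $\gamma_{[x]_{\underline r},{\underline r}}(a_1,\dots,a_p)=\gamma_{[\rho^*\cdot x]_{{\underline r}^\rho},{\underline r}^\rho}(a_{\rho^{-1}(1)},\dots,a_{\rho^{-1}(p)})$; ($\gamma$2) $\gamma_{[x]_{(0,{\underline r})},(0,{\underline r})}(a_0,a_1,\dots)=\gamma_{[x]_{\underline r},{\underline r}}(a_1,\dots)$; ($\gamma$3) $\gamma_{[x]_{\underline r},{\underline r}}(\lambda a_1,\dots)=\lambda^{r_1}\gamma_{[x]_{\underline r},{\underline r}}(a_1,\dots)$; ($\gamma$4) $\gamma_{[x]_{\underline r},{\underline r}}$ at ($a_j$ repeated $q_j$ times)$_j$ equals $\frac{|\mathrm{Stab}_{{\underline q}\rhd{\underline r}}(x)|}{|\mathrm{Stab}_{\underline r}(x)|}\gamma_{[x]_{{\underline q}\rhd{\underline r}},{\underline q}\rhd{\underline r}}(a_1,\dots,a_s)$; ($\gamma$5) $\gamma_{[x]_{\underline r},{\underline r}}(a_0+a_1,a_2,\dots)=\sum_{l+m=r_1}\sum_{[y]\in\Sigma_{{\underline r}\circ_1(l,m)}\backslash\Omega_{\Sigma_{\underline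 r}}(x)}\gamma_{[y],{\underline r}\circ_1(l,m)}(a_0,a_1,a_2,\dots)$. With $\gamma_{[y]_R,R}:=\gamma_{[\tau\cdot y]_{\underline r},{\underline r}}$ for $\tau(R)={\underline r}$, $\gamma'(\mathcal P)$ is the full subcategory satisfying ($\gamma$6a) $\gamma_{[1],(1)}(a)=a$; ($\gamma$6b) for $x\in\mathcal B(n)$, $x_i\in\mathcal B(m_i)$, $a_i\in A^{k_i}$, with $X=\mu(x\otimes x_1^{\otimes r_1}\otimes\dots\otimes x_p^{\otimes r_p})$: $\gamma_{[x]_{\underline r},{\underline r}}(\gamma_{[x_1]_{{\underline q}_1},{\underline q}_1}(a_1),\dots,\gamma_{[x_p]_{{\underline q}_p},{\underline q}_p}(a_p))=\frac{|\mathrm{Stab}_{{\underline r}\diamond({\underline q}_i)}(X)|}{|\mathrm{Stab}_{\underline r}(x)|\prod_i|\mathrm{Stab}_{{\underline q}_i}(x_i)|^{r_i}}\gamma_{[X]_{{\underline r}\diamond({\underline q}_i)},{\underline r}\diamond({\underline q}_i)}((a_{ij})_{i,j})$. Morphisms in all categories: linear maps commuting with operations. *)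

(* Defs.v *)
From HB Require Import structures.
From mathcomp Require Import all_boot all_order all_algebra all_fingroup.
From mathcomp Require Import finmap.
From mathcomp.multinomials Require Import monalg.

Set Implicit Arguments.
Unset Strict Implicit.
Unset Printing Implicit Defensive.

Import GRing.Theory.

(* A composition r in Comp_p(n) is a p-tuple (or seq) of nats with     *)
(* sum n; its i-th interval is [off r i, off r i + r_i).               *)

Definition off (r : seq nat) (i : nat) : nat := sumn (take i r).

(* index of the interval of the composition r containing t (t < sumn r) *)
Definition blk (r : seq nat) (t : nat) : nat :=
  count (fun k => sumn (take k.+1 r) <= t)%N (iota 0 (size r)).

Definition pn p (s : 'S_p) (i : nat) : nat :=
  if insub i is Some o then val (s (o : 'I_p)) else i.

(* the permutation of 'I_N given by a function on nat
   (identity if the function does not induce a permutation; it always does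
    in the uses below) *)
Definition mkperm (N : nat) (f : nat -> nat) : 'S_N :=
  let g := fun i : 'I_N => (insubd i (f i) : 'I_N) in
  (if injectiveb g as b return injectiveb g = b -> 'S_N
   then fun H => perm (elimT (injectiveP g) H)
   else fun _ => 1%g) erefl.

(* Sigma_R for the ordered partition of [N] whose block label of t is lab t:
   permutations preserving every block *)
Definition Sig (N : nat) (lab : nat -> nat) : {set 'S_N} :=
  [set s : 'S_N | [forall i : 'I_N, lab (s i) == lab i]].

Definition rtw p (rho : 'S_p) (r : p.-tuple nat) : p.-tuple nat :=
  [tuple tnth r ((rho^-1)%g i) | i < p].

Definition atw (A : Type) p (rho : 'S_p) (a : p.-tuple A) : p.-tuple A :=
  [tuple tnth a ((rho^-1)%g i) | i < p].

(* rho^* : the block permutation of [sumn r] sending the i-th interval of r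
   order-preservingly onto the rho(i)-th interval of r^rho *)
Definition bperm p (rho : 'S_p) (r : p.-tuple nat) : 'S_(sumn r) :=
  mkperm (sumn r) (fun t =>
    off (rtw rho r) (pn rho (blk r t)) + (t - off r (blk r t)))%N.

Definition qr s p (q : s.-tuple nat) (r : p.-tuple nat) : s.-tuple nat :=
  [tuple (\sum_(i < p | blk q i == j) tnth r i)%N | j < s].

Definition rep (A : zmodType) s p (q : s.-tuple nat) (a : s.-tuple A)
  : p.-tuple A := [tuple nth 0%R (val a) (blk q i) | i < p].

Definition split1 p (r : p.+1.-tuple nat) (l m : nat) : p.+2.-tuple nat :=
  [tuple of l :: m :: behead_tuple r].

Definition choices (T : Type) (ss : seq (seq T)) : seq (seq T) :=
  foldr (fun s acc => [seq y :: l | y <- s, l <- acc]) [:: [::]] ss.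

(* Set operads.  B(n) = {b : T | ar b = n}; the symmetric group acts   *)
(* on the left (act n s b = s.b for ar b = n, so s.(t.b) = (s o t).b,  *)
(* and s o t is written t * s in mathcomp); comp x ys = mu(x;y_1..y_n) *)
(* for ar x = size ys.  Values of the operations outside their domain  *)
(* are irrelevant (they are never used).                               *)

Section Operad.
Variables (T : choiceType) (ar : T -> nat)
          (act : forall n, 'S_n -> T -> T) (e : T) (comp : T -> seq T -> T).

(* restriction of a block-preserving tau to the i-th interval of ms *)
Definition restr (ms : seq nat) (tau : 'S_(sumn ms)) (i : nat)
  : 'S_(nth 0 ms i) :=
  mkperm (nth 0 ms i) (fun o => pn tau (off ms i + o) - off ms i)%N.

Definition set_operad : Prop :=
  [/\ (forall n (s : 'S_n) b, ar b = n -> ar (act s b) = n),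
      (forall n b, ar b = n -> act (1%g : 'S_n) b = b),
      (forall n (s t : 'S_n) b, ar b = n -> act s (act t b) = act (t * s)%g b),
      ar e = 1%N &
      (forall x ys, ar x = size ys -> ar (comp x ys) = sumn (map ar ys))] /\
   [/\ (forall y, comp e [:: y] = y),
      (forall x, comp x (nseq (ar x) e) = x),
      (forall x ys zs, ar x = size ys -> sumn (map ar ys) = size zs ->
         comp (comp x ys) zs =
         comp x [seq comp yz.1 yz.2 | yz <- zip ys (reshape (map ar ys) zs)]),
      (forall n (s : 'S_n) x ys, ar x = n -> size ys = n ->
         let ys' := [seq nth e ys (pn s i) | i <- iota 0 n] in
         let rr := [tuple nth 0 (map ar ys') (val i) | i < n] in
         comp (act s x) ys = act (bperm s rr) (comp x ys')) &
      (* equivariance in the y's :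
         mu(x; t_1.y_1,..,t_n.y_n) = (t_1 (+) .. (+) t_n).mu(x; y) *)
      (forall x ys (tau : 'S_(sumn (map ar ys))), ar x = size ys ->
         tau \in Sig (sumn (map ar ys)) (blk (map ar ys)) ->
         comp x [seq act (restr tau i) (nth e ys i) | i <- iota 0 (size ys)]
         = act tau (comp x ys))].

Definition reduced : Prop := forall b, ar b <> 0%N.

(* The linear operad P = F[B].  P(n) is the set of finitely supported  *)
(* F-combinations of elements of arity n inside {malg F[T]}.           *)
Variable F : fieldType.
Local Notation P := {malg F[T]}.

Definition inP (n : nat) (x : P) : Prop := forall b, b \in msupp x -> ar b = n.

Definition pact n (s : 'S_n) (x : P) : P :=
  (\sum_(b <- enum_fset (msupp x)) << x@_b *g act s b >>)%R.

Definition Pcomp (x : P) (ys : seq P) : P :=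
  (\sum_(b <- enum_fset (msupp x))
   \sum_(cs <- choices [seq enum_fset (msupp y) | y <- ys])
     << (x@_b * \prod_(i < size ys) (nth 0 ys i)@_(nth e cs i)) *g comp b cs >>)%R.

Definition invariant n (G : {set 'S_n}) (x : P) : Prop :=
  forall s, s \in G -> pact s x = x.

Definition adm p (r : p.-tuple nat) (x : P) : Prop :=
  inP (sumn r) x /\ invariant (Sig (sumn r) (blk r)) x.

Definition orbit n (G : {set 'S_n}) (x : T) : seq T :=
  undup [seq act s x | s <- enum G].
Definition Osum n (G : {set 'S_n}) (x : T) : P :=
  (\sum_(y <- orbit G x) << y >>)%R.
Definition stab n (G : {set 'S_n}) (x : T) : {set 'S_n} :=
  [set s in G | act s x == x].
Definition subclasses n (H G : {set 'S_n}) (x : T) : seq {fset T} :=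
  undup [seq seq_fset tt (orbit H y) | y <- orbit G x].

Section Diamond.
Variables (p : nat) (r : p.-tuple nat) (k : 'I_p -> nat)
          (qs : forall i : 'I_p, (k i).-tuple nat).

Definition qseq : seq (seq nat) := [seq val (qs i) | i <- enum 'I_p].
Definition mseq : seq nat := [seq sumn (qs i) | i <- enum 'I_p].
(* arities of the n = sumn r inputs of mu(x; x_1^{r_1},..,x_p^{r_p}) *)
Definition msz : seq nat :=
  [seq nth 0 mseq (blk r u) | u <- iota 0 (sumn r)].
Definition Mtot : nat := sumn msz.
(* block label in r o (q_i) of t in [M], block (i,j) encoded as
   k_1 + .. + k_{i-1} + j *)
Definition dlab (t : nat) : nat :=
  let u := blk msz t in let i := blk r u in
  (off (map size qseq) i + blk (nth [::] qseq i) (t - off msz u))%N.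
Definition dseq : seq nat :=
  flatten [seq [seq (tnth r i * c)%N | c <- val (qs i)] | i <- enum 'I_p].
Definition dcomp : (size dseq).-tuple nat := in_tuple dseq.
Definition Sdiam : {set 'S_Mtot} := Sig Mtot dlab.
(* prod_i Sigma_{r_i} wr Sigma_{q_i} : permutations mapping each input block
   onto an input block and preserving the labels of r o (q_i) *)
Definition Wr : {set 'S_Mtot} :=
  [set s : 'S_Mtot |
     [forall t : 'I_Mtot, forall t' : 'I_Mtot,
        (blk msz t == blk msz t') ==> (blk msz (s t) == blk msz (s t'))]
     && [forall t : 'I_Mtot, dlab (s t) == dlab t]].
Definition dargs (A : zmodType) (b : forall i : 'I_p, (k i).-tuple A)
  : (size dseq).-tuple A :=
  [tuple nth 0%R (flatten [seq val (b i) | i <- enum 'I_p]) t | t < size dseq].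
End Diamond.

Variable A : lmodType F.
Local Open Scope ring_scope.

Definition betaOps := forall p, p.-tuple nat -> P -> p.-tuple A -> A.
Definition gammaOps := forall p, p.-tuple nat -> T -> p.-tuple A -> A.

Definition is_beta (be : betaOps) : Prop :=
  [/\
      (forall p (r : p.-tuple nat) x (rho : 'S_p) (a : p.-tuple A), adm r x ->
         be p r x a = be p (rtw rho r) (pact (bperm rho r) x) (atw rho a)),
      (forall p (r : p.-tuple nat) x (a0 : A) (a : p.-tuple A), adm r x ->
         be p.+1 [tuple of 0%N :: r] x [tuple of a0 :: a] = be p r x a),
      (forall p (r : p.+1.-tuple nat) x (c : F) (a0 : A) (a : p.-tuple A),
         adm r x ->
         be p.+1 r x [tuple of c *: a0 :: a]
         = c ^+ (thead r) *: be p.+1 r x [tuple of a0 :: a]),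
      (forall s p (q : s.-tuple nat) (r : p.-tuple nat) x (a : s.-tuple A),
         sumn q = p -> adm r x ->
         be p r x (rep p q a)
         = be s (qr q r)
              (\sum_(C in rcosets (Sig (sumn r) (blk r))
                                  (Sig (sumn r) (blk (qr q r))))
                  pact (repr C) x) a) &
      (
      (forall p (r : p.+1.-tuple nat) x (a0 a1 : A) (a : p.-tuple A),
         adm r x ->
         be p.+1 r x [tuple of (a0 + a1) :: a]
         = \sum_(l < (thead r).+1)
             be p.+2 (split1 r l (thead r - l)%N) x [tuple of a0 :: a1 :: a]) /\
      (forall p (r : p.-tuple nat) x y (c : F) (a : p.-tuple A),
         adm r x -> adm r y ->
         be p r (c *: x + y) a = c *: be p r x a + be p r y a))].

Definition is_beta' (be : betaOps) : Prop :=
  [/\ is_beta be,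
      (forall a : A, be 1%N [tuple 1%N] << e >> [tuple a] = a) &
      (forall p (r : p.-tuple nat) (x : P) (k : 'I_p -> nat)
              (qs : forall i, (k i).-tuple nat) (xs : 'I_p -> P)
              (b : forall i, (k i).-tuple A),
         adm r x -> (forall i, adm (qs i) (xs i)) ->
         let xl := [seq xs i | i <- enum 'I_p] in
         let X := Pcomp x [seq nth 0 xl (blk r j) | j <- iota 0 (sumn r)] in
         let Y := \sum_(C in rcosets (Wr r qs) (Sdiam r qs))
                    pact (repr C) X in
         forall tau : 'S_(Mtot r qs),
           (forall t : 'I_(Mtot r qs), blk (dcomp r qs) (tau t) = dlab r qs t) ->
           be p r x [tuple be (k i) (qs i) (xs i) (b i) | i < p]
           = be (size (dseq r qs)) (dcomp r qs) (pact tau Y) (dargs r qs b))].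

Definition is_gamma (ga : gammaOps) : Prop :=
  [/\ (* well-definedness: gamma only depends on the class [x]_r *)
      (forall p (r : p.-tuple nat) x (s : 'S_(sumn r)) (a : p.-tuple A),
         ar x = sumn r -> s \in Sig (sumn r) (blk r) ->
         ga p r (act s x) a = ga p r x a),
      (forall p (r : p.-tuple nat) x (rho : 'S_p) (a : p.-tuple A),
         ar x = sumn r ->
         ga p r x a = ga p (rtw rho r) (act (bperm rho r) x) (atw rho a)),
      (forall p (r : p.-tuple nat) x (a0 : A) (a : p.-tuple A),
         ar x = sumn r ->
         ga p.+1 [tuple of 0%N :: r] x [tuple of a0 :: a] = ga p r x a),
      (forall p (r : p.+1.-tuple nat) x (c : F) (a0 : A) (a : p.-tuple A),
         ar x = sumn r ->
         ga p.+1 r x [tuple of c *: a0 :: a]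
         = c ^+ (thead r) *: ga p.+1 r x [tuple of a0 :: a]) &
      (
      (forall s p (q : s.-tuple nat) (r : p.-tuple nat) x (a : s.-tuple A),
         sumn q = p -> ar x = sumn r ->
         ga p r x (rep p q a)
         = (#|stab (Sig (sumn r) (blk (qr q r))) x|
              %/ #|stab (Sig (sumn r) (blk r)) x|)%N%:R *: ga s (qr q r) x a) /\
      (forall p (r : p.+1.-tuple nat) x (a0 a1 : A) (a : p.-tuple A),
         ar x = sumn r ->
         ga p.+1 r x [tuple of (a0 + a1) :: a]
         = \sum_(l < (thead r).+1)
             \sum_(C <- subclasses
                      (Sig (sumn r) (blk (split1 r l (thead r - l)%N)))
                      (Sig (sumn r) (blk r)) x)
               ga p.+2 (split1 r l (thead r - l)%N) (head x (enum_fset C))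
                  [tuple of a0 :: a1 :: a]))].

Definition is_gamma' (ga : gammaOps) : Prop :=
  [/\ is_gamma ga,
      (forall a : A, ga 1%N [tuple 1%N] e [tuple a] = a) &
      (forall p (r : p.-tuple nat) (x : T) (k : 'I_p -> nat)
              (qs : forall i, (k i).-tuple nat) (xs : 'I_p -> T)
              (b : forall i, (k i).-tuple A),
         ar x = sumn r -> (forall i, ar (xs i) = sumn (qs i)) ->
         let xl := [seq xs i | i <- enum 'I_p] in
         let X := comp x [seq nth e xl (blk r j) | j <- iota 0 (sumn r)] in
         forall tau : 'S_(Mtot r qs),
           (forall t : 'I_(Mtot r qs), blk (dcomp r qs) (tau t) = dlab r qs t) ->
           ga p r x [tuple ga (k i) (qs i) (xs i) (b i) | i < p]
           = (#|stab (Sdiam r qs) X|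
                %/ (#|stab (Sig (sumn r) (blk r)) x|
                    * \prod_(i < p) #|stab (Sig (sumn (qs i)) (blk (qs i))) (xs i)|
                                      ^ (tnth r i)))%N%:R
             *: ga (size (dseq r qs)) (dcomp r qs) (act tau X) (dargs r qs b))].

Definition Pfun (be : betaOps) : gammaOps :=
  fun p r x a => be p r (Osum (Sig (sumn r) (blk r)) x) a.

(* equality of objects (operations are only defined on their domains) *)
Definition beta_eq (be1 be2 : betaOps) : Prop :=
  forall p (r : p.-tuple nat) x (a : p.-tuple A),
    adm r x -> be1 p r x a = be2 p r x a.
Definition gamma_eq (ga1 ga2 : gammaOps) : Prop :=
  forall p (r : p.-tuple nat) x (a : p.-tuple A),
    ar x = sumn r -> ga1 p r x a = ga2 p r x a.

End Operad.

Definition beta_mor (T : choiceType) (ar : T -> nat)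
  (act : forall n, 'S_n -> T -> T) (F : fieldType) (A A' : lmodType F)
  (f : {linear A -> A'}) (be : betaOps T A) (be' : betaOps T A') : Prop :=
  forall p (r : p.-tuple nat) x (a : p.-tuple A),
    adm ar act r x -> f (be p r x a) = be' p r x (map_tuple f a).
Definition gamma_mor (T : choiceType) (ar : T -> nat) (F : fieldType)
  (A A' : lmodType F)
  (f : {linear A -> A'}) (ga : gammaOps T A) (ga' : gammaOps T A') : Prop :=
  forall p (r : p.-tuple nat) x (a : p.-tuple A),
    ar x = sumn r -> f (ga p r x a) = ga' p r x (map_tuple f a).

(* Main.v *)
Require Import Defs.
From mathcomp Require Import all_boot all_order all_algebra all_fingroup.
From mathcomp Require Import finmap.
From mathcomp.multinomials Require Import monalg.
From mathcomp Require Import zify.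

Set Implicit Arguments.
Unset Strict Implicit.
Unset Printing Implicit Defensive.

Import GRing.Theory.
(* [orbit] and [invariant] must denote the notions of [Defs], not mathcomp's. *)
Import Defs.

(** Every invariant [x] of [P(n)] is a linear combination of orbit sums, and both
    kinds of structure are linear in [x]; so [beta] is determined by the operations
    [gamma_[x] = beta_(O x)], and each axiom other than (7b) may be checked on orbit
    sums.  Write [Tr_H^G] for the sum over [G/H].  Counting gives
    [Tr_H^G (O_H x) = (|Stab_G x| / |Stab_H x|) O_G x], which matches (beta4) with
    (gamma4).  The wreath product [W] acts on the pairs formed by an element of the
    orbit of [x] and a family of elements of the orbits of the [x_i], with
    stabilizer of order [|Stab x| prod |Stab x_i|^(r_i)]; as [B(0)] is empty, all
    blocks are nonempty and [W] is faithfully a group of permutations.  The same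
    count then matches (beta7b) on orbit sums with (gamma6b).

    Axiom (7b) is not linear in the [x_i].  If [x_i0 = c y + z], the left-hand side
    expands by (beta5) into a sum over [l + m = r_i0] of operations where the
    index [i0] is split into two; on the right-hand side
    [mu(x; .., (c y + z)^(r_i0), ..)] is the sum over [l] of [c^l] times the trace,
    from the stabilizer of the splitting to [W], of [mu(x; .., y^l z^m, ..)], and
    transitivity of traces together with (beta1) and (beta4) identifies the two.
    Induction on the supports of the [x_i] reduces (7b) to orbit sums. *)

(** * Intervals of a composition *)

(** Indices of multiplicity zero shape the induction for (7b). Splitting [x_i0] produces terms with
    [l = 0] or [m = 0]; moreover, at an index with [r_i = 0] the element [x_i] may be 0 and [q_i]
    may have sum 0, whereas the description of the wreath group needs nonempty blocks. Such indices
    are deleted before the next split. A split adds one index and lowers the sum of the sizes [nu]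
    of the [x_i]; a deletion removes one index. Hence the measure [2 * sum nu + p].

    In positive characteristic the order of a stabilizer may vanish in [F]. Orbits are therefore
    counted in [nat], and a quotient of orders is mapped to [F] only after the division has been
    shown exact.

    The groups ['S_(sumn r)] for different compositions with equal sums are different types.
    Statements therefore take a size [N] with an equation, and partitions are given by label
    functions on [nat]: a Young subgroup depends only on which labels coincide, and a change of
    index set becomes a map of labels. *)

Lemma offS (r : seq nat) i : off r i.+1 = (off r i + nth 0 r i)%N.
Proof.
rewrite /off; elim: r i => [|x r IH] [|i] //=; first by rewrite take0 addn0.
by rewrite IH addnA.
Qed.

Lemma off0 (r : seq nat) : off r 0 = 0%N.
Proof. by rewrite /off take0. Qed.

Lemma off_cons x (r : seq nat) i : off (x :: r) i.+1 = (x + off r i)%N.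
Proof. by []. Qed.

Lemma off_le (r : seq nat) i j : (i <= j)%N -> (off r i <= off r j)%N.
Proof.
elim: j => [|j IH]; first by rewrite leqn0 => /eqP ->.
rewrite leq_eqVlt => /predU1P[-> //|/IH le_ij].
by rewrite offS (leq_trans le_ij) ?leq_addr.
Qed.

Lemma off_size (r : seq nat) i : (size r <= i)%N -> off r i = sumn r.
Proof. by move=> le_ri; rewrite /off take_oversize. Qed.

Lemma blk_cons x (r : seq nat) t :
  blk (x :: r) t = if (t < x)%N then 0%N else (blk r (t - x)).+1.
Proof.
rewrite /blk /= take0 /= addn0 -[1%N]/(1 + 0)%N iotaDl count_map.
case: (ltnP t x) => [lt_tx|le_xt]; last first.
  rewrite add1n; congr _.+1; apply: eq_in_count => k _ /=.
  by rewrite leq_subRL.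
rewrite add0n; apply/eqP; rewrite -leqn0 leqNgt -has_count.
apply/hasPn=> k _ /=; rewrite -ltnNge.
by rewrite (leq_trans lt_tx) ?leq_addr.
Qed.

Lemma blk_lt (r : seq nat) t : (t < sumn r)%N -> (blk r t < size r)%N.
Proof.
elim: r t => [|x r IH] t //=; rewrite blk_cons.
case: (ltnP t x) => // le_xt lt_t; apply: IH.
by rewrite ltn_subLR.
Qed.

Lemma blk_offE (r : seq nat) i o :
  (o < nth 0 r i)%N -> blk r (off r i + o) = i.
Proof.
elim: r i => [|x r IH] [|i] //=.
  by rewrite off0 blk_cons => ->.
move=> lt_o; rewrite blk_cons off_cons -addnA ltnNge leq_addr /= addKn.
by rewrite IH.
Qed.

Lemma blk_off_le (r : seq nat) t :
  (t < sumn r)%N -> (off r (blk r t) <= t)%N.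
Proof.
elim: r t => [|x r IH] t //=; rewrite blk_cons.
case: (ltnP t x) => [|le_xt lt_t]; first by rewrite off0.
rewrite off_cons -leq_subRL // IH //; by rewrite ltn_subLR.
Qed.

Lemma blk_sub_lt (r : seq nat) t :
  (t < sumn r)%N -> (t - off r (blk r t) < nth 0 r (blk r t))%N.
Proof.
elim: r t => [|x r IH] t //=; rewrite blk_cons.
case: (ltnP t x) => [|le_xt lt_t]; first by rewrite off0 subn0.
by rewrite off_cons /= subnDA IH // ltn_subLR.
Qed.

Lemma off_add_lt (r : seq nat) i o :
  (o < nth 0 r i)%N -> (off r i + o < sumn r)%N.
Proof.
move=> lt_o; have lt_i : (i < size r)%N.
  by rewrite ltnNge; apply/negP=> le_ri; rewrite nth_default in lt_o.
rewrite -(off_size (leqnn (size r))).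
apply: leq_trans (off_le r lt_i).
by rewrite offS ltn_add2l.
Qed.

Lemma blk_coord (r : seq nat) t :
  (t < sumn r)%N ->
  exists2 o, (o < nth 0 r (blk r t))%N & t = (off r (blk r t) + o)%N.
Proof.
move=> lt_t; exists (t - off r (blk r t))%N; first exact: blk_sub_lt.
by rewrite subnKC ?blk_off_le.
Qed.

Lemma blk_uniq (r : seq nat) t i :
  (off r i <= t < off r i.+1)%N -> blk r t = i.
Proof.
case/andP=> le_t lt_t; rewrite -(subnKC le_t) blk_offE //.
by rewrite ltn_subLR // -offS.
Qed.

Lemma blk_gt_off (r : seq nat) t i :
  (t < sumn r)%N -> (i <= blk r t)%N = (off r i <= t)%N.
Proof.
move=> lt_t; apply/idP/idP => [le_i|].
  exact: leq_trans (off_le r le_i) (blk_off_le lt_t).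
apply: contraTT; rewrite -!ltnNge => lt_i.
apply: leq_trans (off_le r lt_i).
by rewrite offS -ltn_subLR ?blk_off_le // blk_sub_lt.
Qed.

Lemma offE (r : seq nat) i : off r i = (\sum_(j < i) nth 0 r j)%N.
Proof.
by elim: i => [|i IH]; rewrite ?off0 ?big_ord0 // offS IH big_ord_recr.
Qed.

Lemma nth_tnth p (r : p.-tuple nat) (i : 'I_p) : nth 0 r i = tnth r i.
Proof. by rewrite (tnth_nth 0). Qed.

Lemma sumn_tuple p (r : p.-tuple nat) : sumn r = (\sum_(i < p) tnth r i)%N.
Proof.
rewrite -(@off_size r p) ?size_tuple // offE.
by apply: eq_bigr => i _; rewrite nth_tnth.
Qed.

Lemma count_iota_card N (P : pred nat) :
  count P (iota 0 N) = #|[set t : 'I_N | P t]|.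
Proof.
rewrite -sum1_card -sum1_count -{1}(subn0 N) -/(index_iota 0 N) big_mkord.
by apply: eq_bigl => t; rewrite inE.
Qed.

Lemma count_blk (r : seq nat) j :
  count (fun t => blk r t == j) (iota 0 (sumn r)) = if (j < size r)%N then nth 0 r j else 0%N.
Proof.
elim: r j => [|x r IH] j //=; rewrite iotaD count_cat add0n.
have -> : count (fun t => blk (x :: r) t == j) (iota 0 x) = (j == 0%N) * x.
  have -> : count (fun t => blk (x :: r) t == j) (iota 0 x)
            = count (fun=> j == 0%N) (iota 0 x).
    apply: eq_in_count => t; rewrite mem_iota blk_cons /= => ->.
    by rewrite eq_sym.
  by case: (j == 0%N); rewrite ?count_predT ?count_pred0 ?size_iota ?mul1n.
have -> : iota x (sumn r) = map (addn x) (iota 0 (sumn r)).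
  by rewrite -iotaDl addn0.
rewrite count_map.
have eqP t : preim (addn x) (fun t => blk (x :: r) t == j) t
             = ((blk r t).+1 == j).
  by rewrite /= blk_cons ltnNge leq_addr /= addKn.
rewrite (eq_count eqP); case: j {eqP} => [|j] /=.
  by rewrite mul1n count_pred0 addn0.
by rewrite mul0n add0n -IH; apply: eq_count => t /=; rewrite eqSS.
Qed.

Lemma blk_content (r : seq nat) j :
  (count (fun t => blk r t == j) (iota 0 (sumn r)) = nth 0 r j)%N.
Proof. by rewrite count_blk; case: ltnP => // ?; rewrite nth_default. Qed.

Lemma pnE p (s : 'S_p) (i : 'I_p) : pn s i = s i.
Proof. by rewrite /pn valK. Qed.

Lemma pn_lt p (s : 'S_p) i : (i < p)%N -> (pn s i < p)%N.
Proof. by move=> lt_ip; rewrite -[i]/(val (Ordinal lt_ip)) pnE ltn_ord. Qed.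

Lemma pnK p (s : 'S_p) i : pn s^-1 (pn s i) = i.
Proof.
rewrite {2}/pn; case: insubP => [o lt_i <-|nlt]; last by rewrite /pn insubN.
by rewrite pnE permK.
Qed.

Lemma pnKV p (s : 'S_p) i : pn s (pn s^-1 i) = i.
Proof. by rewrite -{1}[s]invgK pnK. Qed.

Lemma pn_inj p (s : 'S_p) : injective (pn s).
Proof. exact: can_inj (pnK s). Qed.

Lemma pnM p (s t : 'S_p) i : pn (s * t) i = pn t (pn s i).
Proof.
have [lt_i|nlt] := boolP (i < p)%N; last by rewrite /pn !insubN.
by rewrite -[i]/(val (Ordinal lt_i)) !pnE permM.
Qed.

Lemma pn1 p i : pn (1 : 'S_p) i = i.
Proof. by rewrite /pn; case: insubP => // o _ <-; rewrite perm1. Qed.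

Lemma eq_pn p (s t : 'S_p) :
  (forall i, (i < p)%N -> pn s i = pn t i) -> s = t.
Proof.
move=> eq_st; apply/permP=> i; apply: val_inj.
by move: (eq_st i (ltn_ord i)); rewrite !pnE.
Qed.

Lemma mkpermE N (f : nat -> nat) :
  (forall i, i < N -> f i < N)%N ->
  (forall i j, (i < N)%N -> (j < N)%N -> f i = f j -> i = j) ->
  forall i, (i < N)%N -> pn (mkperm N f) i = f i.
Proof.
move=> lt_f inj_f i lt_i; rewrite -[i]/(val (Ordinal lt_i)) pnE /mkperm.
set g := fun _ : 'I_N => _.
have gE (j : 'I_N) : val (g j) = f j by rewrite /g val_insubd lt_f.
have inj_g : injectiveb g.
  apply/injectiveP=> j k /(congr1 val); rewrite !gE => eq_jk.
  by apply: ord_inj; apply: inj_f eq_jk.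
(* [mkperm] branches on [injectiveb g] together with a proof of its value; the case split needs that
   proof generalised first. *)
move: (erefl (injectiveb g)).
case: {2 3}(injectiveb g) => [H|]; last by rewrite inj_g.
by rewrite permE -gE.
Qed.

Lemma mkperm_pn N (s : 'S_N) (f : nat -> nat) :
  (forall i, (i < N)%N -> f i = pn s i) -> mkperm N f = s.
Proof.
move=> eq_f; apply: eq_pn => i lt_i; rewrite mkpermE ?eq_f //.
  by move=> j lt_j; rewrite eq_f // pn_lt.
by move=> j k lt_j lt_k; rewrite !eq_f // => /pn_inj.
Qed.

(** The words [lab] and [blk d] contain every label equally often, hence differ by a permutation of
    positions. Such a [tau] is what the operations indexed by an ordered partition are defined
    with. *)
Lemma sort_labels N (lab : nat -> nat) (d : seq nat) :
  N = sumn d ->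
  (forall j, count (fun t => lab t == j) (iota 0 N) = nth 0 d j) ->
  exists tau : 'S_N, forall t : 'I_N, blk d (tau t) = lab t.
Proof.
move=> eq_N eq_d.
have /tuple_permP[p Ep] :
    perm_eq (map_tuple lab (iota_tuple N 0)) (map_tuple (blk d) (iota_tuple N 0)).
  apply/allP=> j _ /=; apply/eqP; rewrite !count_map.
  by apply: etrans (eq_d j) _; rewrite -blk_content -eq_N.
exists p => t; move/val_inj/(congr1 (fun s : N.-tuple nat => tnth s t)): Ep.
by rewrite tnth_mktuple !tnth_map !(tnth_nth 0) /= !nth_iota.
Qed.

(** Converse of [sort_labels]: a labelling determines the entries of any composition that sorts it,
    which later identifies two compositions. *)
Lemma labels_content N (lab : nat -> nat) (d : seq nat) (tau : 'S_N) j :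
  N = sumn d -> (forall t : 'I_N, blk d (tau t) = lab t) ->
  count (fun t => lab t == j) (iota 0 N) = nth 0 d j.
Proof.
move=> eq_N eq_d; rewrite -blk_content -eq_N !count_iota_card.
rewrite -[RHS](card_preimset _ (@perm_inj _ tau)); apply: eq_card => t.
by rewrite !inE eq_d.
Qed.

Lemma SigP N (lab : nat -> nat) (s : 'S_N) :
  reflect (forall i : 'I_N, lab (s i) = lab i) (s \in Sig N lab).
Proof. by rewrite inE; apply: 'forall_eqP. Qed.

Lemma group_set_Sig N lab : group_set (Sig N lab).
Proof.
apply/group_setP; split; first by apply/SigP=> i; rewrite perm1.
by move=> s t /SigP Hs /SigP Ht; apply/SigP=> i; rewrite permM Ht Hs.
Qed.

Canonical Sig_group N lab := Group (group_set_Sig N lab).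

Lemma eq_Sig N (lab1 lab2 : nat -> nat) :
  (forall t t' : 'I_N, (lab1 t == lab1 t') = (lab2 t == lab2 t')) ->
  Sig N lab1 = Sig N lab2.
Proof.
by move=> eq_lab; apply/setP=> s; rewrite !inE; apply: eq_forallb => i.
Qed.

Lemma sub_Sig N (lab1 lab2 : nat -> nat) :
  (forall t t' : 'I_N, lab1 t = lab1 t' -> lab2 t = lab2 t') ->
  Sig N lab1 \subset Sig N lab2.
Proof.
move=> sub_lab; apply/subsetP=> s /SigP Hs; apply/SigP=> i.
exact: sub_lab (Hs i).
Qed.

Lemma tnth_rtw p (rho : 'S_p) (r : p.-tuple nat) (i : 'I_p) :
  tnth (rtw rho r) (rho i) = tnth r i.
Proof. by rewrite tnth_mktuple permK. Qed.

Lemma sumn_rtw p (rho : 'S_p) (r : p.-tuple nat) : sumn (rtw rho r) = sumn r.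
Proof.
rewrite !sumn_tuple (reindex_inj (@perm_inj _ rho)).
by apply: eq_bigr => i _; rewrite tnth_rtw.
Qed.

Lemma nth_rtw p (rho : 'S_p) (r : p.-tuple nat) i :
  (i < p)%N -> nth 0 (rtw rho r) (pn rho i) = nth 0 r i.
Proof.
move=> lt_i; rewrite -[i]/(val (Ordinal lt_i)) pnE.
by rewrite !nth_tnth tnth_rtw.
Qed.

Lemma bpermE p (rho : 'S_p) (r : p.-tuple nat) t :
  (t < sumn r)%N ->
  pn (bperm rho r) t
  = (off (rtw rho r) (pn rho (blk r t)) + (t - off r (blk r t)))%N.
Proof.
have lt_o u : (u < sumn r)%N ->
    (u - off r (blk r u) < nth 0 (rtw rho r) (pn rho (blk r u)))%N.
  move=> lt_u; rewrite nth_rtw ?blk_sub_lt //.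
  by have := blk_lt lt_u; rewrite size_tuple.
apply: mkpermE => [u lt_u|u v lt_u lt_v eq_uv].
  by rewrite -[X in (_ < X)%N](sumn_rtw rho r) off_add_lt ?lt_o.
have eq_b : blk r u = blk r v.
  apply: (@pn_inj _ rho); rewrite -(blk_offE (lt_o u lt_u)) eq_uv.
  by rewrite blk_offE ?lt_o.
move: eq_uv; rewrite eq_b => /addnI eq_o.
by rewrite -(subnKC (blk_off_le lt_u)) -(subnKC (blk_off_le lt_v)) eq_b eq_o.
Qed.

Lemma blk_bperm p (rho : 'S_p) (r : p.-tuple nat) t :
  (t < sumn r)%N ->
  blk (rtw rho r) (pn (bperm rho r) t) = pn rho (blk r t).
Proof.
move=> lt_t; rewrite bpermE // blk_offE // nth_rtw ?blk_sub_lt //.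
by have := blk_lt lt_t; rewrite size_tuple.
Qed.

(** By monotonicity the [j] with [f j < i] form an initial segment, so every offset of [r] is an
    offset of [r']. This serves for [qr], for the splitting of an entry and for the insertion of a
    zero entry. *)
Lemma blk_merge (r r' : seq nat) (f : nat -> nat) t :
  (forall i j, (i <= j < size r')%N -> (f i <= f j)%N) ->
  (forall i, nth 0 r i = \sum_(j < size r' | f j == i) nth 0 r' j)%N ->
  (t < sumn r')%N -> blk r t = f (blk r' t).
Proof.
move=> mono_f eq_r lt_t; have lt_b := blk_lt lt_t.
have offf i : off r i = (\sum_(j < size r' | (f j < i)) nth 0 r' j)%N.
  elim: i => [|i IH]; first by rewrite off0 big_pred0.
  rewrite offS IH eq_r addnC [RHS](bigID (fun j : 'I__ => f j == i)) /=; congr addn.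
    by apply: eq_bigl => j; rewrite ltnS andbC; case: eqP => // ->; rewrite leqnn.
  by apply: eq_bigl => j; rewrite ltnS ltn_neqAle andbC.
have offle i (P : pred nat) : (i <= size r')%N ->
    (forall j, j < size r' -> P j -> j < i)%N ->
    (\sum_(j < size r' | P j) nth 0 r' j <= off r' i)%N.
  move=> le_i sub_P; rewrite offE (big_ord_widen _ (fun j => nth 0 r' j) le_i).
  rewrite big_mkcond [X in (_ <= X)%N]big_mkcond /=; apply: leq_sum => j _.
  by case: ifP => // /(sub_P _ (ltn_ord j)) ->.
have offge i (P : pred nat) : (i <= size r')%N ->
    (forall j, j < i -> P j)%N ->
    (off r' i <= \sum_(j < size r' | P j) nth 0 r' j)%N.
  move=> le_i sub_P; rewrite offE (big_ord_widen _ (fun j => nth 0 r' j) le_i).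
  rewrite big_mkcond [X in (_ <= X)%N]big_mkcond /=; apply: leq_sum => j _.
  by case: ifP => // /sub_P ->.
apply: blk_uniq; rewrite !offf; apply/andP; split.
  apply: leq_trans (blk_off_le lt_t); apply: (offle _ (fun j => f j < _)%N); first exact: ltnW.
  move=> j lt_j; rewrite !ltnNge; apply: contra => le_j.
  by apply: mono_f; rewrite le_j.
have : (t < off r' (blk r' t).+1)%N.
  by rewrite ltnNge -blk_gt_off // ltnn.
move/leq_trans; apply; apply: (offge _ (fun j => f j < _)%N) => // j.
by rewrite !ltnS => le_j; apply: mono_f; rewrite le_j.
Qed.

Lemma blk_mono (q : seq nat) i j :
  (i <= j < sumn q)%N -> (blk q i <= blk q j)%N.
Proof.
case/andP=> le_ij lt_j; rewrite blk_gt_off // (leq_trans _ le_ij) //.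
exact/blk_off_le/(leq_ltn_trans le_ij).
Qed.

Lemma nth_qr s p (q : s.-tuple nat) (r : p.-tuple nat) j :
  sumn q = p ->
  nth 0 (qr q r) j = (\sum_(i < size r | blk q i == j) nth 0 r i)%N.
Proof.
move=> eq_p; rewrite size_tuple.
have [lt_j|le_j] := ltnP j s; last first.
  rewrite nth_default ?size_tuple // big_pred0 // => i.
  apply: contra_leqF le_j => /eqP <-.
  have := @blk_lt q i; rewrite size_tuple; apply.
  by rewrite eq_p.
rewrite (nth_tnth _ (Ordinal lt_j)) tnth_mktuple.
by apply: eq_bigr => i _; rewrite nth_tnth.
Qed.

Lemma blk_qr s p (q : s.-tuple nat) (r : p.-tuple nat) t :
  sumn q = p -> (t < sumn r)%N -> blk (qr q r) t = blk q (blk r t).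
Proof.
move=> eq_p lt_t; apply: blk_merge => // [i j|i].
  by rewrite size_tuple -eq_p; apply: blk_mono.
exact: nth_qr.
Qed.

Lemma sumn_qr s p (q : s.-tuple nat) (r : p.-tuple nat) :
  sumn q = p -> sumn (qr q r) = sumn r.
Proof.
move=> eq_p; rewrite !sumn_tuple.
under eq_bigr do rewrite tnth_mktuple.
rewrite (exchange_big_dep xpredT) //=; apply: eq_bigr => i _.
have lt_b : (blk q i < s)%N.
  by have := @blk_lt q i; rewrite size_tuple eq_p; apply.
by rewrite (big_pred1 (Ordinal lt_b)) // => j; rewrite eq_sym.
Qed.

Lemma blk_ltT p (r : p.-tuple nat) t : (t < sumn r)%N -> (blk r t < p)%N.
Proof. by move/blk_lt; rewrite size_tuple. Qed.

Lemma count_sum N (Q : pred nat) : count Q (iota 0 N) = (\sum_(t < N) Q t)%N.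
Proof.
rewrite count_iota_card -sum1_card big_mkcond; apply: eq_bigr => t _.
by rewrite inE; case: (Q t).
Qed.

Lemma tuple_cons_behead U p (a : p.+1.-tuple U) :
  a = [tuple of thead a :: behead_tuple a].
Proof. by rewrite {1}(tuple_eta a); apply: val_inj. Qed.

(** * Linear extensions, orbit sums and traces *)

Section LinearExtension.
Variables (T : choiceType) (F : fieldType).
Local Open Scope ring_scope.
Implicit Types (V : lmodType F) (x y : {malg F[T]}).

Definition lin V x (h : T -> V) : V :=
  \sum_(b <- enum_fset (msupp x)) x@_b *: h b.

Lemma linEw V (D : seq T) x (h : T -> V) :
  uniq D -> {subset enum_fset (msupp x) <= D} ->
  lin x h = \sum_(b <- D) x@_b *: h b.
Proof.
move=> uD sxD; rewrite [RHS](bigID (fun b => b \in msupp x)) /=.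
rewrite [X in _ + X]big1 ?addr0; last first.
  by move=> b /mcoeff_outdom ->; rewrite scale0r.
rewrite -big_filter /lin; apply: perm_big.
apply: uniq_perm; rewrite ?filter_uniq ?fset_uniq // => b.
rewrite mem_filter; apply/idP/andP => [bx|[]//]; split => //; exact: sxD.
Qed.

Lemma linP V c x y (h : T -> V) :
  lin (c *: x + y) h = c *: lin x h + lin y h.
Proof.
(* Sums over three different supports become comparable on one common duplicate-free list. *)
pose D := undup (enum_fset (msupp x) ++ enum_fset (msupp y)
                 ++ enum_fset (msupp (c *: x + y))).
have uD : uniq D by exact: undup_uniq.
rewrite !(@linEw _ D) //; try by move=> b b_in; rewrite mem_undup !mem_cat b_in ?orbT.
rewrite scaler_sumr -big_split /=; apply: eq_bigr => b _.
by rewrite mcoeffD mcoeffZ scalerDl scalerA.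
Qed.

Lemma lin0 V (h : T -> V) : lin 0 h = 0.
Proof. by rewrite /lin big1 // => b _; rewrite mcoeff0 scale0r. Qed.

Lemma linD V x y (h : T -> V) : lin (x + y) h = lin x h + lin y h.
Proof. by rewrite -{1}[x]scale1r linP scale1r. Qed.

Lemma linZ V c x (h : T -> V) : lin (c *: x) h = c *: lin x h.
Proof. by rewrite -[c *: x]addr0 linP lin0 addr0. Qed.

Lemma lin_sum V I (s : seq I) (Q : pred I) (g : I -> {malg F[T]}) (h : T -> V) :
  lin (\sum_(i <- s | Q i) g i) h = \sum_(i <- s | Q i) lin (g i) h.
Proof. exact: (big_morph (fun z => lin z h) (fun x y => linD x y h) (lin0 h)). Qed.

Lemma linU V b (h : T -> V) : lin << b >> h = h b.
Proof.
rewrite (@linEw _ [:: b]) // ?big_seq1 ?mcoeffUU ?scale1r // => c c_in.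
by move: (fsubsetP msuppU_le _ c_in); rewrite !inE.
Qed.

Lemma eq_lin V x (h h' : T -> V) :
  (forall b, b \in msupp x -> h b = h' b) -> lin x h = lin x h'.
Proof. by move=> eq_h; apply: eq_big_seq => b /eq_h ->. Qed.

Lemma malgUZ (c : F) (b : T) : << c *g b >> = c *: << b >>.
Proof. by apply/malgP=> k; rewrite mcoeffZ !mcoeffU mulr_natr. Qed.

Lemma lin_id x : lin x (fun b => << b >>) = x.
Proof.
by rewrite [RHS]monalgE; apply: eq_bigr => b _; rewrite malgUZ.
Qed.

Lemma lin_lin V x (k : T -> {malg F[T]}) (h : T -> V) :
  lin (lin x k) h = lin x (fun b => lin (k b) h).
Proof. by rewrite lin_sum; apply: eq_bigr => b _; rewrite linZ. Qed.

Lemma lin_exchange V I (s : seq I) (Q : pred I) x (h : I -> T -> V) :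
  lin x (fun b => \sum_(i <- s | Q i) h i b) = \sum_(i <- s | Q i) lin x (h i).
Proof.
by rewrite [RHS]exchange_big; apply: eq_bigr => b _; rewrite scaler_sumr.
Qed.

Lemma linZr V x (c : F) (h : T -> V) :
  lin x (fun b => c *: h b) = c *: lin x h.
Proof.
by rewrite scaler_sumr; apply: eq_bigr => b _; rewrite !scalerA mulrC.
Qed.

End LinearExtension.

Lemma rcosets_repr N (G H : {group 'S_N}) C :
  H \subset G -> C \in rcosets H G ->
  repr C \in G /\ C = (H :* repr C)%g.
Proof.
move=> sHG /rcosetsP[g gG ->]; rewrite rcoset_repr; split=> //.
by case: repr_rcosetP => h hH; rewrite groupM // (subsetP sHG).
Qed.

(** Orbit-stabilizer principle: [K] separates exactly the cosets of [H], so the list of its values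
    is a copy of the coset space. Traces are conjugated, composed and expanded below by choosing a
    suitable [K]. *)
Lemma rcosets_reindex N (V : zmodType) (I : eqType) (G H : {group 'S_N})
    (K : 'S_N -> I) (y : I -> V) (s : seq I) :
  H \subset G -> uniq s ->
  {in G &, forall g h, (K g == K h) = (g * h^-1 \in H)%g} ->
  (forall i, i \in s <-> exists2 g, g \in G & K g = i) ->
  (\sum_(i <- s) y i = \sum_(C in rcosets H G) y (K (repr C)))%R.
Proof.
move=> sHG us eqK mem_s; rewrite -big_enum -(big_map (fun C => K (repr C)) xpredT y).
apply: perm_big; apply: uniq_perm => //.
  rewrite map_inj_in_uniq ?enum_uniq // => C C'; rewrite !mem_enum => HC HC' /eqP.
  have [CG {2}->] := rcosets_repr sHG HC; have [CG' {2}->] := rcosets_repr sHG HC'.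
  by rewrite eqK // => ?; apply/rcoset_eqP; rewrite mem_rcoset.
move=> i; apply/idP/mapP => [/mem_s[g gG <-]|[C]].
  have gC : (H :* g)%g \in rcosets H G by apply/rcosetsP; exists g.
  exists (H :* g)%g; first by rewrite mem_enum.
  apply/eqP; have [CG _] := rcosets_repr sHG gC; rewrite eqK //.
  by case: repr_rcosetP => h hH; rewrite invMg mulKVg groupV.
by rewrite mem_enum => /(rcosets_repr sHG)[CG _] ->; apply/mem_s; exists (repr C).
Qed.

Lemma big_rcosets N (R : nmodType) (G H : {group 'S_N}) (h : 'S_N -> R) :
  H \subset G ->
  (\sum_(g in G) h g = \sum_(C in rcosets H G) \sum_(w in H) h (w * repr C)%g)%R.
Proof.
move=> sHG; rewrite (set_partition_big _ (rcosets_partition sHG)) /=.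
apply: eq_bigr => C /(rcosets_repr sHG)[_ {1}->].
rewrite (reindex_inj (mulIg (repr C))) /=; apply: eq_bigl => w.
by rewrite mem_rcoset mulgK.
Qed.

Lemma Sig_conj N (lab lab' : nat -> nat) (s : 'S_N) :
  (forall t t' : 'I_N, (lab' (s t) == lab' (s t')) = (lab t == lab t')) ->
  Sig N lab' = (Sig N lab :^ s)%g.
Proof.
move=> eq_lab; apply/setP=> g; rewrite mem_conjg; apply/SigP/SigP => Hg i.
  apply/eqP; rewrite -eq_lab; apply/eqP; rewrite -(Hg (s i)); congr (lab' _).
  by rewrite conjgE invgK !permM permKV.
have /eqP := Hg (s^-1 i)%g; rewrite -eq_lab permKV => /eqP <-; congr (lab' _).
by rewrite conjgE invgK !permM !permKV.
Qed.

Section Action.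
Variables (T : choiceType) (ar : T -> nat) (act : forall n, 'S_n -> T -> T).
Variable F : fieldType.
Hypothesis ar_act : forall n (s : 'S_n) b, ar b = n -> ar (act s b) = n.
Hypothesis act1 : forall n b, ar b = n -> act (1%g : 'S_n) b = b.
Hypothesis actM : forall n (s t : 'S_n) b, ar b = n ->
  act s (act t b) = act (t * s)%g b.
Local Open Scope ring_scope.
Local Notation P := {malg F[T]}.
Implicit Types (x y : P) (b : T).

Lemma actK n (s : 'S_n) b : ar b = n -> act s^-1 (act s b) = b.
Proof. by move=> arb; rewrite actM // mulgV act1. Qed.

Lemma actKV n (s : 'S_n) b : ar b = n -> act s (act s^-1 b) = b.
Proof. by move=> arb; rewrite actM // mulVg act1. Qed.

Lemma act_eq n (s : 'S_n) b c :
  ar b = n -> ar c = n -> (act s b == act s c) = (b == c).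
Proof.
move=> arb arc; apply/eqP/eqP => [/(congr1 (act s^-1))|-> //].
by rewrite !actK.
Qed.

Lemma pact_lin n (s : 'S_n) x : pact act s x = lin x (fun b => << act s b >>).
Proof. by apply: eq_bigr => b _; rewrite malgUZ. Qed.

Lemma pactP n (s : 'S_n) c x y :
  pact act s (c *: x + y) = c *: pact act s x + pact act s y.
Proof. by rewrite !pact_lin linP. Qed.

Lemma pactZ n (s : 'S_n) c x : pact act s (c *: x) = c *: pact act s x.
Proof. by rewrite !pact_lin linZ. Qed.

Lemma pact0 n (s : 'S_n) : pact act s (0 : P) = 0.
Proof. by rewrite pact_lin lin0. Qed.

Lemma pact_sum n (s : 'S_n) I (r : seq I) (Q : pred I) (g : I -> P) :
  pact act s (\sum_(i <- r | Q i) g i) = \sum_(i <- r | Q i) pact act s (g i).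
Proof. by rewrite pact_lin lin_sum; apply: eq_bigr => i _; rewrite pact_lin. Qed.

Lemma pactU n (s : 'S_n) b : pact act s (<< b >> : P) = << act s b >>.
Proof. by rewrite pact_lin linU. Qed.

Lemma inP0 n : inP ar n (0 : P).
Proof. by move=> b; rewrite msupp0 inE. Qed.

Lemma inPU n b : ar b = n -> inP ar n (<< b >> : P).
Proof. by move=> arb c /(fsubsetP msuppU_le); rewrite inE => /eqP->. Qed.

Lemma inPP n c x y : inP ar n x -> inP ar n y -> inP ar n (c *: x + y).
Proof.
move=> Px Py b /(fsubsetP (msuppD_le _ _)); rewrite inE => /orP[|/Py //].
by move/(fsubsetP (msuppZ_le _ _))/Px.
Qed.

Lemma inP_sum n I (r : seq I) (Q : pred I) (g : I -> P) :
  (forall i, Q i -> inP ar n (g i)) -> inP ar n (\sum_(i <- r | Q i) g i).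
Proof.
move=> Pg; apply: big_ind => // [|x y Px Py]; first exact: inP0.
by rewrite -[x]scale1r; apply: inPP.
Qed.

Lemma inP_pact n (s : 'S_n) x : inP ar n x -> inP ar n (pact act s x).
Proof.
move=> Px; rewrite pact_lin /lin big_seq_cond; apply: inP_sum => b.
rewrite andbT => /Px arb; rewrite -[X in inP _ _ X]addr0; apply: inPP; last exact: inP0.
by apply: inPU; apply: ar_act.
Qed.

Lemma pact1 n x : inP ar n x -> pact act (1%g : 'S_n) x = x.
Proof.
move=> Px; rewrite pact_lin -[RHS]lin_id; apply: eq_lin => b /Px arb.
by rewrite act1.
Qed.

Lemma pactM n (s t : 'S_n) x :
  inP ar n x -> pact act s (pact act t x) = pact act (t * s)%g x.
Proof.
move=> Px; rewrite !pact_lin lin_lin; apply: eq_lin => b /Px arb.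
by rewrite linU actM.
Qed.

Lemma mcoeff_pact n (s : 'S_n) x b :
  inP ar n x -> ar b = n -> (pact act s x)@_(act s b) = x@_b.
Proof.
move=> Px arb; rewrite pact_lin -[in RHS](lin_id x) /lin !raddf_sum /=.
apply: eq_big_seq => c /Px arc.
by rewrite !mcoeffZ !mcoeffU act_eq.
Qed.

(** [adm] with any set of permutations in place of [Sig]: an operadic composite of invariants is in
    general invariant only under a wreath product. *)
Definition admG n (G : {set 'S_n}) x := inP ar n x /\ invariant act G x.

Lemma admG_coeff n (G : {set 'S_n}) x (s : 'S_n) b :
  admG G x -> s \in G -> ar b = n -> x@_(act s b) = x@_b.
Proof. by case=> Px Ix sG arb; rewrite -{1}(Ix s sG) mcoeff_pact. Qed.

Lemma admGP n (G : {set 'S_n}) c x y :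
  admG G x -> admG G y -> admG G (c *: x + y).
Proof.
move=> [Px Ix] [Py Iy]; split; first exact: inPP.
by move=> s sG; rewrite pactP Ix ?Iy.
Qed.

Lemma admG0 n (G : {set 'S_n}) : admG G 0.
Proof. by split=> [|s _]; [exact: inP0 | rewrite pact0]. Qed.

Lemma admG_sub n (G H : {set 'S_n}) x : H \subset G -> admG G x -> admG H x.
Proof. by move=> /subsetP sHG [Px Ix]; split=> // s /sHG /Ix. Qed.

Lemma orbitP n (G : {set 'S_n}) b c :
  reflect (exists2 s, s \in G & c = act s b) (c \in orbit act G b).
Proof.
rewrite mem_undup; apply: (iffP mapP) => -[s sG ->]; exists s => //.
  by rewrite -mem_enum.
by rewrite mem_enum.
Qed.

Lemma orbit_refl n (G : {group 'S_n}) b : ar b = n -> b \in orbit act G b.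
Proof. by move=> arb; apply/orbitP; exists 1%g; rewrite ?group1 ?act1. Qed.

Lemma orbit_ar n (G : {set 'S_n}) b c :
  ar b = n -> c \in orbit act G b -> ar c = n.
Proof. by move=> arb /orbitP[s _ ->]; apply: ar_act. Qed.

Lemma orbit_trans n (G : {group 'S_n}) b c :
  ar b = n -> c \in orbit act G b -> orbit act G c =i orbit act G b.
Proof.
move=> arb /orbitP[s sG ->] d; apply/orbitP/orbitP => -[t tG ->].
  by exists (s * t)%g; rewrite ?groupM ?actM.
exists (s^-1 * t)%g; first by rewrite groupM ?groupV.
by rewrite actM // mulgA mulgV mul1g.
Qed.

(* A representative of the orbit of [b] that depends only on the orbit. *)
Definition crep n (G : {set 'S_n}) b : T :=
  head b (enum_fset (seq_fset tt (orbit act G b))).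

(** The default [d] is arbitrary because (gamma5) picks the head of a small orbit with the base
    point of the large orbit as default. *)
Lemma crep_orbit n (G : {group 'S_n}) b d :
  ar b = n ->
  head d (enum_fset (seq_fset tt (orbit act G b))) \in orbit act G b.
Proof.
move=> arb; have := orbit_refl G arb; rewrite -{1}(seq_fsetE tt).
set s := seq_fset _ _; move=> b_in.
rewrite -(seq_fsetE tt) -/s.
have headP (l : seq T) : b \in l -> head d l \in l.
  by case: l => //= c l _; rewrite mem_head.
exact: (headP _ b_in).
Qed.

Lemma crep_eq n (G : {group 'S_n}) b c :
  ar b = n -> c \in orbit act G b -> crep G c = crep G b.
Proof.
move=> arb c_in; rewrite /crep.
have -> : seq_fset tt (orbit act G c) = seq_fset tt (orbit act G b).
  by apply/fsetP=> d; rewrite !seq_fsetE (orbit_trans arb c_in).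
have := orbit_refl G arb; rewrite -(seq_fsetE tt).
set s := seq_fset _ _; move=> b_in.
by case: (enum_fset s) (b_in : b \in enum_fset s).
Qed.

Lemma mcoeff_Osum n (G : {set 'S_n}) b c :
  (Osum act F G b)@_c = (c \in orbit act G b)%:R.
Proof.
rewrite /Osum raddf_sum /=; under eq_bigr do rewrite mcoeffU.
have [c_in|c_nin] := boolP (c \in orbit act G b); last first.
  rewrite big_seq big1 // => d d_in; rewrite (_ : (d == c) = false) //.
  by apply: contraNF c_nin => /eqP <-.
rewrite (bigD1_seq c) ?undup_uniq //= eqxx big1 ?addr0 // => d /negbTE -> //.
Qed.

Lemma eq_Osum n (G H : {set 'S_n}) b c :
  orbit act G b =i orbit act H c -> Osum act F G b = Osum act F H c.
Proof. by move=> eq_o; apply/malgP=> d; rewrite !mcoeff_Osum eq_o. Qed.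

Lemma Osum_orbit n (G : {group 'S_n}) b c :
  ar b = n -> c \in orbit act G b -> Osum act F G c = Osum act F G b.
Proof. by move=> arb /(orbit_trans arb); apply: eq_Osum. Qed.

Lemma inP_Osum n (G : {set 'S_n}) b : ar b = n -> inP ar n (Osum act F G b).
Proof.
move=> arb; rewrite /Osum big_seq; apply: inP_sum => c /(orbit_ar arb).
exact: inPU.
Qed.

Lemma pact_Osum n (G : {set 'S_n}) (s : 'S_n) b :
  ar b = n -> pact act s (Osum act F G b) = Osum act F (G :^ s)%g (act s b).
Proof.
move=> arb; rewrite /Osum pact_sum; under eq_bigr do rewrite pactU.
rewrite -(big_map (act s) xpredT (fun c => << c >>)); apply: perm_big.
apply: uniq_perm; rewrite ?undup_uniq //.
  rewrite map_inj_in_uniq ?undup_uniq // => c d c_in d_in /eqP.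
  by rewrite act_eq ?(orbit_ar arb c_in) ?(orbit_ar arb d_in) // => /eqP.
move=> c; apply/mapP/orbitP => [[d /orbitP[g gG ->] ->]|[g gG ->]].
  exists (g ^ s)%g; first by rewrite memJ_conjg.
  by rewrite !actM // conjgE !mulgA mulgV mul1g.
exists (act (g ^ s^-1)%g b).
  by apply/orbitP; exists (g ^ s^-1)%g; rewrite // -mem_conjg.
by rewrite !actM // conjgE invgK !mulgA mulgKV.
Qed.

Lemma admG_Osum n (G : {group 'S_n}) b : ar b = n -> admG G (Osum act F G b).
Proof.
move=> arb; split; first exact: inP_Osum.
move=> s sG; rewrite pact_Osum // conjGid //.
by apply: Osum_orbit => //; apply/orbitP; exists s.
Qed.

(** The coefficients of an invariant are constant along orbits, so it suffices to keep the elements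
    of the support that represent their own orbit. *)
Lemma Osum_decomp n (G : {group 'S_n}) x :
  admG G x ->
  x = \sum_(b <- enum_fset (msupp x) | b == crep G b) x@_b *: Osum act F G b.
Proof.
move=> Ax; have [Px _] := Ax; apply/malgP=> c.
rewrite raddf_sum /=; under eq_bigr do rewrite mcoeffZ mcoeff_Osum.
rewrite big_seq_cond.
have eq_rep b : (b \in msupp x) && (b == crep G b) ->
    c \in orbit act G b -> [/\ ar c = n, b = crep G c & x@_b = x@_c].
  case/andP=> /Px arb /eqP b_rep c_in; split; first exact: orbit_ar c_in.
    by rewrite (crep_eq arb c_in).
  by case/orbitP: c_in => s sG ->; rewrite (admG_coeff Ax).
have [c_in|c_nin] := boolP (c \in msupp x); last first.
  rewrite mcoeff_outdom // big1 // => b Hb.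
  have [/(eq_rep b Hb)[_ _ ->]|_] := boolP (c \in _); last by rewrite mulr0.
  by rewrite mcoeff_outdom // mul0r.
have arc := Px _ c_in.
have rc_in : crep G c \in orbit act G c by apply: crep_orbit.
have xrc : x@_(crep G c) = x@_c.
  by case/orbitP: rc_in => s sG ->; rewrite (admG_coeff Ax).
have rc_supp : crep G c \in msupp x.
  by rewrite -mcoeff_neq0 xrc mcoeff_neq0.
have c_rc : c \in orbit act G (crep G c).
  by rewrite (orbit_trans arc rc_in) orbit_refl.
have rep_rc : crep G c == crep G (crep G c) by rewrite (crep_eq arc rc_in).
rewrite -big_seq_cond big_mkcond /=.
rewrite (bigD1_seq (crep G c)) ?fset_uniq //= rep_rc c_rc mulr1 xrc.
rewrite big_seq_cond big1 ?addr0 // => b /andP[b_in ne_b].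
case: ifP => // b_rep; have [c_b|_] := boolP (c \in _); last by rewrite mulr0.
by case: (eq_rep b) => //; [rewrite b_in | move=> _ Eb _; rewrite Eb eqxx in ne_b].
Qed.

Lemma admG_ind n (G : {group 'S_n}) (K : P -> Prop) :
  K 0 ->
  (forall c x y, admG G x -> admG G y -> K x -> K y -> K (c *: x + y)) ->
  (forall b, ar b = n -> K (Osum act F G b)) ->
  forall x, admG G x -> K x.
Proof.
move=> K0 KP KO x Ax; have [Px _] := Ax; rewrite (Osum_decomp Ax) big_seq_cond.
suff [] : admG G (\sum_(b <- enum_fset (msupp x)
              | (b \in enum_fset (msupp x)) && (b == crep G b)) x@_b *: Osum act F G b)
          /\ K (\sum_(b <- enum_fset (msupp x)
              | (b \in enum_fset (msupp x)) && (b == crep G b)) x@_b *: Osum act F G b) by [].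
(* Only the summation lists are generalised; the filter keeps membership in the support, which gives
   the arity. Admissibility of the partial sums is carried along because the linear step requires
   it. *)
elim: {1 3}(enum_fset (msupp x)) => [|b s [IH1 IH2]].
  by rewrite !big_nil; split=> //; apply: admG0.
rewrite !big_cons; case: ifP => // /andP[/Px arb _].
have AO := admG_Osum G arb; split; first exact: admGP.
by apply: KP => //; apply: KO.
Qed.

Lemma card_transporter n (G : {group 'S_n}) b c :
  ar b = n -> c \in orbit act G b ->
  #|[set g in G | act g b == c]| = #|stab act G b|.
Proof.
move=> arb /orbitP[s sG ->]; rewrite -[RHS](card_rcoset _ s); apply: eq_card => g.
rewrite mem_rcoset !inE groupMr ?groupV //; apply: andb_id2l => gG.
have arg := ar_act g arb.
by rewrite -actM // -[RHS](act_eq s) ?ar_act // actKV.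
Qed.

(** Each element of the orbit equals [g b] for exactly [|Stab b|] elements [g]. The weight is
    [nat]-valued so that indicator functions can be inserted and the result divided. *)
Lemma orbit_sum n (G : {group 'S_n}) b (h : T -> nat) :
  ar b = n ->
  (#|stab act G b| * \sum_(c <- orbit act G b) h c = \sum_(g in G) h (act g b))%N.
Proof.
move=> arb.
have hE g : g \in G ->
    h (act g b) = (\sum_(c <- orbit act G b) (act g b == c) * h c)%N.
  move=> gG; have b_in : act g b \in orbit act G b by apply/orbitP; exists g.
  rewrite (bigD1_seq _ b_in) ?undup_uniq //= eqxx mul1n big1 ?addn0 // => c.
  by rewrite eq_sym => /negbTE ->.
rewrite (eq_bigr _ hE) exchange_big /= big_distrr /=.
apply: eq_big_seq => c c_in; rewrite -big_distrl /= -(card_transporter arb c_in).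
rewrite -sum1_card big_mkcond [in RHS]big_mkcond; congr (_ * _)%N.
by apply: eq_bigr => g _; rewrite inE; case: (g \in G); case: eqP.
Qed.

(* In mathcomp [H :* g] means first H then g, so these right cosets are the left
   cosets G/H of the paper. *)
Definition Tr n (H G : {set 'S_n}) x : P :=
  \sum_(C in rcosets H G) pact act (repr C) x.

Lemma TrP n (H G : {set 'S_n}) c x y :
  Tr H G (c *: x + y) = c *: Tr H G x + Tr H G y.
Proof.
rewrite scaler_sumr -big_split /=; apply: eq_bigr => C _; exact: pactP.
Qed.

Lemma Tr0 n (H G : {set 'S_n}) : Tr H G 0 = 0.
Proof. by apply: big1 => C _; rewrite pact0. Qed.

Lemma TrZ n (H G : {set 'S_n}) c x : Tr H G (c *: x) = c *: Tr H G x.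
Proof. by rewrite -[c *: x]addr0 TrP Tr0 addr0. Qed.

Lemma Tr_sum n (H G : {set 'S_n}) I (r : seq I) (Q : pred I) (g : I -> P) :
  Tr H G (\sum_(i <- r | Q i) g i) = \sum_(i <- r | Q i) Tr H G (g i).
Proof.
apply: (big_morph (Tr H G) _ (Tr0 H G)) => x y.
by rewrite -[x]scale1r TrP !scale1r.
Qed.

Lemma Tr_reindex n (H G : {group 'S_n}) x (I : eqType) (K : 'S_n -> I)
    (y : I -> P) (s : seq I) :
  H \subset G -> uniq s ->
  {in G &, forall g h, (K g == K h) = (g * h^-1 \in H)%g} ->
  (forall i, i \in s <-> exists2 g, g \in G & K g = i) ->
  (forall g, g \in G -> y (K g) = pact act g x) ->
  \sum_(i <- s) y i = Tr H G x.
Proof.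
move=> sHG us eqK mem_s yK; rewrite (rcosets_reindex _ sHG us eqK mem_s).
by apply: eq_bigr => C /(rcosets_repr sHG)[CG _]; rewrite yK.
Qed.

Lemma pact_repr n (H : {group 'S_n}) x (g : 'S_n) :
  admG H x -> pact act (repr (H :* g)%g) x = pact act g x.
Proof. by case=> Px Ix; case: repr_rcosetP => h hH; rewrite -pactM // Ix. Qed.

Lemma rcoset_eqE n (H : {group 'S_n}) (g h : 'S_n) :
  ((H :* g)%g == (H :* h)%g) = (g * h^-1 \in H)%g.
Proof. by rewrite -mem_rcoset; apply/eqP/rcoset_eqP. Qed.

Lemma Tr_enum n (H G : {set 'S_n}) x :
  Tr H G x = \sum_(C <- enum (rcosets H G)) pact act (repr C) x.
Proof. by rewrite big_enum. Qed.

Lemma Tr_conj n (H G : {group 'S_n}) (s : 'S_n) x :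
  H \subset G -> admG H x ->
  pact act s (Tr H G x) = Tr (H :^ s)%g (G :^ s)%g (pact act s x).
Proof.
move=> sHG Ax; have [Px Ix] := Ax.
have AHs : admG (H :^ s)%g (pact act s x).
  split; first exact: inP_pact.
  move=> g; rewrite mem_conjg => gH; rewrite pactM //.
  have -> : (s * g = g ^ s^-1 * s)%g by rewrite conjgE invgK !mulgA mulgKV.
  by rewrite -pactM // Ix.
pose y (D : {set 'S_n}) := pact act (repr D) (pact act s x).
pose K (g : 'S_n) : {set 'S_n} := (H :^ s :* g ^ s)%g.
rewrite [RHS]Tr_enum {1}/Tr pact_sum.
transitivity (\sum_(C in rcosets H G) y (K (repr C))).
  apply: eq_bigr => C _; rewrite /y /K (@pact_repr _ (H :^ s)%G) //.
  by rewrite !pactM // conjgE !mulgA mulgV mul1g.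
apply/esym/rcosets_reindex; rewrite ?enum_uniq //.
  move=> g h _ _; rewrite /K (@rcoset_eqE _ (H :^ s)%G) -conjVg -conjMg.
  by rewrite memJ_conjg.
move=> D; rewrite mem_enum; split=> [/rcosetsP[_ /imsetP[g gG ->] ->]|[g gG <-]].
  by exists g.
by apply/rcosetsP; exists (g ^ s)%g; rewrite ?memJ_conjg.
Qed.

Lemma Tr_id n (G : {group 'S_n}) x : admG G x -> Tr G G x = x.
Proof.
case=> Px Ix.
rewrite -(@Tr_reindex _ G G x unit (fun=> tt) (fun=> x) [:: tt]) ?big_seq1 //.
- by move=> g h gG hG; rewrite eqxx groupM ?groupV.
- by case; split=> // _; exists 1%g; rewrite ?group1.
by move=> g gG; rewrite Ix.
Qed.

(** Acting by [s] only permutes the cosets that are summed over, through [g |-> g * s]. *)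
Lemma Tr_adm n (H G : {group 'S_n}) x :
  H \subset G -> admG H x -> admG G (Tr H G x).
Proof.
move=> sHG Ax; have [Px Ix] := Ax; split.
  by apply: inP_sum => C _; apply: inP_pact.
move=> s sG; rewrite [RHS]Tr_enum /Tr pact_sum.
pose y (D : {set 'S_n}) := pact act (repr D) x.
pose K (g : 'S_n) : {set 'S_n} := (H :* (g * s))%g.
transitivity (\sum_(C in rcosets H G) y (K (repr C))).
  by apply: eq_bigr => C _; rewrite /y /K (@pact_repr _ H) // pactM.
apply/esym/rcosets_reindex; rewrite ?enum_uniq //.
- by move=> g h _ _; rewrite rcoset_eqE invMg mulgA mulgK.
- move=> D; rewrite mem_enum; split=> [/rcosetsP[g gG ->]|[g gG <-]].
    by exists (g * s^-1)%g; rewrite ?groupM ?groupV // /K mulgKV.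
  by apply/rcosetsP; exists (g * s)%g; rewrite ?groupM.
Qed.

Lemma Tr_tower n (H K G : {group 'S_n}) x :
  H \subset K -> K \subset G -> admG H x -> Tr K G (Tr H K x) = Tr H G x.
Proof.
move=> sHK sKG Ax; have [Px Ix] := Ax; have sHG := subset_trans sHK sKG.
(* With [d g] the chosen representative of the [K]-coset of [g], an [H]-coset in [G] is encoded by
   that [K]-coset together with the [H]-coset in [K] of the remaining factor [g * (d g)^-1]. *)
pose d g := repr (K :* g)%g.
have dK g : (g * (d g)^-1)%g \in K.
  by rewrite /d; case: repr_rcosetP => k kK; rewrite invMg mulKVg groupV.
pose s := [seq (D, C) | D <- enum (rcosets K G), C <- enum (rcosets H K)].
pose y (DC : {set 'S_n} * {set 'S_n}) := pact act (repr DC.2 * repr DC.1)%g x.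
pose k g := ((K :* g)%g, (H :* (g * (d g)^-1))%g).
rewrite -(@Tr_reindex _ H G x _ k y s) //.
- rewrite /s big_allpairs_dep /= big_enum /=; apply: eq_bigr => D _.
  by rewrite big_enum pact_sum; apply: eq_bigr => C _; rewrite pactM.
- by apply: allpairs_uniq; rewrite ?enum_uniq // => -[? ?] [? ?].
- move=> g h gG hG; rewrite /k xpair_eqE !rcoset_eqE.
  apply/andP/idP => [[gh_K]|gh_H].
    have -> : d g = d h by congr (repr _); apply/eqP; rewrite rcoset_eqE.
    by rewrite invMg invgK mulgA mulgKV.
  have gh_K := subsetP sHK _ gh_H; split=> //.
  have -> : d g = d h by congr (repr _); apply/eqP; rewrite rcoset_eqE.
  by rewrite invMg invgK mulgA mulgKV.
- move=> [D C]; split=> [/allpairsP[[D' C'] /= []]|[g gG <-]].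
    rewrite !mem_enum => HD HC [-> ->].
    have [DG eqD'] := rcosets_repr sKG HD; have [CK eqC'] := rcosets_repr sHK HC.
    exists (repr C' * repr D')%g; first by apply: groupM => //; apply: (subsetP sKG).
    have eqD : (K :* (repr C' * repr D'))%g = D'.
      by rewrite [RHS]eqD'; apply/eqP; rewrite rcoset_eqE mulgK.
    by rewrite /k /d eqD mulgK -eqC'.
  apply/allpairsP; exists (k g) => /=; rewrite !mem_enum; split=> //.
    by apply/rcosetsP; exists g.
  by apply/rcosetsP; exists (g * (d g)^-1)%g.
move=> g gG; rewrite /y /k /= -pactM // (@pact_repr _ H) //.
by rewrite pactM // mulgKV.
Qed.

(** Common form of the counts behind (gamma4) and (gamma6b). The hypothesis on [S] says that [L],
    each entry taken [S] times, is the multiset of all [w b] with [w] in [H]. Hence [S] times the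
    coefficient of [c] in the trace counts the [g] in [G] with [g b = c]. *)
Lemma Tr_count n (H G : {group 'S_n}) b (L : seq T) (S : nat) :
  H \subset G -> ar b = n -> (0 < S)%N -> (forall c, c \in L -> ar c = n) ->
  (forall h : T -> nat, S * \sum_(c <- L) h c = \sum_(w in H) h (act w b))%N ->
  Tr H G (\sum_(c <- L) << c >>) = (#|stab act G b| %/ S)%N%:R *: Osum act F G b.
Proof.
move=> sHG arb S_gt0 arL SL; apply/malgP=> c.
rewrite mcoeffZ mcoeff_Osum -natrM /Tr raddf_sum /=.
rewrite (eq_bigr (fun C => (\sum_(z <- L) (act (repr C) z == c))%N%:R)); last first.
  move=> C _; rewrite pact_sum raddf_sum natr_sum /=; apply: eq_bigr => z _.
  by rewrite pactU mcoeffU.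
rewrite -natr_sum; congr _%:R; apply/eqP.
rewrite -(eqn_pmul2l S_gt0) big_distrr /=; apply/eqP.
transitivity #|[set g in G | act g b == c]|.
  rewrite -sum1_card [RHS](eq_bigl (fun g => (g \in G) && (act g b == c))); last first.
    by move=> g; rewrite inE.
  rewrite big_mkcondr /= (big_rcosets _ sHG); apply: eq_bigr => C _.
  rewrite (SL (fun z => (act (repr C) z == c) : nat)); apply: eq_bigr => w _.
  by rewrite actM //; case: eqP.
have [c_in|c_nin] := boolP (c \in orbit act G b); last first.
  rewrite !muln0; apply: eq_card0 => g; rewrite !inE; apply: contraNF c_nin.
  by case/andP=> gG /eqP <-; apply/orbitP; exists g.
rewrite muln1 (card_transporter arb c_in); apply/eqP.
(* What remains is that [S] divides [|Stab_G b|]; the same count at [c = b] exhibits the quotient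
   [c0]. *)
rewrite eq_sym mulnC -dvdn_eq.
have Sw := SL (fun z => (z == b) : nat).
pose c0 := (\sum_(C in rcosets H G) \sum_(z <- L) (act (repr C) z == b))%N.
suff -> : #|stab act G b| = (S * c0)%N by rewrite dvdn_mulr.
rewrite big_distrr /= -sum1_card [LHS](eq_bigl (fun g => (g \in G) && (act g b == b))); last first.
  by move=> g; rewrite inE.
rewrite big_mkcondr /= (big_rcosets _ sHG); apply: eq_bigr => C _.
rewrite (SL (fun z => (act (repr C) z == b) : nat)); apply: eq_bigr => w _.
by rewrite actM //; case: eqP.
Qed.

Lemma Tr_Osum n (H G : {group 'S_n}) b :
  H \subset G -> ar b = n ->
  Tr H G (Osum act F H b)
  = (#|stab act G b| %/ #|stab act H b|)%N%:R *: Osum act F G b.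
Proof.
move=> sHG arb; apply: Tr_count => //.
- by apply/card_gt0P; exists 1%g; rewrite inE group1 act1 /=.
- by move=> c; apply: orbit_ar.
by move=> h; rewrite orbit_sum.
Qed.

(** The large orbit is a disjoint union of small ones. These are compared as finite sets, so that an
    orbit listed through several of its members is kept once. *)
Lemma Osum_subclasses n (H G : {group 'S_n}) b :
  H \subset G -> ar b = n ->
  Osum act F G b
  = \sum_(C <- subclasses act H G b) Osum act F H (head b (enum_fset C)).
Proof.
move=> sHG arb; apply/malgP=> c; rewrite mcoeff_Osum raddf_sum /=.
pose o d := seq_fset tt (orbit act H d).
have headP d d0 : d \in orbit act G b ->
    Osum act F H (head d0 (enum_fset (o d))) = Osum act F H d.
  move=> d_in; have ard := orbit_ar arb d_in.
  by apply: Osum_orbit => //; apply: crep_orbit.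
have [c_in|c_nin] := boolP (c \in orbit act G b); last first.
  rewrite big_seq big1 // => C; rewrite mem_undup => /mapP[d d_in ->].
  rewrite (headP d) // mcoeff_Osum; case: orbitP => // -[s sH Ec].
  case/negP: c_nin; rewrite Ec; case/orbitP: d_in => t tG ->.
  apply/orbitP; exists (t * s)%g; last by rewrite actM.
  by apply: groupM => //; apply: (subsetP sHG).
have arc := orbit_ar arb c_in.
rewrite (bigD1_seq (o c)) ?undup_uniq //=; last first.
  by rewrite mem_undup; apply: map_f.
rewrite (headP c) // mcoeff_Osum orbit_refl // big_seq_cond big1 ?addr0 // => C.
rewrite mem_undup => /andP[/mapP[d d_in ->] ne_o].
rewrite (headP d) // mcoeff_Osum; have ard := orbit_ar arb d_in.
have [c_d|//] := boolP (c \in orbit act H d).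
case/eqP: ne_o; apply/fsetP=> z; rewrite !seq_fsetE.
by rewrite (orbit_trans ard c_d).
Qed.

(** * Relabelling and splitting of beta operations *)

Lemma admG_conj n (H : {group 'S_n}) (s : 'S_n) x :
  admG H x -> admG (H :^ s)%g (pact act s x).
Proof.
case=> Px Ix; split; first exact: inP_pact.
move=> g; rewrite mem_conjg => gH; rewrite pactM //.
have -> : (s * g = g ^ s^-1 * s)%g by rewrite conjgE invgK !mulgA mulgKV.
by rewrite -pactM // Ix.
Qed.

Lemma admE N p (r : p.-tuple nat) x :
  N = sumn r -> adm ar act r x <-> admG (Sig N (blk r)) x.
Proof. by move=> ->. Qed.

Lemma adm_pact N (lab lab' : nat -> nat) (s : 'S_N) x :
  (forall t t' : 'I_N, (lab' (s t) == lab' (s t')) = (lab t == lab t')) ->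
  admG (Sig N lab) x -> admG (Sig N lab') (pact act s x).
Proof. by move=> /Sig_conj -> Ax; apply: (@admG_conj _ (Sig_group N lab)). Qed.

(** Two permutations sorting the same labelling differ by an element preserving it, which fixes [x];
    so the choice of a sorting permutation never matters. *)
Lemma pact_coset N (lab lab' : nat -> nat) (s s' : 'S_N) x :
  (forall t : 'I_N, lab' (s t) = lab t) ->
  (forall t : 'I_N, lab' (s' t) = lab t) ->
  admG (Sig N lab) x -> pact act s x = pact act s' x.
Proof.
move=> Hs Hs' [Px Ix].
have -> : s = (s * s'^-1 * s')%g by rewrite mulgKV.
rewrite -pactM // Ix //; apply/SigP => t.
by rewrite permM -Hs' permKV Hs.
Qed.

(* Duplicates the index [i0]: entries [i0] and [i0 + 1] become [u] and [v]. *)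
Definition spl U p (a : p.+1.-tuple U) (i0 : 'I_p.+1) (u v : U) : p.+2.-tuple U :=
  [tuple (if unlift (lift ord0 i0) j is Some i
          then if i == i0 then u else tnth a i else v) | j < p.+2].

(** Reduces duplication at [i0] to duplication at the first index, where (beta5) acts: the displayed
    permutation is the transposition of 0 and [i0], extended so that the second copy, at position 1,
    goes to position [i0 + 1]. *)
Lemma spl_split U p (a : p.+1.-tuple U) (i0 : 'I_p.+1) (u v : U) (j : 'I_p.+2) :
  tnth (spl a i0 u v)
       (lift_perm (lift ord0 ord0) (lift ord0 i0) (tperm ord0 i0) j)
  = tnth [tuple of u :: v :: behead_tuple (atw (tperm ord0 i0) a)] j.
Proof.
rewrite tnth_mktuple; case: (unliftP (lift ord0 ord0) j) => [k|] ->.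
  rewrite lift_perm_lift liftK.
  case: (unliftP ord0 k) => [k'|] ->; last first.
    rewrite tpermL eqxx (_ : lift (lift ord0 ord0) ord0 = ord0); last exact: val_inj.
    by rewrite tnth0.
  have -> : lift (lift ord0 ord0) (lift ord0 k') = lift ord0 (lift ord0 k').
    by apply: val_inj.
  rewrite !tnthS /=.
  have -> : (tperm ord0 i0 (lift ord0 k') == i0) = false.
    rewrite -{2}(tpermL ord0 i0) (inj_eq perm_inj); apply: negbTE.
    by rewrite eq_sym neq_lift.
  by rewrite tnth_behead tnth_mktuple tpermV; congr tnth; apply/congr1/val_inj;
     rewrite /= inordK ?ltnS.
by rewrite lift_perm_id unlift_none tnthS tnth0.
Qed.

Lemma spl_ord0 U p (a : p.+1.-tuple U) (u v : U) :
  spl a ord0 u v = [tuple of u :: v :: behead_tuple a].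
Proof.
apply: eq_from_tnth => j; have := spl_split a ord0 u v j.
have -> : tperm ord0 (ord0 : 'I_p.+1) = 1%g by exact: tperm1.
rewrite lift_perm1 perm1 => ->.
suff -> : atw 1 a = a by [].
by apply: eq_from_tnth => i; rewrite tnth_mktuple invg1 perm1.
Qed.

(** [unbump i0] is the map undoing a duplication: it sends [i0] and [i0 + 1] to [i0] and shifts the
    later indices down. *)
Lemma unbump_lift p (i0 k : 'I_p.+1) :
  unbump i0 (lift (lift ord0 i0) k : 'I_p.+2) = k.
Proof. by rewrite /= /unbump /bump; lia. Qed.

Lemma unbump_lift_self p (i0 : 'I_p.+1) :
  unbump i0 (lift ord0 i0 : 'I_p.+2) = i0.
Proof. by rewrite /= /unbump /bump; lia. Qed.

Lemma nth_spl_sum p (r : p.+1.-tuple nat) (i0 : 'I_p.+1) l i :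
  (l <= tnth r i0)%N ->
  (nth 0 r i = \sum_(j < p.+2 | unbump i0 j == i)
                 nth 0 (spl r i0 l (tnth r i0 - l)%N) j)%N.
Proof.
move=> le_l; rewrite big_mkcond (bigD1_ord (lift ord0 i0)) //.
rewrite (unbump_lift_self i0) nth_tnth tnth_mktuple unlift_none.
under eq_bigr => k _.
  rewrite (unbump_lift i0 k) nth_tnth tnth_mktuple liftK; over.
rewrite /= -big_mkcond /=; have [lt_i|le_i] := ltnP i p.+1; last first.
  rewrite nth_default ?size_tuple // big_pred0 => [|k]; last first.
    by apply: contra_leqF le_i => /eqP <-.
  by case: eqP => // Ei; have := ltn_ord i0; rewrite Ei ltnNge le_i.
rewrite (big_pred1 (Ordinal lt_i)) //.
rewrite (nth_tnth r (Ordinal lt_i)) [Ordinal _ == i0]eq_sym.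
rewrite -[(nat_of_ord i0) == i]/(i0 == Ordinal lt_i).
by case: eqP => [<-|_]; rewrite ?add0n // subnK.
Qed.

Lemma sumn_spl p (r : p.+1.-tuple nat) (i0 : 'I_p.+1) l :
  (l <= tnth r i0)%N -> sumn (spl r i0 l (tnth r i0 - l)%N) = sumn r.
Proof.
move=> le_l; rewrite !sumn_tuple (bigD1_ord (lift ord0 i0)) // tnth_mktuple unlift_none.
under eq_bigr => k _ do rewrite tnth_mktuple liftK.
rewrite (bigD1 i0) // [in RHS](bigD1 i0) //= eqxx addnA subnK //.
by congr addn; apply: eq_bigr => k /negbTE ->.
Qed.

Lemma blk_spl p (r : p.+1.-tuple nat) (i0 : 'I_p.+1) l t :
  (l <= tnth r i0)%N -> (t < sumn r)%N ->
  blk r t = unbump i0 (blk (spl r i0 l (tnth r i0 - l)%N) t).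
Proof.
move=> le_l lt_t; apply: blk_merge => [i j|i|]; last by rewrite sumn_spl.
  by rewrite /unbump; lia.
by rewrite size_tuple -nth_spl_sum.
Qed.

Lemma sumn_split1 p (r : p.+1.-tuple nat) l :
  (l <= thead r)%N -> sumn (split1 r l (thead r - l)%N) = sumn r.
Proof. by move=> le_l; rewrite /split1 -spl_ord0 sumn_spl. Qed.

Lemma Sig_split1 N p (r : p.+1.-tuple nat) l :
  (l <= thead r)%N -> N = sumn r ->
  Sig N (blk (split1 r l (thead r - l)%N)) \subset Sig N (blk r).
Proof.
move=> le_l ->; apply: sub_Sig => t t'; rewrite /split1 -spl_ord0 => eq_t.
by rewrite !(blk_spl le_l) // eq_t.
Qed.

Section Beta.
Variable A : lmodType F.
Variable be : betaOps T A.
Hypothesis beP : is_beta ar act be.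

(* Combines beta_1 and beta_4: [f] is an arbitrary map of the label sets. *)
Lemma beta_relabel N s s' (d : s.-tuple nat) (d' : s'.-tuple nat)
    (lab f : nat -> nat) (tau tau' : 'S_N) x (a0 : s.-tuple A) (a : s'.-tuple A) :
  N = sumn d -> N = sumn d' ->
  (forall t : 'I_N, blk d (tau t) = lab t) ->
  (forall t : 'I_N, blk d' (tau' t) = f (lab t)) ->
  (forall L, L < s -> f L < s')%N ->
  (forall L, (L < s)%N -> nth 0 a0 L = nth 0 a (f L)) ->
  admG (Sig N lab) x ->
  be d (pact act tau x) a0
  = be d' (pact act tau' (Tr (Sig N lab) (Sig N (fun t => f (lab t))) x)) a.
Proof.
move=> eN; subst N => eN' Hd Hd' lt_f Ha Ax; have [Px Ix] := Ax.
have lt_lab (t : 'I_(sumn d)) : (lab t < s)%N.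
  by rewrite -Hd -[X in (_ < X)%N](size_tuple d) blk_lt.
(* The fibre sizes of [f], which play the role of [q] in (beta4). A label outside the image of [f]
   simply gets the entry 0. *)
pose q := [tuple count (fun L => f L == j) (iota 0 s) | j < s'].
have nth_q j : count (fun L => f L == j) (iota 0 s) = nth 0%N q j.
  have [lt_j|le_j] := ltnP j s'.
    by rewrite (nth_tnth q (Ordinal lt_j)) tnth_mktuple.
  rewrite [RHS]nth_default ?size_tuple // count_sum big1 // => L _.
  by case: eqP => // Ej; have := lt_f L (ltn_ord L); rewrite Ej ltnNge le_j.
have sum_q : sumn q = s.
  rewrite sumn_tuple -[RHS]card_ord -sum1_card.
  rewrite (eq_bigr (fun j : 'I_s' => \sum_(L < s) (f L == j))%N); last first.
    by move=> j _; rewrite tnth_mktuple count_sum.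
  rewrite exchange_big /=; apply: eq_bigr => L _.
  rewrite (bigD1 (Ordinal (lt_f L (ltn_ord L)))) //= eqxx big1 // => j.
  by rewrite eq_sym => /negbTE; rewrite -val_eqE /= => ->.
(* [rho] sorts the labels by their value under [f], so that (beta1) turns the fibres of [f] into
   consecutive intervals, to which (beta4) applies. *)
have [rho Hrho] := sort_labels (esym sum_q) nth_q.
case: beP => b1 _ _ b4 _.
have Atau : adm ar act d (pact act tau x).
  by apply: (adm_pact _ Ax) => t t'; rewrite !Hd.
rewrite (b1 _ _ _ rho _ Atau) pactM //.
set sg := (tau * bperm rho d)%g.
have Hsg (t : 'I_(sumn d)) : blk (rtw rho d) (sg t) = pn rho (lab t).
  by rewrite permM -pnE blk_bperm // Hd.
have Asg : admG (Sig (sumn d) (blk (rtw rho d))) (pact act sg x).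
  by apply: (adm_pact _ Ax) => t t'; rewrite !Hsg (inj_eq (@pn_inj _ rho)).
have sum_r := sumn_rtw rho d.
have -> : atw rho a0 = rep s q a.
  apply: eq_from_tnth => i; rewrite !tnth_mktuple -{2}[i](permKV rho) Hrho -Ha //.
  by rewrite -tnth_nth.
rewrite b4 //; last exact/(admE _ (esym sum_r)).
have Hqr (t : 'I_(sumn d)) : blk (qr q (rtw rho d)) (sg t) = f (lab t).
  rewrite blk_qr // ?sum_r // Hsg -[lab t]/(val (Ordinal (lt_lab t))) pnE.
  by rewrite Hrho.
(* Both compositions sort the labelling [f o lab], hence have the same entries. *)
have eq_d' : qr q (rtw rho d) = d'.
  apply/val_inj/(@eq_from_nth _ 0%N); rewrite ?size_tuple // => j _.
  have eqr : sumn d = sumn (qr q (rtw rho d)) by rewrite sumn_qr // sum_r.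
  have cont := labels_content (lab := fun t => f (lab t)) j.
  exact: etrans (esym (cont _ _ _ eqr Hqr)) (cont _ _ _ eN' Hd').
rewrite eq_d'; congr (be d' _ a); rewrite -/(Tr _ _ _) sum_r.
rewrite eq_d' in Hqr.
have Sl : Sig (sumn d) (blk (rtw rho d)) = (Sig (sumn d) lab :^ sg)%g.
  by apply: Sig_conj => t t'; rewrite !Hsg (inj_eq (@pn_inj _ rho)).
have Sf : Sig (sumn d) (blk d') = (Sig (sumn d) (fun t => f (lab t)) :^ sg)%g.
  by apply: Sig_conj => t t'; rewrite !Hqr.
have sub : Sig (sumn d) lab \subset Sig (sumn d) (fun t => f (lab t)).
  by apply: sub_Sig => t t' ->.
rewrite Sl Sf -(@Tr_conj _ (Sig_group _ lab) (Sig_group _ (fun t => f (lab t)))) //.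
apply: pact_coset Hqr Hd' _.
by apply: (@Tr_adm _ (Sig_group _ lab) (Sig_group _ (fun t => f (lab t)))).
Qed.

Lemma beta_relabel_inj N s s' (d : s.-tuple nat) (d' : s'.-tuple nat)
    (lab f : nat -> nat) (tau tau' : 'S_N) x (a0 : s.-tuple A) (a : s'.-tuple A) :
  N = sumn d -> N = sumn d' ->
  (forall t : 'I_N, blk d (tau t) = lab t) ->
  (forall t : 'I_N, blk d' (tau' t) = f (lab t)) ->
  (forall L, L < s -> f L < s')%N ->
  (forall L, (L < s)%N -> nth 0 a0 L = nth 0 a (f L)) ->
  injective f ->
  admG (Sig N lab) x ->
  be d (pact act tau x) a0 = be d' (pact act tau' x) a.
Proof.
move=> eN eN' Hd Hd' lt_f Ha inj_f Ax.
rewrite (beta_relabel eN eN' Hd Hd' lt_f Ha Ax).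
have -> : Sig N (fun t => f (lab t)) = Sig N lab.
  by apply: eq_Sig => t t'; rewrite (inj_eq inj_f).
by rewrite (@Tr_id _ (Sig_group N lab)).
Qed.

Lemma be0 p (r : p.-tuple nat) (a : p.-tuple A) : be r 0 a = 0.
Proof.
case: beP => _ _ _ _ [_ lin_be].
have A0 : adm ar act r (0 : P) := admG0 (Sig (sumn r) (blk r)).
have := lin_be _ _ _ _ 1 a A0 A0; rewrite scaler0 addr0 scale1r.
by move/esym/eqP; rewrite -[X in _ == X]addr0 (inj_eq (addrI _)) => /eqP.
Qed.

Lemma be_sum p (r : p.-tuple nat) (a : p.-tuple A) I (s : seq I) (Q : pred I)
    (c : I -> F) (g : I -> P) :
  (forall i, Q i -> adm ar act r (g i)) ->
  be r (\sum_(i <- s | Q i) c i *: g i) a = \sum_(i <- s | Q i) c i *: be r (g i) a.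
Proof.
move=> Ag; case: beP => _ _ _ _ [_ lin_be].
suff [] : adm ar act r (\sum_(i <- s | Q i) c i *: g i) /\
   be r (\sum_(i <- s | Q i) c i *: g i) a = \sum_(i <- s | Q i) c i *: be r (g i) a by [].
elim: s => [|i s [IH1 IH2]].
  by rewrite !big_nil be0; split=> //; exact: (admG0 (Sig (sumn r) (blk r))).
rewrite !big_cons; case: ifP => // Qi; split.
  by apply: (@admGP _ (Sig (sumn r) (blk r))) => //; apply: Ag.
by rewrite lin_be ?IH2 //; apply: Ag.
Qed.

(** (beta5) and (beta3) concern the first argument only. So [i0] is exchanged with the first index,
    the argument is split there, (beta3) extracts [c ^+ l] from the first half, and a relabelling
    moves both halves back. *)
Lemma beta_split p (r : p.+1.-tuple nat) x (i0 : 'I_p.+1) (c : F) (A0 A1 : A)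
    (a : p.+1.-tuple A) :
  adm ar act r x -> tnth a i0 = c *: A0 + A1 ->
  be r x a
  = \sum_(l < (tnth r i0).+1)
      c ^+ l *: be (spl r i0 l (tnth r i0 - l)%N) x (spl a i0 A0 A1).
Proof.
move=> Ax Ea; have [Px Ix] := Ax; case: beP => b1 _ b3 _ [b5 _].
pose rho := tperm ord0 i0; rewrite (b1 _ _ _ rho _ Ax).
set r1 := rtw rho r; set a1 := atw rho a; set bp := bperm rho r.
have hr1 : thead r1 = tnth r i0.
  by rewrite /thead tnth_mktuple tpermV tpermL.
have sum_r1 : sumn r1 = sumn r by exact: sumn_rtw.
have blk_bp (t : 'I_(sumn r)) : blk r1 (bp t) = pn rho (blk r t).
  by rewrite -pnE blk_bperm.
have Ax1 : admG (Sig (sumn r) (blk r1)) (pact act bp x).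
  by apply: (adm_pact _ Ax) => t t'; rewrite !blk_bp (inj_eq (@pn_inj _ rho)).
have ha1 : thead a1 = c *: A0 + A1 by rewrite /thead tnth_mktuple tpermV tpermL.
rewrite (tuple_cons_behead a1) ha1 b5; last exact/(admE _ (esym sum_r1)).
rewrite hr1; apply: eq_bigr => l0 _.
have: (l0 <= tnth r i0)%N by rewrite -ltnS.
move: (nat_of_ord l0) => l le_l'; rewrite -hr1.
have le_l : (l <= thead r1)%N by rewrite hr1.
set d := split1 r1 l _; have sum_d : sumn d = sumn r by rewrite sumn_split1.
rewrite b3; last first.
  apply/(admE _ (esym sum_d)); apply: admG_sub Ax1.
  by apply: Sig_split1.
have -> : thead d = l :> nat by [].
congr (_ *: _); rewrite hr1.
set d' := spl r i0 l _.
pose rho' := lift_perm (lift ord0 ord0) (lift ord0 i0) rho : 'S_p.+2.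
have eq_d' : d' = rtw rho' d.
  apply: eq_from_tnth => j; rewrite -[j](permKV rho') spl_split tnth_mktuple permK.
  by rewrite /d hr1.
have sum_d' : sumn d' = sumn r by rewrite eq_d' sumn_rtw.
(* The composite of the two block permutations, formed on [nat] because their types involve [sumn d]
   and [sumn r]. *)
pose tau' := mkperm (sumn r) (fun t => pn (bperm rho' d) (pn bp t)).
have tau'E t : (t < sumn r)%N -> pn tau' t = pn (bperm rho' d) (pn bp t).
  apply: mkpermE => [u lt_u|u v lt_u lt_v /pn_inj/pn_inj //].
  by rewrite -{2}sum_d pn_lt // sum_d pn_lt.
have blk_tau' (t : 'I_(sumn r)) : blk d' (tau' t) = pn rho' (blk d (pn bp t)).
  by rewrite -pnE tau'E // eq_d' blk_bperm // sum_d pn_lt.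
rewrite (beta_relabel_inj (d := d) (d' := d') (tau := bp) (tau' := tau')
  (lab := fun t => blk d (pn bp t)) (f := pn rho') (a := spl a i0 A0 A1)) //.
(* Since [x] is fixed by the group of [r], it is enough that [tau'] preserves the intervals of [r]:
   on these the two exchanges cancel. *)
- congr (be d' _ _); apply: Ix; apply/SigP=> t.
  rewrite (blk_spl le_l') // -/d' blk_tau'.
  have lt_b : (blk d (pn bp t) < p.+2)%N.
    by apply: blk_ltT; rewrite sum_d pn_lt.
  have -> : blk r t = pn rho (blk r1 (pn bp t)).
    by rewrite pnE blk_bp -pnM /rho tperm2 pn1.
  have -> : blk r1 (pn bp t) = unbump 0 (blk d (pn bp t)).
    rewrite -[0%N]/(val (ord0 : 'I_p.+1)) /d /split1 -spl_ord0.
    by apply: blk_spl; rewrite // sum_r1 pn_lt.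
  suff rhoj (j : 'I_p.+2) : unbump i0 (pn rho' j) = pn rho (unbump 0 j).
    exact: (rhoj (Ordinal lt_b)).
  rewrite pnE; case: (unliftP (lift ord0 ord0) j) => [k|] ->.
    rewrite lift_perm_lift unbump_lift.
    by rewrite -[unbump 0 _]/(unbump (ord0 : 'I_p.+1) _) unbump_lift pnE.
  rewrite lift_perm_id unbump_lift_self.
  rewrite -[unbump 0 _]/(unbump (ord0 : 'I_p.+1) _) unbump_lift_self.
  by rewrite pnE tpermL.
- by move=> t; rewrite pnE.
- by move=> L; apply: pn_lt.
- move=> L lt_L; rewrite -[L]/(val (Ordinal lt_L)) pnE -!tnth_nth.
  by rewrite spl_split.
- exact: pn_inj.
- apply: admG_sub Ax; apply: sub_Sig => t t'; rewrite !pnE => eq_d.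
  apply: (@pn_inj _ rho); rewrite -!blk_bp.
  have merge (v : 'I_(sumn r)) : blk r1 v = unbump 0 (blk d v).
    rewrite -[0%N]/(val (ord0 : 'I_p.+1)) /d /split1 -spl_ord0.
    by apply: blk_spl; rewrite // sum_r1.
  by rewrite !merge eq_d.
Qed.

(** Homogeneity of positive degree, applied to [0 = 0 *: 0] after moving [i0] to the front. *)
Lemma beta_zero p (r : p.-tuple nat) x (i0 : 'I_p) (a : p.-tuple A) :
  adm ar act r x -> tnth a i0 = 0 -> (0 < tnth r i0)%N -> be r x a = 0.
Proof.
case: p r i0 a => [|p] r i0 a; first by case: i0.
move=> Ax Ea r_gt0; case: beP => b1 _ b3 _ _.
pose rho := tperm ord0 i0; rewrite (b1 _ _ _ rho _ Ax).
rewrite (tuple_cons_behead (atw _ _)).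
have -> : thead (atw rho a) = 0 *: 0.
  by rewrite /thead tnth_mktuple tpermV tpermL Ea scale0r.
rewrite b3; last first.
  apply/(admE _ (esym (sumn_rtw _ _))); apply: (adm_pact _ Ax) => t t'.
  by rewrite -!pnE !blk_bperm // (inj_eq (@pn_inj _ rho)).
have -> : thead (rtw rho r) = tnth r i0 by rewrite /thead tnth_mktuple tpermV tpermL.
by case: (tnth r i0) r_gt0 => // n _; rewrite expr0n /= scale0r.
Qed.

End Beta.

(** * Wreath products and operadic composition *)

Lemma choices_cons (U : Type) (s : seq U) ss :
  choices (s :: ss) = [seq z :: l | z <- s, l <- choices ss].
Proof. by []. Qed.

Lemma mem_choices (U : eqType) (d : U) ss cs :
  cs \in choices ss <->
  size cs = size ss /\ forall i, (i < size ss)%N -> nth d cs i \in nth [::] ss i.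
Proof.
elim: ss cs => [|s ss IH] cs.
  by rewrite inE; split=> [/eqP->|[/size0nil ->]].
rewrite choices_cons; split=> [/allpairsP[[y l] /= [y_in /IH[sz H] ->]]|].
  by split; [rewrite /= sz | case=> [|i] //=; apply: H].
case: cs => [|y l] [] //= [sz] H; apply/allpairsP; exists (y, l); split=> //=.
  exact: (H 0%N).
by apply/IH; split=> // i; apply: (H i.+1).
Qed.

Lemma choices_uniq (U : eqType) (ss : seq (seq U)) :
  all uniq ss -> uniq (choices ss).
Proof.
elim: ss => // s ss IH /= /andP[us /IH uss].
by apply: allpairs_uniq => // -[y l] [y' l'] _ _ /= [-> ->].
Qed.

Lemma big_choices (U : Type) (V : nmodType) (s : seq U) ss (G : seq U -> V) :
  \sum_(cs <- choices (s :: ss)) G cs = \sum_(z <- s) \sum_(l <- choices ss) G (z :: l).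
Proof. by rewrite choices_cons big_allpairs_dep. Qed.

Lemma eq_seq_ord U n (d : U) (s s' : seq U) :
  size s = n -> size s' = n -> (forall v : 'I_n, nth d s v = nth d s' v) -> s = s'.
Proof.
move=> sz sz' eq_s; apply: (@eq_from_nth _ d) => [|i]; rewrite ?sz ?sz' // => lt_i.
exact: (eq_s (Ordinal lt_i)).
Qed.

Definition permv U n (d : U) (pi : 'S_n) (s : seq U) : seq U :=
  [seq nth d s (pi v) | v <- enum 'I_n].

Lemma nth_map_ord U n (d : U) (h : 'I_n -> U) (v : 'I_n) :
  nth d [seq h v | v <- enum 'I_n] v = h v.
Proof. by rewrite (nth_map v) ?size_enum_ord // nth_ord_enum. Qed.

Lemma size_map_ord U n (h : 'I_n -> U) : size [seq h v | v <- enum 'I_n] = n.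
Proof. by rewrite size_map size_enum_ord. Qed.

Lemma nth_permv U n (d : U) (pi : 'S_n) s (v : 'I_n) :
  nth d (permv d pi s) v = nth d s (pi v).
Proof. exact: nth_map_ord. Qed.

Lemma size_permv U n (d : U) (pi : 'S_n) s : size (permv d pi s) = n.
Proof. exact: size_map_ord. Qed.

Lemma choices_permv (U : eqType) n (d : U) (pi : 'S_n) (ss : seq (seq U)) :
  size ss = n -> all uniq ss ->
  perm_eq (map (permv d pi) (choices ss)) (choices (permv [::] pi ss)).
Proof.
move=> sz us; apply: uniq_perm.
- rewrite map_inj_in_uniq ?choices_uniq // => cs cs'.
  move=> /(mem_choices d)[szc _] /(mem_choices d)[szc' _] eq_p.
  apply: (@eq_seq_ord _ n d); rewrite ?szc ?szc' // => v.
  by rewrite -[v](permKV pi) -!(nth_permv d) eq_p.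
- apply: choices_uniq; apply/allP=> s /mapP[v _ ->].
  by apply: (allP us); rewrite mem_nth ?sz.
move=> cs; apply/mapP/idP => [[cs' /(mem_choices d)[szc H] ->]|/(mem_choices d)].
  apply/(mem_choices d); rewrite !size_permv; split=> // i lt_i.
  rewrite -[i]/(val (Ordinal lt_i)) !nth_permv; apply: H; by rewrite sz.
rewrite size_permv => -[szc H]; exists (permv d pi^-1 cs); last first.
  apply: (@eq_seq_ord _ n d); rewrite ?size_permv // => v.
  by rewrite !nth_permv permK.
apply/(mem_choices d); rewrite size_permv; split=> // i; rewrite sz => lt_i.
rewrite -[i]/(val (Ordinal lt_i)) nth_permv; have := H (pi^-1 (Ordinal lt_i))%g.
by rewrite nth_permv permKV; apply.
Qed.

(** Transports a permutation along an equation between sizes by passing through its underlying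
    function on [nat]. *)
Lemma act_cast n m (s : 'S_n) z : n = m -> act s z = act (mkperm m (pn s)) z.
Proof. by move=> eq_n; subst m; rewrite (@mkperm_pn _ s). Qed.

Section Theta.
Variables (n : nat) (ms : seq nat).
Hypothesis size_ms : size ms = n.

Definition locn (loc : forall u : 'I_n, 'S_(nth 0%N ms u)) (u o : nat) : nat :=
  if insub u is Some u' then pn (loc u') o else o.

(* The permutation of [sumn ms] sending the [u]-th block to the [pi u]-th one,
   through [loc u]. *)
Definition theta (pi : 'S_n) (loc : forall u : 'I_n, 'S_(nth 0%N ms u)) :
    'S_(sumn ms) :=
  mkperm (sumn ms) (fun t =>
    off ms (pn pi (blk ms t)) + locn loc (blk ms t) (t - off ms (blk ms t)))%N.

Lemma locnE loc (u : 'I_n) o : locn loc u o = pn (loc u) o.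
Proof. by rewrite /locn valK. Qed.

Lemma thetaE (pi : 'S_n) loc t :
  (forall u : 'I_n, nth 0%N ms (pi u) = nth 0%N ms u) -> (t < sumn ms)%N ->
  pn (theta pi loc) t
  = (off ms (pn pi (blk ms t)) + locn loc (blk ms t) (t - off ms (blk ms t)))%N.
Proof.
move=> Hpi; apply: mkpermE.
  move=> v lt_v; have lt_b := blk_lt lt_v; rewrite size_ms in lt_b.
  apply: off_add_lt; rewrite -[blk ms v]/(val (Ordinal lt_b)) pnE Hpi locnE pn_lt //.
  exact: blk_sub_lt.
have lt_o v : (v < sumn ms)%N ->
    (locn loc (blk ms v) (v - off ms (blk ms v)) < nth 0%N ms (pn pi (blk ms v)))%N.
  move=> lt_v; have lt_b := blk_lt lt_v; rewrite size_ms in lt_b.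
  rewrite -[blk ms v]/(val (Ordinal lt_b)) pnE Hpi locnE pn_lt //.
  exact: blk_sub_lt.
move=> v w lt_v lt_w eq_vw.
have eq_b : blk ms v = blk ms w.
  apply: (@pn_inj _ pi).
  by rewrite -(blk_offE (lt_o v lt_v)) eq_vw blk_offE ?lt_o.
move: eq_vw; rewrite eq_b => /addnI.
have lt_b := blk_lt lt_w; rewrite size_ms in lt_b.
rewrite -[blk ms w]/(val (Ordinal lt_b)) !locnE => /pn_inj eq_o.
by rewrite -(subnKC (blk_off_le lt_v)) -(subnKC (blk_off_le lt_w)) eq_b eq_o.
Qed.

Lemma theta_coord (pi : 'S_n) loc (u : 'I_n) o :
  (forall u : 'I_n, nth 0%N ms (pi u) = nth 0%N ms u) ->
  (o < nth 0%N ms u)%N ->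
  pn (theta pi loc) (off ms u + o) = (off ms (pi u) + pn (loc u) o)%N.
Proof.
by move=> Hpi lt_o; rewrite thetaE ?off_add_lt // blk_offE // pnE addKn locnE.
Qed.

End Theta.

Section OperadLaws.
Variables (e : T) (comp : T -> seq T -> T).
Hypothesis op : set_operad ar act e comp.

Lemma ar_comp b ys : ar b = size ys -> ar (comp b ys) = sumn (map ar ys).
Proof. by case: op => [[_ _ _ _ H] _]; apply: H. Qed.

(** Joins the two equivariance axioms: [loc] first acts inside the blocks, then [pi] moves the
    blocks. The inverse appears because the input at position [u] ends up at position [pi u]. *)
Lemma theta_act b (ys : seq T) n (pi : 'S_n)
    (loc : forall u : 'I_n, 'S_(nth 0%N (map ar ys) u)) :
  ar b = n -> size ys = n ->
  (forall u : 'I_n, nth 0%N (map ar ys) (pi u) = nth 0%N (map ar ys) u) ->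
  act (theta pi loc) (comp b ys)
  = comp (act pi b)
      (permv e pi^-1 [seq act (loc u) (nth e ys u) | u <- enum 'I_n]).
Proof.
move=> arb szy Hpi; set ms := map ar ys in loc Hpi *.
have szm : size ms = n by rewrite size_map.
case: op => _ [_ _ _ op4 op5].
set Z := [seq act (loc u) _ | u <- _]; set W := permv e pi^-1 Z.
have szZ : size Z = n by exact: size_map_ord.
have szW : size W = n by exact: size_permv.
have arZ : map ar Z = ms.
  apply: (@eq_seq_ord _ n 0%N); [by rewrite size_map | by [] | move=> u].
  rewrite (nth_map e) ?szZ // nth_map_ord; apply: ar_act.
  by rewrite (nth_map e) // szy.
have H1 (u : 'I_n) : nth 0%N ms ((1%g : 'S_n) u) = nth 0%N ms u by rewrite perm1.
pose tau := theta (1%g : 'S_n) loc.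
have tauE t : (t < sumn ms)%N ->
    pn tau t = (off ms (blk ms t) + locn loc (blk ms t) (t - off ms (blk ms t)))%N.
  by move=> lt_t; rewrite thetaE // pn1.
have lt_l t : (t < sumn ms)%N ->
    (locn loc (blk ms t) (t - off ms (blk ms t)) < nth 0%N ms (blk ms t))%N.
  move=> lt_t; have lt_b := blk_lt lt_t; rewrite szm in lt_b.
  rewrite -[blk ms t]/(val (Ordinal lt_b)) locnE pn_lt //.
  exact: blk_sub_lt.
have tauS : tau \in Sig (sumn ms) (blk ms).
  apply/SigP=> t; rewrite -pnE tauE // blk_offE //; exact: lt_l.
have := op5 b ys tau; rewrite arb szy => /(_ erefl tauS).
have -> : [seq act (restr tau i) (nth e ys i) | i <- iota 0 n] = Z.
  apply: (@eq_seq_ord _ n e); [by rewrite size_map size_iota | by [] | move=> u].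
  rewrite (nth_map 0%N) ?size_iota // nth_iota // add0n nth_map_ord.
  congr act; apply: mkperm_pn => o lt_o.
  by rewrite theta_coord // perm1 addKn.
move=> eq_tau.
have := op4 n pi b W arb szW; rewrite /=.
have -> : [seq nth e W (pn pi i) | i <- iota 0 n] = Z.
  apply: (@eq_seq_ord _ n e); [by rewrite size_map size_iota | by [] | move=> u].
  rewrite (nth_map 0%N) ?size_iota // nth_iota // add0n pnE nth_permv permK.
  by [].
set rr := [tuple _ | i < n] => ->; rewrite eq_tau.
have val_rr : val rr = ms.
  apply: (@eq_seq_ord _ n 0%N); rewrite ?size_tuple // => u.
  by rewrite (nth_tnth rr u) tnth_mktuple arZ.
have val_rt : val (rtw pi rr) = ms.
  apply: (@eq_seq_ord _ n 0%N); rewrite ?size_tuple // => u.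
  rewrite -[u](permKV pi) -[in LHS]pnE nth_rtw // Hpi.
  by rewrite -[tval rr]/(val rr) val_rr.
have sum_rr : sumn rr = sumn ms by rewrite -[tval rr]/(val rr) val_rr.
rewrite (act_cast _ _ sum_rr) actM; last by rewrite ar_comp ?szy.
congr act; apply: eq_pn => t lt_t; rewrite thetaE // pnM.
have lt_tau : (pn tau t < sumn ms)%N by exact: pn_lt.
rewrite (@mkpermE _ (pn (bperm pi rr))) //; first last.
- by move=> i j _ _ /pn_inj.
- by move=> i; rewrite -sum_rr; apply: pn_lt.
rewrite bpermE ?sum_rr // -[tval rr]/(val rr) -[tval (rtw _ _)]/(val (rtw pi rr)).
rewrite val_rt val_rr tauE // blk_offE ?addKn //; exact: lt_l.
Qed.

(* [lab] is the labelling of a wreath product: [c u] is the colour of the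
   [u]-th block and [il i] the labelling inside a block of colour [i]. *)
Definition wreath_labels (ms : seq nat) (c : nat -> nat) (il : nat -> nat -> nat)
    (lab : nat -> nat) : Prop :=
  [/\ forall u, (u < size ms)%N -> (0 < nth 0%N ms u)%N,
      forall u v, (u < size ms)%N -> (v < size ms)%N -> c u = c v ->
        nth 0%N ms u = nth 0%N ms v &
      forall u v o o', (o < nth 0%N ms u)%N -> (o' < nth 0%N ms v)%N ->
        (lab (off ms u + o)%N == lab (off ms v + o')%N)
        = (c u == c v) && (il (c u) o == il (c u) o')].

(** The set [Wr] with free parameters, so that the wreath groups before and after a change of index
    set lie in one ['S_N]. *)
Definition WrG N (ms : seq nat) (lab : nat -> nat) : {set 'S_N} :=
  [set s : 'S_N |
     [forall t : 'I_N, forall t' : 'I_N,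
        (blk ms t == blk ms t') ==> (blk ms (s t) == blk ms (s t'))]
     && [forall t : 'I_N, lab (s t) == lab t]].

Lemma WrGP N ms (lab : nat -> nat) (s : 'S_N) :
  reflect ((forall t t' : 'I_N, blk ms t = blk ms t' -> blk ms (s t) = blk ms (s t'))
           /\ forall t : 'I_N, lab (s t) = lab t)
          (s \in WrG N ms lab).
Proof.
rewrite inE; apply: (iffP andP) => -[H1 H2]; split.
- by move=> t t' /eqP E; have /forallP/(_ t)/forallP/(_ t')/implyP/(_ E)/eqP := H1.
- by move=> t; apply/eqP/(forallP H2).
- by apply/forallP=> t; apply/forallP=> t'; apply/implyP=> /eqP/H1 ->.
by apply/forallP=> t; rewrite H2.
Qed.

Lemma group_set_WrG N ms lab : group_set (WrG N ms lab).
Proof.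
apply/group_setP; split; first by apply/WrGP; split=> *; rewrite !perm1.
move=> s s' /WrGP[H1 H2] /WrGP[H1' H2']; apply/WrGP; split=> [t t' E|t].
  by rewrite !permM; apply/H1'/H1.
by rewrite permM H2' H2.
Qed.

Canonical WrG_group N ms lab := Group (group_set_WrG N ms lab).

Lemma WrG_Sig N ms lab : WrG N ms lab \subset Sig N lab.
Proof. by apply/subsetP=> s /WrGP[_ H]; apply/SigP. Qed.

Section Wreath.
Variables (ms : seq nat) (n : nat) (c : nat -> nat) (il : nat -> nat -> nat).
Variable lab : nat -> nat.
Hypothesis wl : wreath_labels ms c il lab.
Hypothesis size_ms : size ms = n.
Local Notation N := (sumn ms).

Local Notation locT := {dffun forall u : 'I_n, 'S_(nth 0%N ms u)}.

Lemma Sig_col_ms (pi : 'S_n) (u : 'I_n) :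
  pi \in Sig n c -> nth 0%N ms (pi u) = nth 0%N ms u.
Proof. by case: wl => _ H _ /SigP Hpi; apply: H; rewrite ?size_ms. Qed.

Lemma theta_WrG (pi : 'S_n) (loc : forall u : 'I_n, 'S_(nth 0%N ms u)) :
  pi \in Sig n c -> (forall u : 'I_n, loc u \in Sig (nth 0%N ms u) (il (c u))) ->
  theta pi loc \in WrG N ms lab.
Proof.
move=> piS locS; have Hpi u := Sig_col_ms u piS.
have coord (t : 'I_N) : exists (u : 'I_n) o, [/\ blk ms t = u, (o < nth 0%N ms u)%N &
     t = (off ms u + o)%N :> nat /\ theta pi loc t = (off ms (pi u) + pn (loc u) o)%N :> nat].
  have [o lt_o Et] := blk_coord (ltn_ord t); have lt_b := blk_lt (ltn_ord t).
  rewrite size_ms in lt_b; exists (Ordinal lt_b), o; split=> //; split=> //.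
  by rewrite -pnE {1}Et (theta_coord size_ms _ (u := Ordinal lt_b)).
apply/WrGP; split=> [t t'|t].
  have [u [o [-> lt_o [_ ->]]]] := coord t; have [u' [o' [-> lt_o' [_ ->]]]] := coord t'.
  by move/ord_inj => eq_u; subst u'; rewrite !blk_offE ?Hpi ?pn_lt.
have [u [o [_ lt_o [-> ->]]]] := coord t; case: wl => _ _ Hl; apply/eqP.
have /SigP cpi := piS; rewrite Hl ?Hpi ?pn_lt // cpi eqxx /=.
by have /SigP/(_ (Ordinal lt_o)) := locS u; rewrite -pnE /= => ->.
Qed.

(** Block [u] goes to the block containing the image of its first point, which exists because blocks
    are nonempty. This map of blocks is injective because the inverse of [g] also respects blocks;
    equal colours force equal lengths, and subtracting offsets gives the inner permutations. *)
Lemma WrG_theta (g : 'S_N) :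
  g \in WrG N ms lab ->
  exists (pi : 'S_n) (loc : {dffun forall u : 'I_n, 'S_(nth 0%N ms u)}),
    [/\ pi \in Sig n c,
        forall u : 'I_n, loc u \in Sig (nth 0%N ms u) (il (c u)) &
        g = theta pi loc].
Proof.
move=> gW; have gV := groupVr gW; have [ms_gt0 Hm Hl] := wl.
have ltN u o : (o < nth 0%N ms u)%N -> (off ms u + o < N)%N by exact: off_add_lt.
have gblk g' t t' : g' \in WrG N ms lab -> (t < N)%N -> (t' < N)%N ->
    blk ms t = blk ms t' -> blk ms (pn g' t) = blk ms (pn g' t').
  move=> /WrGP[H _] lt_t lt_t'.
  by rewrite -[t]/(val (Ordinal lt_t)) -[t']/(val (Ordinal lt_t')) !pnE; apply: H.
pose pin u := blk ms (pn g (off ms u)).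
have off_lt u : (u < n)%N -> (off ms u < N)%N.
  by move=> lt_u; rewrite -[off _ _]addn0 ltN // ms_gt0 // size_ms.
have pin_lt u : (u < n)%N -> (pin u < n)%N.
  by move=> lt_u; rewrite -size_ms blk_lt // pn_lt ?off_lt.
have blk_off u : (u < n)%N -> blk ms (off ms u) = u.
  by move=> lt_u; rewrite -[off _ _]addn0 blk_offE // ms_gt0 ?size_ms.
have pinE u o : (u < n)%N -> (o < nth 0%N ms u)%N -> blk ms (pn g (off ms u + o)) = pin u.
  by move=> lt_u lt_o; apply: gblk; rewrite ?ltN ?off_lt // blk_off ?blk_offE.
have pin_inj u v : (u < n)%N -> (v < n)%N -> pin u = pin v -> u = v.
  move=> lt_u lt_v; move/(gblk _ _ _ gV); rewrite !pnK !pn_lt ?off_lt //.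
  by rewrite !blk_off //; apply.
pose pi := mkperm n pin.
have piE (u : 'I_n) : pi u = pin u :> nat by rewrite -pnE mkpermE.
pose o1 u o := (pn g (off ms u + o) - off ms (pin u))%N.
have gE u o : (u < n)%N -> (o < nth 0%N ms u)%N ->
    pn g (off ms u + o) = (off ms (pin u) + o1 u o)%N /\ (o1 u o < nth 0%N ms (pin u))%N.
  move=> lt_u lt_o; have lt_g : (pn g (off ms u + o) < N)%N by rewrite pn_lt ?ltN.
  rewrite /o1 -(pinE u o) //; split; last exact: blk_sub_lt.
  by rewrite subnKC ?blk_off_le.
have labE u o : (u < n)%N -> (o < nth 0%N ms u)%N ->
    c (pin u) = c u /\ il (c u) (o1 u o) = il (c u) o.
  move=> lt_u lt_o; have [Eg lt_o1] := gE u o lt_u lt_o.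
  have /WrGP[_ /(_ (Ordinal (ltN _ _ lt_o)))] := gW; rewrite -pnE /= Eg => /eqP.
  by rewrite Hl // => /andP[/eqP -> /eqP].
have msE u : (u < n)%N -> nth 0%N ms (pin u) = nth 0%N ms u.
  move=> lt_u; apply: Hm; rewrite ?size_ms ?pin_lt //.
  by case: (labE u 0%N) => //; rewrite ms_gt0 ?size_ms.
have o1E (u : 'I_n) o : (o < nth 0%N ms u)%N -> pn (mkperm (nth 0%N ms u) (o1 u)) o = o1 u o.
  apply: mkpermE => [i lt_i|i j lt_i lt_j eq_ij].
    by have [_] := gE u i (ltn_ord u) lt_i; rewrite msE.
  have [Ei _] := gE u i (ltn_ord u) lt_i; have [Ej _] := gE u j (ltn_ord u) lt_j.
  by apply: (@addnI (off ms u)); apply: (@pn_inj _ g); rewrite Ei Ej eq_ij.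
exists pi, [ffun u : 'I_n => mkperm (nth 0%N ms u) (o1 u)]; split.
- apply/SigP=> u; rewrite piE; case: (labE u 0%N) => //.
  by rewrite ms_gt0 ?size_ms.
- move=> u; rewrite ffunE; apply/SigP=> o; rewrite -pnE o1E //.
  by case: (labE u o).
apply: eq_pn => t lt_t; have lt_b := blk_lt lt_t; rewrite size_ms in lt_b.
have [o lt_o ->] := blk_coord lt_t; have [-> _] := gE _ _ lt_b lt_o.
rewrite (theta_coord size_ms _ (u := Ordinal lt_b)) // => [|u]; last by rewrite piE msE.
by rewrite ffunE o1E // piE.
Qed.

(** The parametrisation by [theta] is injective: a point of each block reveals [pi], and then the
    offsets inside the block reveal [loc]. *)
Lemma WrG_sum (h : 'S_N -> nat) :
  (\sum_(w in WrG N ms lab) h w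
   = \sum_(pi in Sig n c)
       \sum_(loc in setXn (fun u : 'I_n => Sig (nth 0%N ms u) (il (c u))))
         h (theta pi loc))%N.
Proof.
pose Dom := [set d : 'S_n * locT |
  (d.1 \in Sig n c) && (d.2 \in setXn (fun u : 'I_n => Sig (nth 0%N ms u) (il (c u))))].
pose th (d : 'S_n * locT) := theta d.1 d.2.
have inj_th : {in Dom &, injective th}.
  move=> [pi loc] [pi' loc'] /=; rewrite !in_set /= => /andP[piS _] /andP[pi'S _] eq_th.
  have [ms_gt0 _ _] := wl.
  have mspi (u : 'I_n) : nth 0%N ms (pi u) = nth 0%N ms u.
    by apply: Sig_col_ms; rewrite in_set.
  have mspi' (u : 'I_n) : nth 0%N ms (pi' u) = nth 0%N ms u.
    by apply: Sig_col_ms; rewrite in_set.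
  have co (u : 'I_n) o : (o < nth 0%N ms u)%N ->
      pi u = pi' u /\ pn (loc u) o = pn (loc' u) o.
    move=> lt_o; have := congr1 (fun s : 'S_N => pn s (off ms u + o)) eq_th.
    rewrite /th /= !theta_coord // => E.
    have Epi : pi u = pi' u.
      apply: ord_inj; have lo : (pn (loc u) o < nth 0%N ms (pi u))%N.
        by rewrite mspi pn_lt.
      by rewrite -(blk_offE lo) E blk_offE // mspi' pn_lt.
    by split=> //; move: E; rewrite Epi => /addnI.
  congr pair; first by apply/permP=> u; case: (co u 0%N) => //; rewrite ms_gt0 ?size_ms.
  by apply/ffunP=> u; apply: eq_pn => o /co[].
rewrite pair_big /= [RHS](eq_bigl (mem Dom)); last first.
  by move=> d; rewrite -[RHS]/(d \in Dom) [RHS]in_set.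
rewrite -[RHS](big_imset h inj_th); apply: eq_bigl => g; apply/idP/imsetP.
  move=> /WrG_theta[pi [loc [piS locS ->]]]; exists (pi, loc) => //.
  by rewrite [X in is_true X]in_set /= piS; apply/setXnP.
case=> -[pi loc]; rewrite [X in is_true X]in_set => /andP[piS /setXnP locS] ->.
exact: theta_WrG.
Qed.

End Wreath.

(** Here [ms] is a variable, since the type of [loc] must not change with the word [ys]. *)
Lemma theta_act_ms b (ys : seq T) n (ms : seq nat) (pi : 'S_n)
    (loc : forall u : 'I_n, 'S_(nth 0%N ms u)) :
  map ar ys = ms -> ar b = n -> size ys = n ->
  (forall u : 'I_n, nth 0%N ms (pi u) = nth 0%N ms u) ->
  act (theta pi loc) (comp b ys)
  = comp (act pi b)
      (permv e pi^-1 [seq act (loc u) (nth e ys u) | u <- enum 'I_n]).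
Proof. by move=> Ems; subst ms; apply: theta_act. Qed.

(* Multilinear extension of [h]; [e] is only a default for [nth]. *)
Definition ML (V : lmodType F) (Zs : seq P) (h : seq T -> V) : V :=
  \sum_(cs <- choices [seq enum_fset (msupp z) | z <- Zs])
     (\prod_(i < size Zs) (nth 0 Zs i)@_(nth e cs i)) *: h cs.

Lemma Pcomp_ML x Zs :
  Pcomp e comp x Zs = lin x (fun b => ML Zs (fun cs => << comp b cs >>)).
Proof.
apply: eq_bigr => b _; rewrite scaler_sumr; apply: eq_bigr => cs _.
by rewrite malgUZ scalerA.
Qed.

Lemma ML_nil (V : lmodType F) (h : seq T -> V) : ML [::] h = h [::].
Proof. by rewrite /ML /= big_seq1 big_ord0 scale1r. Qed.

Lemma ML_cons (V : lmodType F) z Zs (h : seq T -> V) :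
  ML (z :: Zs) h = lin z (fun b => ML Zs (fun cs => h (b :: cs))).
Proof.
rewrite /ML map_cons big_choices /lin; apply: eq_bigr => b _.
rewrite scaler_sumr; apply: eq_bigr => cs _.
by rewrite [size _]/= big_ord_recl scalerA.
Qed.

Lemma mem_choices_supp Zs cs :
  cs \in choices [seq enum_fset (msupp z) | z <- Zs] <->
  size cs = size Zs /\
  forall i, (i < size Zs)%N -> nth e cs i \in msupp (nth (0 : P) Zs i).
Proof.
split=> [/(mem_choices e)[]|[sz H]].
  rewrite size_map => sz H; split=> // i lt_i.
  by have := H i lt_i; rewrite (nth_map 0).
apply/(mem_choices e); rewrite size_map; split=> // i lt_i.
by rewrite (nth_map 0) //; apply: H.
Qed.

Lemma eq_ML (V : lmodType F) Zs (h h' : seq T -> V) :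
  (forall cs, size cs = size Zs ->
     (forall i, (i < size Zs)%N -> nth e cs i \in msupp (nth 0 Zs i)) ->
     h cs = h' cs) ->
  ML Zs h = ML Zs h'.
Proof.
by move=> eq_h; apply: eq_big_seq => cs /mem_choices_supp[sz H]; rewrite eq_h.
Qed.

Lemma pact_ML N (g : 'S_N) Zs (h : seq T -> P) :
  pact act g (ML Zs h) = ML Zs (fun cs => pact act g (h cs)).
Proof. by rewrite pact_sum; apply: eq_bigr => cs _; rewrite pactZ. Qed.

Lemma pact_lin_map N (g : 'S_N) x (h : T -> P) :
  pact act g (lin x h) = lin x (fun b => pact act g (h b)).
Proof. by rewrite pact_sum; apply: eq_bigr => b _; rewrite pactZ. Qed.

(** Expansion of a product of sums: a word [l] selects one summand at each position. *)
Lemma ML_sum (V : lmodType F) I K (us : seq K) (J : K -> seq I) (co : I -> F)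
    (z : I -> P) (h : seq T -> V) :
  ML [seq \sum_(i <- J u) co i *: z i | u <- us] h
  = \sum_(l <- choices (map J us)) (\prod_(i <- l) co i) *: ML (map z l) h.
Proof.
elim: us h => [|u us IH] h; first by rewrite /= big_seq1 big_nil scale1r.
rewrite map_cons ML_cons lin_sum [in RHS]map_cons big_choices.
apply: eq_bigr => i _; rewrite linZ.
rewrite (eq_lin (h' := fun b => \sum_(l <- choices (map J us))
    (\prod_(i <- l) co i) *: ML (map z l) (fun cs => h (b :: cs)))); last first.
  by move=> b _; rewrite IH.
rewrite lin_exchange scaler_sumr; apply: eq_bigr => l _.
by rewrite linZr scalerA big_cons map_cons ML_cons.
Qed.

Lemma ML_map_lin (V : lmodType F) I (us : seq I) (z : I -> P) (a : I -> T -> T)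
    (h : seq T -> V) :
  ML [seq lin (z u) (fun b => << a u b >>) | u <- us] h
  = ML [seq z u | u <- us] (fun cs => h [seq a p.1 p.2 | p <- zip us cs]).
Proof.
elim: us h => [|u us IH] h; first by rewrite !ML_nil.
rewrite !map_cons !ML_cons lin_lin; apply: eq_lin => b _.
by rewrite linU IH.
Qed.

Lemma ML_U (V : lmodType F) cs (h : seq T -> V) :
  ML [seq << b >> | b <- cs] h = h cs.
Proof.
elim: cs h => [|b cs IH] h; first by rewrite ML_nil.
by rewrite map_cons ML_cons linU IH.
Qed.

Lemma ML_permv (V : lmodType F) n (pi : 'S_n) Zs (h : seq T -> V) :
  size Zs = n ->
  ML (permv 0 pi Zs) h = ML Zs (fun cs => h (permv e pi cs)).
Proof.
move=> sz; rewrite /ML.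
have -> : [seq enum_fset (msupp z) | z <- permv 0 pi Zs]
          = permv [::] pi [seq enum_fset (msupp z) | z <- Zs].
  apply: (@eq_seq_ord _ n [::]); [by rewrite size_map size_permv | by rewrite size_permv | move=> v].
  by rewrite (nth_map 0) ?size_permv // !nth_permv (nth_map 0) // sz.
have szS : size [seq enum_fset (msupp z) | z <- Zs] = n by rewrite size_map.
have uS : all uniq [seq enum_fset (msupp z) | z <- Zs].
  by apply/allP=> s /mapP[z _ ->]; apply: fset_uniq.
rewrite -(perm_big _ (choices_permv e pi szS uS)).
rewrite big_map; apply: eq_bigr => cs _; congr (_ *: _).
rewrite size_permv sz [RHS](reindex_inj (@perm_inj _ pi)) /=.
by apply: eq_bigr => i _; rewrite !nth_permv.
Qed.

Lemma zip_enum n (a : 'I_n -> T -> T) cs :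
  size cs = n ->
  [seq a p.1 p.2 | p <- zip (enum 'I_n) cs]
  = [seq a u (nth e cs u) | u <- enum 'I_n].
Proof.
move=> sz; apply: (@eq_seq_ord _ n e).
- by rewrite size_map size_zip size_enum_ord sz minnn.
- exact: size_map_ord.
move=> u; rewrite nth_map_ord (nth_map (u, e)) ?size_zip ?size_enum_ord ?sz ?minnn //.
by rewrite nth_zip ?size_enum_ord ?sz //= nth_ord_enum.
Qed.

(** The arguments absorb [loc] and [x] absorbs [pi], so only the permutation of the arguments
    survives. *)
Lemma Pcomp_theta (ms : seq nat) n (c : nat -> nat) il lab x Zs (pi : 'S_n)
    (loc : forall u : 'I_n, 'S_(nth 0%N ms u)) :
  wreath_labels ms c il lab -> size ms = n ->
  pi \in Sig n c -> admG (Sig n c) x -> size Zs = n ->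
  (forall u : 'I_n, inP ar (nth 0%N ms u) (nth 0 Zs u)) ->
  (forall u : 'I_n, pact act (loc u) (nth 0 Zs u) = nth 0 Zs u) ->
  pact act (theta pi loc) (Pcomp e comp x Zs) = Pcomp e comp x (permv 0 pi^-1 Zs).
Proof.
move=> wl size_ms piS [Px Ix] sz PZ IZ; have Hpi u := Sig_col_ms wl size_ms u piS.
pose k b := ML (permv 0 pi^-1 Zs) (fun cs => << comp b cs >> : P).
rewrite !Pcomp_ML pact_lin_map -/k.
transitivity (lin x (fun b => k (act pi b))); last first.
  by rewrite -[in RHS](Ix pi piS) pact_lin lin_lin; apply: eq_lin => b _; rewrite linU.
apply: eq_lin => b /Px arb; rewrite pact_ML /k ML_permv //.
pose zf (u : 'I_n) : P := nth 0 Zs u.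
have EZ : Zs = [seq lin (zf u) (fun b => << act (loc u) b >>) | u <- enum 'I_n].
  apply: (@eq_seq_ord _ n 0); rewrite ?size_map_ord // => u.
  by rewrite nth_map_ord -pact_lin IZ.
rewrite [in RHS]EZ (@ML_map_lin _ _ _ zf).
have -> : [seq zf u | u <- enum 'I_n] = Zs.
  apply: (@eq_seq_ord _ n 0); rewrite ?size_map_ord // => u.
  by rewrite nth_map_ord.
apply: eq_ML => cs; rewrite sz => szc Hcs.
have Ems : map ar cs = ms.
  apply: (@eq_seq_ord _ n 0%N); rewrite ?size_map // => u.
  rewrite (nth_map e) ?szc //; apply: (PZ u); exact: Hcs.
by rewrite pactU (theta_act_ms _ Ems) // (zip_enum (fun u => act (loc u))).
Qed.

Lemma inP_Pcomp N (ms : seq nat) x Zs :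
  inP ar (size ms) x -> size Zs = size ms ->
  (forall u, (u < size ms)%N -> inP ar (nth 0%N ms u) (nth 0 Zs u)) ->
  N = sumn ms -> inP ar N (Pcomp e comp x Zs).
Proof.
move=> Px sz PZ ->; rewrite Pcomp_ML /lin big_seq_cond; apply: inP_sum => b.
rewrite andbT => /Px arb; rewrite -[X in inP _ _ X]addr0; apply: inPP; last exact: inP0.
rewrite /ML big_seq_cond; apply: inP_sum => cs; rewrite andbT.
move=> /mem_choices_supp[szc Hcs].
rewrite -[X in inP _ _ X]addr0; apply: inPP; last exact: inP0.
have Ems : map ar cs = ms.
  apply: (@eq_seq_ord _ (size ms) 0%N); rewrite ?size_map ?szc // => u.
  rewrite (nth_map e) ?szc ?sz //; apply: (PZ u) => //; apply: Hcs; by rewrite sz.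
by apply: inPU; rewrite ar_comp ?Ems // arb szc sz.
Qed.

Lemma stab_gt0 n (G : {group 'S_n}) b : ar b = n -> (0 < #|stab act G b|)%N.
Proof. by move=> arb; apply/card_gt0P; exists 1%g; rewrite inE group1 act1 /=. Qed.

(** Orbit counting in each coordinate: the families [loc] producing a given word form a product of
    transporters. *)
Lemma prod_orbit_sum n (ms : seq nat) (G : forall u : 'I_n, {group 'S_(nth 0%N ms u)})
    (zs : seq T) (H : seq T -> nat) :
  (forall u : 'I_n, ar (nth e zs u) = nth 0%N ms u) ->
  (\sum_(loc in setXn (fun u => G u : {set _}))
      H [seq act (loc u) (nth e zs u) | u <- enum 'I_n]
   = (\prod_(u < n) #|stab act (G u) (nth e zs u)|)
     * \sum_(cs <- choices [seq orbit act (G u) (nth e zs u) | u <- enum 'I_n]) H cs)%N.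
Proof.
move=> arz; set O := [seq orbit act _ _ | u <- _].
have szO : size O = n by exact: size_map_ord.
have uO : uniq (choices O).
  by apply: choices_uniq; apply/allP=> s /mapP[u _ ->]; apply: undup_uniq.
pose L (loc : {dffun forall u : 'I_n, 'S_(nth 0%N ms u)}) :=
  [seq act (loc u) (nth e zs u) | u <- enum 'I_n].
rewrite (eq_bigr (fun loc => \sum_(cs <- choices O) (L loc == cs) * H cs)%N); last first.
  move=> loc /setXnP locG.
  have L_in : L loc \in choices O.
    apply/(mem_choices e); rewrite szO size_map_ord; split=> // i lt_i.
    rewrite -[i]/(val (Ordinal lt_i)) !nth_map_ord.
    by apply/orbitP; exists (loc (Ordinal lt_i)); first exact: locG.
  rewrite (bigD1_seq _ L_in) //= eqxx mul1n big1 ?addn0 // => cs.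
  by rewrite eq_sym => /negbTE ->.
rewrite exchange_big /= big_distrr /=; apply: eq_big_seq => cs cs_in.
rewrite -big_distrl /=; congr (_ * _)%N.
have /(mem_choices e)[szc Hcs] := cs_in; rewrite szO in szc Hcs.
pose tr u := [set g in G u | act g (nth e zs u) == nth e cs u].
transitivity #|setXn tr|; last first.
  rewrite cardsXn; apply: eq_bigr => u _; apply: card_transporter => //.
  by have := Hcs u (ltn_ord u); rewrite nth_map_ord.
rewrite -sum1_card big_mkcond [RHS]big_mkcond; apply: eq_bigr => loc _.
case: setXnP => [locG|nlocG]; case: setXnP => [locT|nlocT] //.
- rewrite (_ : L loc == cs) //; apply/eqP/(@eq_seq_ord _ n e); rewrite ?size_map_ord // => u.
  by rewrite nth_map_ord; have := locT u; rewrite inE => /andP[_ /eqP].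
- rewrite (_ : (L loc == cs) = false) //; apply: contra_notF nlocT => /eqP Ecs u.
  by rewrite inE locG -Ecs nth_map_ord eqxx.
by case: nlocG => u; have := locT u; rewrite inE => /andP[].
Qed.

Lemma map_iota_ord U n (h : nat -> U) :
  [seq h u | u <- iota 0 n] = [seq h (val u) | u <- enum 'I_n].
Proof. by rewrite -val_enum_ord -map_comp. Qed.

(* The count behind gamma_6b: the wreath product acts on the pairs (b, cs) of
   elements of the orbits with stabilizer of the displayed order. *)
Lemma Tr_Pcomp_Osum (ys : seq T) n (c : nat -> nat) il lab b0 :
  wreath_labels (map ar ys) c il lab -> size ys = n -> ar b0 = n ->
  (forall u v : 'I_n, c u = c v -> nth e ys u = nth e ys v) ->
  Tr (WrG (sumn (map ar ys)) (map ar ys) lab) (Sig (sumn (map ar ys)) lab)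
     (Pcomp e comp (Osum act F (Sig n c) b0)
        [seq Osum act F (Sig (nth 0%N (map ar ys) u) (il (c u))) (nth e ys u)
           | u <- iota 0 n])
  = (#|stab act (Sig (sumn (map ar ys)) lab) (comp b0 ys)|
       %/ (#|stab act (Sig n c) b0|
           * \prod_(u < n) #|stab act (Sig (nth 0%N (map ar ys) u) (il (c u)))
                                  (nth e ys u)|))%N%:R
    *: Osum act F (Sig (sumn (map ar ys)) lab) (comp b0 ys).
Proof.
move=> wl szy arb0 coly; set ms := map ar ys in wl *.
have szm : size ms = n by rewrite size_map.
have ary (u : 'I_n) : ar (nth e ys u) = nth 0%N ms u by rewrite (nth_map e) // szy.
pose G (u : nat) := Sig_group (nth 0%N ms u) (il (c u)).
pose O := [seq orbit act (G u) (nth e ys u) | u <- iota 0 n].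
have EO : O = [seq orbit act (G (nat_of_ord u)) (nth e ys u) | u : 'I_n <- enum 'I_n].
  exact: map_iota_ord.
have szO : size O = n by rewrite size_map size_iota.
(* All coefficients of orbit sums are 1, so the composite is the sum over this list, in which
   repetitions are allowed. *)
pose L := [seq comp b cs | b <- orbit act (Sig n c) b0, cs <- choices O].
have -> : Pcomp e comp (Osum act F (Sig n c) b0)
    [seq Osum act F (Sig (nth 0%N ms u) (il (c u))) (nth e ys u) | u <- iota 0 n]
    = \sum_(z <- L) << z >>.
  rewrite Pcomp_ML /Osum lin_sum /L big_allpairs_dep; apply: eq_bigr => b _.
  rewrite linU.
  transitivity (ML [seq \sum_(z <- orbit act (G u) (nth e ys u)) 1 *: << z >> | u <- iota 0 n]
      (fun cs => << comp b cs >> : P)).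
    congr ML; apply: eq_map => u; apply: eq_bigr => z _; by rewrite scale1r.
  rewrite ML_sum; apply: eq_bigr => cs _.
  by rewrite big1 ?scale1r ?ML_U.
apply: (@Tr_count _ (WrG_group _ ms lab) (Sig_group _ lab)).
- exact: WrG_Sig.
- by rewrite ar_comp ?szy.
- rewrite muln_gt0 (stab_gt0 (Sig_group n c)) //=; apply: prodn_gt0 => u.
  exact: (stab_gt0 (G u)).
- move=> z /allpairsP[[b cs] /= [b_in /(mem_choices e)[szc Hcs] ->]].
  have arb := orbit_ar arb0 b_in; rewrite szO in szc Hcs.
  rewrite ar_comp ?arb //; congr sumn; apply: (@eq_seq_ord _ n 0%N); rewrite ?size_map // => u.
  rewrite (nth_map e) ?szc //; apply: (orbit_ar (G := G u) (b := nth e ys u)) => //.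
  by have := Hcs u (ltn_ord u); rewrite EO nth_map_ord.
move=> h; rewrite (WrG_sum wl szm).
rewrite (eq_bigr (fun pi => (\prod_(u < n) #|stab act (G u) (nth e ys u)|)
     * \sum_(cs <- choices O) h (comp (act pi b0) cs)))%N; last first.
  move=> pi piS; have Hpi u := Sig_col_ms wl szm u piS.
  have /SigP cpi : (pi^-1)%g \in Sig n c by rewrite groupV.
  have E : (\sum_(loc in setXn (fun u : 'I_n => G u : {set _}))
      h (comp (act pi b0) (permv e pi^-1 [seq act (loc u) (nth e ys u) | u <- enum 'I_n]))
    = (\prod_(u < n) #|stab act (G u) (nth e ys u)|)
      * \sum_(cs <- choices O) h (comp (act pi b0) (permv e pi^-1 cs)))%N.
    rewrite EO; exact: (@prod_orbit_sum n ms (fun u : 'I_n => G u) ys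
            (fun cs => h (comp (act pi b0) (permv e pi^-1 cs))) ary).
  rewrite (eq_bigr (fun loc : {dffun forall u : 'I_n, 'S_(nth 0%N ms u)} =>
     h (comp (act pi b0) (permv e pi^-1 [seq act (loc u) (nth e ys u) | u <- enum 'I_n])))); last first.
    by move=> loc _; rewrite theta_act.
  rewrite E; congr (_ * _)%N.
  (* [pi] preserves colours, and blocks of one colour carry the same orbit; so permuting the
     positions only reorders the list of words. *)
  have Op : permv [::] pi^-1 O = O.
    apply: (@eq_seq_ord _ n [::]); rewrite ?size_permv // => u.
    rewrite nth_permv EO !nth_map_ord /G.
    have -> : nth e ys ((pi^-1)%g u) = nth e ys u by apply: coly; rewrite cpi.
    have -> : nth 0%N ms ((pi^-1)%g u) = nth 0%N ms u by rewrite -Hpi permKV.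
    by rewrite cpi.
  rewrite -(big_map (permv e pi^-1) xpredT (fun cs => h (comp (act pi b0) cs))).
  rewrite (perm_big _ (choices_permv e pi^-1 szO _)) ?Op //.
  by apply/allP=> s /mapP[u _ ->]; apply: undup_uniq.
rewrite -big_distrr /= mulnAC mulnC; congr (_ * _)%N.
rewrite -(@orbit_sum _ (Sig_group n c) b0 (fun b => \sum_(cs <- choices O) h (comp b cs))%N) //.
by congr (_ * _)%N; rewrite /L big_allpairs_dep.
Qed.

Lemma wreath_lab_eq ms c il lab t t' :
  wreath_labels ms c il lab -> (t < sumn ms)%N -> (t' < sumn ms)%N ->
  (lab t == lab t')
  = (c (blk ms t) == c (blk ms t'))
    && (il (c (blk ms t)) (t - off ms (blk ms t))%N
        == il (c (blk ms t)) (t' - off ms (blk ms t'))%N).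
Proof.
move=> [_ _ Hl] lt_t lt_t'.
rewrite -{1}(subnKC (blk_off_le lt_t)) -{1}(subnKC (blk_off_le lt_t')).
by rewrite Hl ?blk_sub_lt.
Qed.

(** Identifies the wreath group of the finer labelling with the stabilizer of the colouring [c'] in
    the coarser one, the subgroup from which the trace of a split starts. *)
Lemma WrG_refine (ms : seq nat) (c c' f : nat -> nat) il lab lab'
    (w : 'S_(sumn ms)) :
  wreath_labels ms c il lab -> wreath_labels ms c' (fun i => il (f i)) lab' ->
  (forall u, (u < size ms)%N -> c u = f (c' u)) ->
  w \in WrG (sumn ms) ms lab' <->
  w \in WrG (sumn ms) ms lab
  /\ forall t : 'I_(sumn ms), c' (blk ms (w t)) = c' (blk ms t).
Proof.
move=> wl wl' Ef.
have Eb (t : 'I_(sumn ms)) : c (blk ms t) = f (c' (blk ms t)) by rewrite Ef ?blk_lt.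
split=> [/WrGP[Hb Hl]|[/WrGP[Hb Hl] Hc]].
  have lw (t : 'I_(sumn ms)) := introT eqP (Hl t).
  split=> [|t]; last first.
    by have := lw t; rewrite (wreath_lab_eq wl') // => /andP[/eqP].
  apply/WrGP; split=> // t; apply/eqP; have := lw t.
  rewrite (wreath_lab_eq wl') // (wreath_lab_eq wl) // !Eb => /andP[/eqP -> ->].
  by rewrite eqxx.
apply/WrGP; split=> // t; apply/eqP; have := introT eqP (Hl t).
rewrite (wreath_lab_eq wl) // (wreath_lab_eq wl') // !Eb !Hc.
by rewrite !eqxx.
Qed.

Lemma blk_inv_theta (ms : seq nat) n (c : nat -> nat) il lab (pi : 'S_n)
    (loc : forall u : 'I_n, 'S_(nth 0%N ms u)) (u : 'I_n) :
  wreath_labels ms c il lab -> size ms = n -> pi \in Sig n c ->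
  blk ms (pn (theta pi loc)^-1 (off ms u)) = (pi^-1)%g u.
Proof.
move=> wl size_ms piS; have Hpi v := Sig_col_ms wl size_ms v piS.
have [ms_gt0 _ _] := wl.
have lt_u : (off ms u < sumn ms)%N.
  by rewrite -[off _ _]addn0 off_add_lt // ms_gt0 ?size_ms.
set t := pn _ _; have lt_t : (t < sumn ms)%N by exact: pn_lt.
have Et : pn (theta pi loc) t = off ms u by rewrite /t pnKV.
have lt_b := blk_lt lt_t; rewrite size_ms in lt_b.
have [o lt_o E] := blk_coord lt_t.
move: Et; rewrite {1}E (theta_coord size_ms _ (u := Ordinal lt_b)) // => Eo.
have lo : (pn (loc (Ordinal lt_b)) o < nth 0%N ms (pi (Ordinal lt_b)))%N.
  by rewrite Hpi pn_lt.
have : pi (Ordinal lt_b) = u.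
  apply: ord_inj; rewrite -(blk_offE lo) Eo -[off _ _]addn0 blk_offE //.
  by rewrite ms_gt0 ?size_ms.
by move=> <-; rewrite permK.
Qed.

(* Refining the colouring [c] to [c'] with [c = f o c']: the words with the
   content of [c'] are the translates of the word [c'] by the wreath product. *)
Lemma Pcomp_refine (ms : seq nat) n (c c' f : nat -> nat) il lab lab' x
    (xs' : nat -> P) (J : seq nat) :
  wreath_labels ms c il lab -> wreath_labels ms c' (fun i => il (f i)) lab' ->
  size ms = n -> (forall u, (u < n)%N -> c u = f (c' u)) ->
  (forall u, (u < n)%N -> c' u \in J) -> uniq J ->
  admG (Sig n c) x ->
  (forall u i, (u < n)%N -> i \in J -> f i = c u ->
     admG (Sig (nth 0%N ms u) (il (c u))) (xs' i)) ->
  \sum_(l <- choices [seq [seq i <- J | f i == c u] | u <- iota 0 n]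
          | perm_eq l (map c' (iota 0 n))) Pcomp e comp x (map xs' l)
  = Tr (WrG (sumn ms) ms lab') (WrG (sumn ms) ms lab)
       (Pcomp e comp x [seq xs' (c' u) | u <- iota 0 n]).
Proof.
move=> wl wl' size_ms Ef c'J uJ Ax Axs; have [ms_gt0 _ _] := wl.
rewrite -size_ms in Ef; have ref w := WrG_refine w wl wl' Ef; rewrite size_ms in Ef.
set W := WrG_group (sumn ms) ms lab; set W' := WrG_group (sumn ms) ms lab'.
(* The translate by [g] of the word [c'], read off at the first point of each block. *)
pose K (g : 'S_(sumn ms)) := [seq c' (blk ms (pn g^-1 (off ms u))) | u <- iota 0 n].
have off_lt u : (u < n)%N -> (off ms u < sumn ms)%N.
  by move=> lt_u; rewrite -[off _ _]addn0 off_add_lt // ms_gt0 ?size_ms.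
have blk_off u : (u < n)%N -> blk ms (off ms u) = u.
  by move=> lt_u; rewrite -[off _ _]addn0 blk_offE // ms_gt0 ?size_ms.
have Kth (pi : 'S_n) (loc : forall u : 'I_n, 'S_(nth 0%N ms u)) : pi \in Sig n c ->
    K (theta pi loc) = [seq c' ((pi^-1)%g u) | u : 'I_n <- enum 'I_n].
  move=> piS; rewrite /K map_iota_ord; apply: eq_map => u /=.
  by rewrite (blk_inv_theta _ _ wl).
pose fib u := [seq i <- J | f i == c u].
have szfib : size [seq fib u | u <- iota 0 n] = n by rewrite size_map size_iota.
have nthfib u : (u < n)%N -> nth [::] [seq fib u | u <- iota 0 n] u = fib u.
  by move=> lt_u; rewrite (nth_map 0%N) ?size_iota // nth_iota.
rewrite -big_filter.
apply: (@Tr_reindex _ W' W _ _ K (fun l => Pcomp e comp x (map xs' l))).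
- by apply/subsetP=> w /ref[].
- apply/filter_uniq/choices_uniq/allP=> s /mapP[u _ ->]; exact: filter_uniq.
- move=> g h gW hW.
  have blkV g' (v : 'I_(sumn ms)) : g' \in W ->
      blk ms ((g'^-1)%g v) = blk ms (pn g'^-1 (off ms (blk ms v))).
    move=> g'W; have lt_b := blk_lt (ltn_ord v); rewrite size_ms in lt_b.
    have /WrGP[Hb _] := groupVr g'W.
    rewrite -[off _ _]/(val (Ordinal (off_lt _ lt_b))) pnE; apply: Hb.
    by rewrite /= blk_off.
  apply/eqP/idP => [EK|/ref[_ H]].
    apply/ref; split; first by rewrite groupM ?groupV.
    move=> t; have lt_b := blk_lt (ltn_ord (g t)); rewrite size_ms in lt_b.
    have /eq_in_map/(_ (blk ms (g t))) := EK; rewrite mem_iota => /(_ lt_b).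
    by rewrite -!blkV // permK permM => <-.
  apply/eq_in_map=> u; rewrite mem_iota add0n => lt_u.
  have := H ((g^-1)%g (Ordinal (off_lt _ lt_u))).
  rewrite permM permKV -!pnE /= => <-; by [].
- move=> l; rewrite mem_filter; split=> [/andP[pl /(mem_choices 0%N)[szl Hl]]|[g gW <-]].
    rewrite szfib in szl Hl.
    have szl' : size l == n by rewrite szl.
    (* A word with the content of [c'] is [c' o sg]. The letters at [u] lie over [c u], so [sg]
       preserves [c], and [sg^-1] with trivial inner parts is an element of the wreath group
       reaching the word. *)
    have /tuple_permP[sg Esg] : perm_eq (Tuple szl') (map_tuple c' (iota_tuple n 0)) by [].
    have lE (u : 'I_n) : nth 0%N l u = c' (sg u).
      move/val_inj/(congr1 (fun s : n.-tuple nat => tnth s u)): Esg.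
      by rewrite tnth_mktuple tnth_map !(tnth_nth 0%N) /= nth_iota.
    have sgS : (sg^-1)%g \in Sig n c.
      rewrite groupV; apply/SigP=> u; rewrite Ef // -lE.
      by have := Hl u (ltn_ord u); rewrite nthfib // mem_filter => /andP[/eqP ->].
    exists (theta sg^-1 (fun u => 1%g)).
      by apply: (theta_WrG wl) => // u; rewrite group1.
    rewrite Kth // invgK; apply: (@eq_seq_ord _ n 0%N); rewrite ?size_map_ord // => u.
    by rewrite nth_map_ord lE.
  have [pi [loc [piS _ ->]]] := WrG_theta wl size_ms gW; rewrite Kth //.
  have /SigP piV : (pi^-1)%g \in Sig n c by rewrite groupV.
  apply/andP; split; last first.
    apply/(mem_choices 0%N); rewrite szfib size_map_ord; split=> // u lt_u.
    rewrite nthfib // -[u]/(val (Ordinal lt_u)) nth_map_ord mem_filter c'J // andbT.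
    by rewrite -Ef // piV.
  rewrite perm_sym map_iota_ord.
  have -> : [seq c' ((pi^-1)%g u) | u : 'I_n <- enum 'I_n]
            = [seq c' (val u) | u <- [seq (pi^-1)%g u | u : 'I_n <- enum 'I_n]].
    by rewrite -[RHS]map_comp; apply: eq_map.
  apply: perm_map; apply: uniq_perm; first exact: enum_uniq.
    by rewrite map_inj_uniq; [exact: enum_uniq | exact: perm_inj].
  move=> u; rewrite mem_enum; apply/esym/mapP; exists (pi u); rewrite ?mem_enum //.
  by rewrite permK.
move=> g gW; have [pi [loc [piS locS ->]]] := WrG_theta wl size_ms gW; rewrite Kth //.
have Az (u : 'I_n) : admG (Sig (nth 0%N ms u) (il (c u))) (xs' (c' u)).
  by apply: Axs => //; rewrite ?c'J -?Ef.
have nthz (u : 'I_n) : nth 0 [seq xs' (c' u) | u <- iota 0 n] u = xs' (c' u).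
  by rewrite (nth_map 0%N) ?size_iota // nth_iota.
rewrite (Pcomp_theta wl size_ms piS Ax); first last.
- by move=> u; rewrite nthz; case: (Az u) => _; apply; apply: locS.
- by move=> u; rewrite nthz; case: (Az u).
- by rewrite size_map size_iota.
congr Pcomp; rewrite -map_comp /permv; apply: eq_map => u /=.
by rewrite nthz.
Qed.

(** * The diamond partition *)

Lemma nth_flatten_off U (d : U) (ss : seq (seq U)) i j :
  (j < size (nth [::] ss i))%N ->
  nth d (flatten ss) (off (map size ss) i + j) = nth d (nth [::] ss i) j.
Proof.
elim: ss i => [|s ss IH] [|i] //=; rewrite nth_cat.
  by rewrite off0 add0n => ->.
by move=> lt_j; rewrite off_cons -addnA ltnNge leq_addr /= addKn IH.
Qed.

Lemma count_blocks (ms : seq nat) (Q : pred nat) :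
  count Q (iota 0 (sumn ms))
  = (\sum_(u < size ms) count (fun o => Q (off ms u + o)%N) (iota 0 (nth 0%N ms u)))%N.
Proof.
elim: ms Q => [|m ms IH] Q /=; first by rewrite big_ord0.
rewrite iotaD count_cat big_ord_recl /= add0n; congr addn.
have -> : iota m (sumn ms) = map (addn m) (iota 0 (sumn ms)) by rewrite -iotaDl addn0.
rewrite count_map IH; apply: eq_bigr => u _; apply: eq_count => o /=.
by rewrite addnA.
Qed.

Lemma prod_blk p (r : p.-tuple nat) (g : nat -> nat) :
  (\prod_(u < sumn r) g (blk r u) = \prod_(i < p) g i ^ tnth r i)%N.
Proof.
pose pr (u : 'I_(sumn r)) := Ordinal (blk_ltT (ltn_ord u)).
rewrite (partition_big pr xpredT) //=; apply: eq_bigr => i _.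
rewrite (eq_bigr (fun=> g i)); last by move=> u /eqP <-.
rewrite prod_nat_const; congr (_ ^ _)%N.
rewrite -nth_tnth -blk_content count_iota_card; apply: eq_card => u.
by rewrite inE -[RHS](val_eqE (pr u) i).
Qed.

Section Diamond.
Variables (p : nat) (r : p.-tuple nat) (k : 'I_p -> nat).
Variable qs : forall i : 'I_p, (k i).-tuple nat.

Lemma nth_qseq (i : 'I_p) : nth [::] (qseq qs) i = qs i.
Proof. exact: (nth_map_ord [::] (fun i => val (qs i))). Qed.

Lemma nth_ksize (i : 'I_p) : nth 0%N (map size (qseq qs)) i = k i.
Proof.
by rewrite (nth_map [::]) ?size_map_ord // nth_qseq size_tuple.
Qed.

Lemma size_msz : size (msz r qs) = sumn r.
Proof. by rewrite size_map size_iota. Qed.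

Lemma nth_msz (u : nat) : (u < sumn r)%N ->
  nth 0%N (msz r qs) u = sumn (nth [::] (qseq qs) (blk r u)).
Proof.
move=> lt_u; rewrite (nth_map 0%N) ?size_iota // nth_iota // add0n.
rewrite -[blk r u]/(val (Ordinal (blk_ltT lt_u))).
by rewrite nth_qseq (nth_map_ord 0%N (fun i => sumn (qs i))).
Qed.

Lemma dlab_coord u o : (o < nth 0%N (msz r qs) u)%N ->
  dlab r qs (off (msz r qs) u + o)
  = (off (map size (qseq qs)) (blk r u) + blk (nth [::] (qseq qs) (blk r u)) o)%N.
Proof. by move=> lt_o; rewrite /dlab blk_offE // addKn. Qed.

Lemma msz_lt u o : (o < nth 0%N (msz r qs) u)%N -> (u < sumn r)%N.
Proof.
move=> lt_o; rewrite -size_msz ltnNge; apply/negP=> le_u.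
by rewrite nth_default in lt_o.
Qed.

Lemma blk_inner_lt u o : (o < nth 0%N (msz r qs) u)%N ->
  (blk (nth [::] (qseq qs) (blk r u)) o
     < nth 0%N (map size (qseq qs)) (blk r u))%N.
Proof.
move=> lt_o; have lt_u := msz_lt lt_o.
rewrite (nth_map [::]) ?size_map_ord ?blk_ltT //.
by apply: blk_lt; rewrite -nth_msz.
Qed.

(** The colour of an input block is its index [i]. Positivity is asked only where [r_i > 0], since
    the other indices own no block. *)
Lemma wreath_diam :
  (forall i, 0 < tnth r i -> 0 < sumn (qs i))%N ->
  wreath_labels (msz r qs) (blk r) (fun i => blk (nth [::] (qseq qs) i)) (dlab r qs).
Proof.
move=> q_gt0; split.
- move=> u; rewrite size_msz => lt_u; rewrite nth_msz //.
  have lt_b := blk_ltT lt_u; rewrite -[blk r u]/(val (Ordinal lt_b)) nth_qseq.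
  by apply: q_gt0; rewrite -nth_tnth /=; apply: leq_ltn_trans (blk_sub_lt lt_u).
- by move=> u v; rewrite size_msz => lt_u lt_v Ec; rewrite !nth_msz // Ec.
move=> u v o o' lt_o lt_o'; rewrite !dlab_coord //.
apply/eqP/andP => [E|[/eqP <- /eqP ->] //].
have Eb : blk r u = blk r v.
  by rewrite -(blk_offE (blk_inner_lt lt_o)) E (blk_offE (blk_inner_lt lt_o')).
by move: E; rewrite -Eb => /addnI ->; rewrite !eqxx.
Qed.

Lemma size_dseq : size (dseq r qs) = sumn (map size (qseq qs)).
Proof.
rewrite size_flatten /shape -!map_comp; congr sumn.
by apply: eq_map => i /=; rewrite size_map.
Qed.

Lemma dlab_lt t : (t < Mtot r qs)%N -> (dlab r qs t < size (dseq r qs))%N.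
Proof.
move=> lt_t; have [o lt_o ->] := blk_coord lt_t.
rewrite dlab_coord // size_dseq off_add_lt //; exact: blk_inner_lt.
Qed.

Lemma nth_dseq (i : 'I_p) j : (j < k i)%N ->
  nth 0%N (dseq r qs) (off (map size (qseq qs)) i + j) = (tnth r i * nth 0%N (qs i) j)%N.
Proof.
move=> lt_j; pose ss := [seq [seq (tnth r i * c)%N | c <- val (qs i)] | i <- enum 'I_p].
have Ess : map size (qseq qs) = map size ss.
  by rewrite -!map_comp; apply: eq_map => i' /=; rewrite size_map.
have nss : nth [::] ss i = [seq (tnth r i * c)%N | c <- val (qs i)].
  exact: (nth_map_ord [::] (fun i => [seq (tnth r i * c)%N | c <- val (qs i)])).
rewrite Ess (@nth_flatten_off _ 0%N ss) nss ?size_map ?size_tuple //.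
by rewrite (nth_map 0%N) ?size_tuple.
Qed.

(** The label [(i, j)] occurs [q_ij] times in each of the [r_i] blocks of colour [i]. With
    [sort_labels] this yields the permutation sorting the diamond partition. *)
Lemma count_dlab L :
  count (fun t => dlab r qs t == L) (iota 0 (Mtot r qs)) = nth 0%N (dseq r qs) L.
Proof.
have [lt_L|le_L] := ltnP L (size (dseq r qs)); last first.
  rewrite nth_default // count_sum big1 // => t _.
  by case: eqP => // Et; have := dlab_lt (ltn_ord t); rewrite Et ltnNge le_L.
rewrite size_dseq in lt_L; have [j lt_j EL] := blk_coord lt_L.
have lt_i := blk_lt lt_L; rewrite size_map size_map_ord in lt_i.
set i := Ordinal lt_i; rewrite -[blk _ L]/(val i) in EL lt_j.
have lt_j' : (j < k i)%N by rewrite -nth_ksize.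
rewrite EL nth_dseq // /Mtot count_blocks size_msz.
rewrite (eq_bigr (fun u : 'I_(sumn r) => (blk r u == i) * nth 0%N (qs i) j))%N; last first.
  move=> u _; rewrite nth_msz //.
  have lt_b := blk_ltT (ltn_ord u).
  have Ecnt : forall o, o \in iota 0 (sumn (nth [::] (qseq qs) (blk r u))) ->
     (dlab r qs (off (msz r qs) u + o) == (off (map size (qseq qs)) i + j)%N)
     = (blk r u == i) && (blk (qs i) o == j).
    move=> o; rewrite mem_iota add0n => lt_o.
    have lt_o' : (o < nth 0%N (msz r qs) u)%N by rewrite nth_msz.
    rewrite dlab_coord //; apply/eqP/andP => [E|[/eqP -> /eqP <-]]; last by rewrite nth_qseq.
    have Eb : blk r u = i.
      by rewrite -(blk_offE (blk_inner_lt lt_o')) E blk_offE.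
    by move: E; rewrite Eb nth_qseq => /addnI ->; rewrite !eqxx.
  rewrite (eq_in_count Ecnt); case: eqP => [->|_]; last by rewrite count_pred0.
  by rewrite nth_qseq /= blk_content mul1n.
rewrite -big_distrl /=; congr (_ * _)%N.
by rewrite -nth_tnth -blk_content count_sum.
Qed.

Lemma sumn_dseq : sumn (dseq r qs) = Mtot r qs.
Proof.
rewrite -(off_size (leqnn (size (dseq r qs)))) offE.
under eq_bigr do rewrite -count_dlab count_sum.
rewrite exchange_big /= -[RHS]card_ord -sum1_card; apply: eq_bigr => t _.
rewrite (bigD1 (Ordinal (dlab_lt (ltn_ord t)))) //= eqxx big1 // => L.
by rewrite eq_sym -val_eqE /= => /negbTE ->.
Qed.

Lemma nth_dargs (A : zmodType) (b : forall i : 'I_p, (k i).-tuple A) (i : 'I_p) j :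
  (j < k i)%N ->
  nth 0 (dargs r qs b) (off (map size (qseq qs)) i + j) = nth 0 (b i) j.
Proof.
move=> lt_j; pose ss := [seq val (b i) | i <- enum 'I_p].
have Ess : map size (qseq qs) = map size ss.
  by rewrite -!map_comp; apply: eq_map => i' /=; rewrite !size_tuple.
have nss : nth [::] ss i = b i by exact: (nth_map_ord [::] (fun i => val (b i))).
have lt_L : (off (map size (qseq qs)) i + j < size (dseq r qs))%N.
  by rewrite size_dseq off_add_lt // nth_ksize.
rewrite -[(_ + _)%N]/(val (Ordinal lt_L)) -tnth_nth tnth_mktuple /=.
by rewrite Ess (@nth_flatten_off _ 0 ss) nss ?size_tuple.
Qed.

Lemma exists_dsort N : N = Mtot r qs ->
  exists tau : 'S_N, forall t : 'I_N, blk (dcomp r qs) (tau t) = dlab r qs t.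
Proof.
move=> ->; apply: sort_labels; first by rewrite sumn_dseq.
exact: count_dlab.
Qed.

End Diamond.

Hypothesis red : reduced ar.

Lemma Tr_diamond_Osum p (r : p.-tuple nat) (k : 'I_p -> nat)
    (qs : forall i : 'I_p, (k i).-tuple nat) (b0 : T) (xs : 'I_p -> T) :
  ar b0 = sumn r -> (forall i, ar (xs i) = sumn (qs i)) ->
  let X := comp b0 [seq nth e [seq xs i | i <- enum 'I_p] (blk r j) | j <- iota 0 (sumn r)] in
  Tr (Wr r qs) (Sdiam r qs)
     (Pcomp e comp (Osum act F (Sig (sumn r) (blk r)) b0)
        [seq nth 0 [seq Osum act F (Sig (sumn (qs i)) (blk (qs i))) (xs i) | i <- enum 'I_p]
                (blk r j) | j <- iota 0 (sumn r)])
  = (#|stab act (Sdiam r qs) X|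
       %/ (#|stab act (Sig (sumn r) (blk r)) b0|
           * \prod_(i < p) #|stab act (Sig (sumn (qs i)) (blk (qs i))) (xs i)|
                             ^ (tnth r i)))%N%:R
    *: Osum act F (Sdiam r qs) X
  /\ ar X = Mtot r qs.
Proof.
move=> arb0 arx X; rewrite {}/X.
set ys := [seq nth e [seq xs i | i <- enum 'I_p] (blk r j) | j <- iota 0 (sumn r)].
have q_gt0 i : (0 < sumn (qs i))%N by rewrite -arx lt0n; apply/eqP/red.
have szy : size ys = sumn r by rewrite size_map size_iota.
have nthy u (lt_u : (u < sumn r)%N) : nth e ys u = xs (Ordinal (blk_ltT lt_u)).
  rewrite (nth_map 0%N) ?size_iota // nth_iota // add0n.
  by rewrite -[blk r u]/(val (Ordinal (blk_ltT lt_u))) nth_map_ord.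
have Ey : map ar ys = msz r qs.
  apply: (@eq_seq_ord _ (sumn r) 0%N); rewrite ?size_map ?size_iota // => u.
  rewrite (nth_map e) ?szy // nth_msz // (nthy u (ltn_ord u)) arx.
  by rewrite -[blk r u]/(val (Ordinal (blk_ltT (ltn_ord u)))) nth_qseq.
have wl := wreath_diam (r := r) (fun i _ => q_gt0 i).
split; last by rewrite ar_comp ?Ey // arb0 szy.
have coly (u v : 'I_(sumn r)) : blk r u = blk r v -> nth e ys u = nth e ys v.
  move=> Ec; rewrite (nthy u (ltn_ord u)) (nthy v (ltn_ord v)).
  by congr xs; apply: val_inj.
rewrite -Ey in wl; have := Tr_Pcomp_Osum wl szy arb0 coly.
rewrite Ey => K1.
have ES : [seq Osum act F (Sig (nth 0%N (msz r qs) u) (blk (nth [::] (qseq qs) (blk r u))))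
                (nth e ys u) | u <- iota 0 (sumn r)]
  = [seq nth 0 [seq Osum act F (Sig (sumn (qs i)) (blk (qs i))) (xs i) | i <- enum 'I_p]
                (blk r j) | j <- iota 0 (sumn r)].
  apply/eq_in_map=> u; rewrite mem_iota add0n => lt_u.
  rewrite nth_msz // (nthy u lt_u) -[blk r u]/(val (Ordinal (blk_ltT lt_u))).
  by rewrite nth_qseq nth_map_ord.
rewrite ES in K1; apply: etrans K1 _; congr ((_ %/ (_ * _))%N%:R *: _).
(* Stabilizer orders as a function on [nat], so that [prod_blk] can regroup the product over blocks
   by colour and produce the exponents [r_i]. *)
pose g i := if insub i is Some j
  then #|stab act (Sig (sumn (qs j)) (blk (qs j))) (xs j)| else 0%N.
have gE (i : 'I_p) : g i = #|stab act (Sig (sumn (qs i)) (blk (qs i))) (xs i)|.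
  by rewrite /g valK.
rewrite -(eq_bigr _ (fun i _ => congr1 (fun m => (m ^ tnth r i)%N) (gE i))) -prod_blk.
apply: eq_bigr => u _; rewrite nth_msz // (nthy u (ltn_ord u)).
rewrite -[blk r u]/(val (Ordinal (blk_ltT (ltn_ord u)))).
by rewrite nth_qseq gE.
Qed.

(** * Changing the index set of a diamond partition *)

Section Merge.
Variables (p p' : nat) (r : p.-tuple nat) (r' : p'.-tuple nat).
Variables (k : 'I_p -> nat) (qs : forall i : 'I_p, (k i).-tuple nat).
Variables (f : 'I_p' -> 'I_p) (fn : nat -> nat).
Hypothesis fE : forall i : 'I_p', fn i = f i.
Hypothesis sum_r' : sumn r' = sumn r.
Hypothesis blk_f : forall u, (u < sumn r)%N -> blk r u = fn (blk r' u).
Let qs' := fun i => qs (f i).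

Lemma merge_qseq (i : 'I_p') : nth [::] (qseq qs') i = nth [::] (qseq qs) (fn i).
Proof. by rewrite fE !nth_qseq. Qed.

Lemma merge_msz : msz r' qs' = msz r qs.
Proof.
apply: (@eq_seq_ord _ (sumn r) 0%N); rewrite ?size_msz // => u.
have lt_u : (u < sumn r')%N by rewrite sum_r'.
rewrite !nth_msz // blk_f //.
by rewrite -[blk r' u]/(val (Ordinal (blk_ltT lt_u))) merge_qseq.
Qed.

Lemma wreath_merge :
  (forall i, 0 < tnth r' i -> 0 < sumn (qs (f i)))%N ->
  wreath_labels (msz r qs) (blk r') (fun i => blk (nth [::] (qseq qs) (fn i)))
    (dlab r' qs').
Proof.
move=> q_gt0; have [H1 H2 H3] := @wreath_diam _ r' _ qs' q_gt0.
rewrite merge_msz in H1 H2 H3; split=> // u v o o' lt_o lt_o'; rewrite H3 //.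
have lt_u : (u < sumn r')%N by rewrite sum_r'; apply: msz_lt lt_o.
by rewrite -[blk r' u]/(val (Ordinal (blk_ltT lt_u))) merge_qseq.
Qed.

(** The map [(i, j) |-> (f i, j)] in the encoding of label pairs as numbers. *)
Let fh L := (off (map size (qseq qs)) (fn (blk (map size (qseq qs')) L))
             + (L - off (map size (qseq qs')) (blk (map size (qseq qs')) L)))%N.

Lemma fhE (i : 'I_p') j : (j < k (f i))%N ->
  fh (off (map size (qseq qs')) i + j) = (off (map size (qseq qs)) (f i) + j)%N.
Proof.
by move=> lt_j; rewrite /fh blk_offE ?fE ?addKn // (nth_ksize qs').
Qed.

Lemma merge_dlab t : (t < Mtot r qs)%N -> dlab r qs t = fh (dlab r' qs' t).
Proof.
move=> lt_t; have [o lt_o ->] := blk_coord lt_t.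
rewrite dlab_coord // -merge_msz dlab_coord ?merge_msz //.
set u := blk (msz r qs) t; rewrite -/u in lt_o.
have lt_u : (u < sumn r)%N by exact: (msz_lt lt_o).
have lt_u' : (u < sumn r')%N by rewrite sum_r'.
rewrite blk_f //; have Eb : blk r' u = val (Ordinal (blk_ltT lt_u')) by [].
rewrite Eb fhE; first by rewrite merge_qseq fE.
rewrite -(nth_ksize qs') -Eb; apply: (@blk_inner_lt _ r' _ qs' u).
by rewrite merge_msz.
Qed.

Lemma merge_coord L : (L < size (dseq r' qs'))%N ->
  exists (i : 'I_p') j, (j < k (f i))%N /\ L = (off (map size (qseq qs')) i + j)%N.
Proof.
rewrite size_dseq => lt_L; have [j lt_j EL] := blk_coord lt_L.
have lt_i := blk_lt lt_L; rewrite size_map size_map_ord in lt_i.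
exists (Ordinal lt_i), j; split=> //.
by rewrite -[blk _ L]/(val (Ordinal lt_i)) (nth_ksize qs') in lt_j.
Qed.

(** Arguments at indices with the same image under [f] agree, so [beta_relabel] merges them along
    [fh], and transitivity lengthens the trace accordingly. Used both when [f] forgets a duplication
    and when it is the inclusion omitting an index of multiplicity 0. *)
Lemma beta_merge (A : lmodType F) (be : betaOps T A) N
    (b : forall i : 'I_p, (k i).-tuple A) (tau tau' : 'S_N) Z :
  is_beta ar act be ->
  N = Mtot r qs ->
  (forall t : 'I_N, blk (dcomp r qs) (tau t) = dlab r qs t) ->
  (forall t : 'I_N, blk (dcomp r' qs') (tau' t) = dlab r' qs' t) ->
  admG (WrG N (msz r qs) (dlab r' qs')) Z ->
  be _ (dcomp r' qs')
     (pact act tau' (Tr (WrG N (msz r qs) (dlab r' qs')) (Sig N (dlab r' qs')) Z))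
     (dargs r' qs' (fun i => b (f i)))
  = be _ (dcomp r qs)
     (pact act tau (Tr (WrG N (msz r qs) (dlab r' qs')) (Sig N (dlab r qs)) Z))
     (dargs r qs b).
Proof.
move=> beP EN Htau Htau' AZ.
have EN' : N = Mtot r' qs' by rewrite /Mtot merge_msz.
have AT : admG (Sig N (dlab r' qs'))
    (Tr (WrG N (msz r qs) (dlab r' qs')) (Sig N (dlab r' qs')) Z).
  apply: (@Tr_adm _ (WrG_group _ _ _) (Sig_group _ _)) => //; exact: WrG_Sig.
rewrite (beta_relabel beP (lab := dlab r' qs') (f := fh) (d' := dcomp r qs)
   (tau' := tau) (a := dargs r qs b)) //.
- have ESig : Sig N (fun t => fh (dlab r' qs' t)) = Sig N (dlab r qs).
    by apply: eq_Sig => t t'; rewrite !merge_dlab // -EN.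
  rewrite ESig (@Tr_tower _ (WrG_group _ _ _) (Sig_group _ _) (Sig_group _ _)) //.
    exact: WrG_Sig.
  by apply: sub_Sig => t t' E; rewrite !merge_dlab -?EN // E.
- by rewrite sumn_dseq.
- by rewrite sumn_dseq.
- by move=> t; rewrite Htau merge_dlab // -EN.
- move=> L /merge_coord[i [j [lt_j ->]]]; rewrite fhE //.
  by rewrite size_dseq off_add_lt // nth_ksize.
move=> L /merge_coord[i [j [lt_j ->]]]; rewrite fhE //.
rewrite [RHS]nth_dargs //; exact: (@nth_dargs _ r' _ qs' A (fun i => b (f i)) i j lt_j).
Qed.

End Merge.

Lemma admG_Pcomp ms n (c : nat -> nat) il lab x (z : nat -> P) :
  wreath_labels ms c il lab -> size ms = n -> admG (Sig n c) x ->
  (forall u, (u < n)%N -> admG (Sig (nth 0%N ms u) (il (c u))) (z (c u))) ->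
  admG (WrG (sumn ms) ms lab) (Pcomp e comp x [seq z (c u) | u <- iota 0 n]).
Proof.
move=> wl size_ms Ax Az; have [Px _] := Ax.
have nthz u : (u < n)%N -> nth 0 [seq z (c u) | u <- iota 0 n] u = z (c u).
  by move=> lt_u; rewrite (nth_map 0%N) ?size_iota // nth_iota.
have szz : size [seq z (c u) | u <- iota 0 n] = n by rewrite size_map size_iota.
split.
  apply: (@inP_Pcomp _ ms) => //; rewrite ?size_ms // => u lt_u.
  by rewrite nthz //; case: (Az u lt_u).
move=> g /(WrG_theta wl size_ms)[pi [loc [piS locS ->]]].
rewrite (Pcomp_theta wl size_ms piS Ax) //; first last.
- by move=> u; rewrite nthz //; case: (Az u) => // _; apply; apply: locS.
- by move=> u; rewrite nthz //; case: (Az u).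
congr Pcomp; apply: (@eq_seq_ord _ n 0); rewrite ?size_permv // => u.
have /SigP piV : (pi^-1)%g \in Sig n c by rewrite groupV.
by rewrite nth_permv !nthz // piV.
Qed.

Lemma PcompP a x y Zs :
  Pcomp e comp (a *: x + y) Zs = a *: Pcomp e comp x Zs + Pcomp e comp y Zs.
Proof. by rewrite !Pcomp_ML linP. Qed.

Lemma Pcomp0 Zs : Pcomp e comp (0 : P) Zs = 0.
Proof. by rewrite Pcomp_ML lin0. Qed.

Lemma Pcomp_zero x Zs u :
  (u < size Zs)%N -> nth 0 Zs u = 0 -> Pcomp e comp x Zs = 0.
Proof.
move=> lt_u Zu0; rewrite Pcomp_ML /lin big1 // => b _.
rewrite /ML big1 ?scaler0 // => cs _.
by rewrite (bigD1 (Ordinal lt_u)) //= Zu0 mcoeff0 mul0r scale0r.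
Qed.

(** * Splitting one inner operation into a linear combination *)

Section Split.
Variables (p : nat) (r : p.+1.-tuple nat) (i0 : 'I_p.+1).
Local Notation j1 := (lift ord0 i0 : 'I_p.+2).

(** [unbump i0] between ordinals: [unlift] is undefined exactly at the second copy [i0 + 1], where
    the default [i0] is the intended value. *)
Definition fspl (j : 'I_p.+2) : 'I_p.+1 := odflt i0 (unlift j1 j).

Lemma fsplE (j : 'I_p.+2) : unbump i0 j = fspl j.
Proof.
rewrite /fspl; case: unliftP => [k ->|->] /=; first exact: unbump_lift.
exact: unbump_lift_self.
Qed.

(** Letters other than [i0] and [i0 + 1] are counted through their images, and the number of letters
    [i0 + 1] is the number of letters over [i0] minus that of [i0]. *)
Lemma words_perm (l l' : seq nat) :
  map (unbump i0) l = map (unbump i0) l' ->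
  count_mem (i0 : nat) l = count_mem (i0 : nat) l' -> perm_eq l l'.
Proof.
move=> Em E0.
have cntU i s : count (fun j => unbump i0 j == i) s = count_mem i (map (unbump i0) s).
  by rewrite count_map.
have E1 s : (count_mem (i0 : nat) s + count_mem i0.+1 s
             = count_mem (i0 : nat) (map (unbump i0) s))%N.
  rewrite -cntU; elim: s => //= a s <-; rewrite /unbump.
  by case: (ltngtP a i0); case: (ltngtP a i0.+1); lia.
apply/allP=> i _ /=; apply/eqP.
have [->|ne0] := eqVneq i (i0 : nat); first exact: E0.
have [->|ne1] := eqVneq i i0.+1.
  by apply/eqP; rewrite -(eqn_add2l (count_mem (i0 : nat) l)) E1 Em -E1 E0.
have Ei s : count_mem i s = count_mem (unbump i0 i) (map (unbump i0) s).
  rewrite -cntU; apply: eq_count => j /=; rewrite /unbump.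
  by move: ne0 ne1; lia.
by rewrite Ei Em -Ei.
Qed.

Variables (k : 'I_p.+1 -> nat) (qs : forall i : 'I_p.+1, (k i).-tuple nat).
Variables (x : P) (xs : 'I_p.+1 -> P) (a : F) (z0 z1 : P).
Hypothesis xs0 : xs i0 = a *: z0 + z1.
Hypothesis Ax : adm ar act r x.
Hypothesis Axs : forall i, adm ar act (qs i) (xs i).
Hypothesis Az0 : adm ar act (qs i0) z0.
Hypothesis Az1 : adm ar act (qs i0) z1.
Hypothesis q_gt0 : forall i, (0 < sumn (qs i))%N.

Definition xsspl (j : 'I_p.+2) : P := tnth (spl [tuple xs i | i < p.+1] i0 z0 z1) j.
Let rl l := spl r i0 l (tnth r i0 - l)%N.
Let qs' := fun j => qs (fspl j).

Lemma adm_xsspl j : adm ar act (qs' j) (xsspl j).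
Proof.
rewrite /xsspl tnth_mktuple /qs' /fspl; case: (unlift _ _) => [i|] //=.
by case: eqP => [-> //|_]; rewrite tnth_mktuple.
Qed.

Lemma xsspl_adm u i : (u < sumn r)%N -> i \in iota 0 p.+2 -> unbump i0 i = blk r u ->
  admG (Sig (nth 0%N (msz r qs) u) (blk (nth [::] (qseq qs) (blk r u))))
    (nth 0 [seq xsspl j | j <- enum 'I_p.+2] i).
Proof.
rewrite mem_iota add0n => lt_u lt_i E; rewrite nth_msz // -E.
rewrite -[i]/(val (Ordinal lt_i)) nth_map_ord fsplE nth_qseq.
exact: adm_xsspl.
Qed.

Lemma xsspl_sum (i : 'I_p.+1) :
  \sum_(j <- [seq j <- iota 0 p.+2 | unbump i0 j == i])
     (if j == (i0 : nat) then a else 1) *: nth 0 [seq xsspl j | j <- enum 'I_p.+2] j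
  = xs i.
Proof.
rewrite big_filter -[iota 0 p.+2]/(index_iota 0 p.+2) big_mkord.
under eq_bigr do rewrite nth_map_ord.
rewrite big_mkcond (bigD1_ord j1) //.
have Es (j : 'I_p.+1) : (nat_of_ord (lift j1 j) == i0) = (j == i0).
  by rewrite -val_eqE /= /bump; lia.
rewrite (eq_bigr (fun j : 'I_p.+1 => if j == i then
   (if j == i0 then a else 1) *: (if j == i0 then z0 else xs j) else 0)); last first.
  move=> j _; rewrite (unbump_lift i0 j) Es /xsspl tnth_mktuple liftK tnth_mktuple.
  by rewrite val_eqE.
rewrite (unbump_lift_self i0) /xsspl tnth_mktuple unlift_none.
rewrite -big_mkcond /= big_pred1_eq.
rewrite (_ : (bump 0 i0 == i0) = false) ?scale1r; last by rewrite /bump; lia.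
rewrite -[(nat_of_ord i0) == i]/(i0 == i) eq_sym.
by case: eqP => [->|_]; rewrite ?xs0 ?scale1r ?add0r // addrC.
Qed.

Lemma prod_word (l : seq nat) :
  \prod_(j <- l) (if j == (i0 : nat) then a else 1) = a ^+ count_mem (i0 : nat) l.
Proof.
elim: l => [|j l IH]; first by rewrite big_nil.
by rewrite big_cons IH /=; case: eqP => _; rewrite ?exprS ?mul1r.
Qed.

Lemma blk_rl l u : (l <= tnth r i0)%N -> (u < sumn r)%N ->
  blk r u = unbump i0 (blk (rl l) u).
Proof. exact: blk_spl. Qed.

Lemma sumn_rl l : (l <= tnth r i0)%N -> sumn (rl l) = sumn r.
Proof. exact: sumn_spl. Qed.

Lemma wreath_rl l : (l <= tnth r i0)%N ->
  wreath_labels (msz r qs) (blk (rl l))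
    (fun i => blk (nth [::] (qseq qs) (unbump i0 i))) (dlab (rl l) qs').
Proof.
move=> le_l; apply: (wreath_merge fsplE (sumn_rl le_l)) => // u lt_u.
exact: blk_rl.
Qed.

(** Expanding every sum gives words in the duplicated indices, each weighted by [a] to its number of
    letters [i0]. Words with equal numbers form one orbit of the wreath group, which [Pcomp_refine]
    turns into a trace. *)
Lemma Pcomp_split :
  Pcomp e comp x
    [seq nth 0 [seq xs i | i <- enum 'I_p.+1] (blk r u) | u <- iota 0 (sumn r)]
  = \sum_(l < (tnth r i0).+1) a ^+ l *:
      Tr (WrG (Mtot r qs) (msz r qs) (dlab (rl l) qs'))
         (WrG (Mtot r qs) (msz r qs) (dlab r qs))
         (Pcomp e comp x [seq nth 0 [seq xsspl j | j <- enum 'I_p.+2] (blk (rl l) u)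
                             | u <- iota 0 (sumn r)]).
Proof.
pose zf (j : nat) := nth 0 [seq xsspl j | j <- enum 'I_p.+2] j.
pose co (j : nat) : F := if j == (i0 : nat) then a else 1.
pose J (u : nat) := [seq j <- iota 0 p.+2 | unbump i0 j == blk r u].
have -> : [seq nth 0 [seq xs i | i <- enum 'I_p.+1] (blk r u) | u <- iota 0 (sumn r)]
          = [seq \sum_(j <- J u) co j *: zf j | u <- iota 0 (sumn r)].
  apply/eq_in_map=> u; rewrite mem_iota add0n => lt_u.
  rewrite /J -[blk r u]/(val (Ordinal (blk_ltT lt_u))) nth_map_ord.
  exact/esym/xsspl_sum.
have -> : Pcomp e comp x [seq \sum_(j <- J u) co j *: zf j | u <- iota 0 (sumn r)]
    = \sum_(l <- choices (map J (iota 0 (sumn r))))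
         a ^+ count_mem (i0 : nat) l *: Pcomp e comp x (map zf l).
  rewrite Pcomp_ML (eq_lin (h' := fun b => \sum_(l <- choices (map J (iota 0 (sumn r))))
     (\prod_(i <- l) co i) *: ML (map zf l) (fun cs => << comp b cs >> : P))); last first.
    by move=> b _; rewrite ML_sum.
  rewrite lin_exchange; apply: eq_bigr => l _.
  by rewrite linZr -Pcomp_ML prod_word.
set CH := choices _.
have memJ l : l \in CH -> map (unbump i0) l = map (blk r) (iota 0 (sumn r)).
  move=> /(mem_choices 0%N)[]; rewrite size_map size_iota => szl Hl.
  apply: (@eq_seq_ord _ (sumn r) 0%N); rewrite ?size_map ?size_iota // => u.
  rewrite !(nth_map 0%N) ?size_iota ?szl // nth_iota // add0n.
  have := Hl u (ltn_ord u); rewrite (nth_map 0%N) ?size_iota // nth_iota // add0n.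
  by rewrite mem_filter => /andP[/eqP].
have cnt_le l : l \in CH -> (count_mem (i0 : nat) l <= tnth r i0)%N.
  move=> /memJ El; rewrite -nth_tnth -blk_content.
  have -> : count (fun t => blk r t == i0) (iota 0 (sumn r))
            = count_mem (i0 : nat) (map (blk r) (iota 0 (sumn r))).
    by rewrite count_map.
  rewrite -El count_map; apply: sub_count => j /= /eqP ->.
  by rewrite /unbump ltnn subn0.
(* Words are grouped by their number of letters [i0]; [cnt_le] ensures that [inord] does not alter
   it. *)
rewrite big_seq (partition_big
  (fun l => inord (count_mem (i0 : nat) l) : 'I_(tnth r i0).+1) xpredT) //=.
apply: eq_bigr => l _; have le_l : (l <= tnth r i0)%N by rewrite -ltnS.
have wl := wreath_diam (r := r) (fun i _ => q_gt0 i).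
have lt_rl u : (u < sumn r)%N -> (blk (rl l) u < p.+2)%N.
  by move=> lt_u; apply: blk_ltT; rewrite sumn_rl.
have mem_rl : map (blk (rl l)) (iota 0 (sumn r)) \in CH.
  apply/(mem_choices 0%N); rewrite !size_map; split=> // u.
  rewrite size_iota => lt_u; rewrite !(nth_map 0%N) ?size_iota // nth_iota // add0n.
  by rewrite mem_filter -blk_rl // eqxx mem_iota add0n lt_rl.
have cnt_rl : count_mem (i0 : nat) (map (blk (rl l)) (iota 0 (sumn r))) = l.
  rewrite count_map -(sumn_rl le_l) [LHS](blk_content (rl l) i0).
  have Ei0 : (i0 : nat) = lift j1 i0 by rewrite /= /bump; lia.
  by rewrite Ei0 nth_tnth tnth_mktuple liftK eqxx.
(* The word [blk (rl l)] has exactly [l] letters [i0], so by [words_perm] the group of [l] consists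
   of its rearrangements in [CH]. *)
transitivity (\sum_(w <- CH | perm_eq w (map (blk (rl l)) (iota 0 (sumn r))))
                 a ^+ l *: Pcomp e comp x (map zf w)).
  rewrite [RHS]big_seq_cond; apply: eq_big => [w|w /andP[w_in /eqP <-]]; last first.
    by rewrite inordK // ltnS cnt_le.
  have [w_in|//] := boolP (w \in CH); rewrite !andTb.
  have -> : (inord (count_mem (i0 : nat) w) == l) = (count_mem (i0 : nat) w == l).
    by rewrite -val_eqE /= inordK // ltnS cnt_le.
  apply/eqP/idP => [Ew|pw]; last by rewrite (seq.permP pw) cnt_rl.
  by apply: words_perm; rewrite ?cnt_rl // (memJ _ w_in) (memJ _ mem_rl).
rewrite -scaler_sumr; congr (_ *: _).
apply: (Pcomp_refine (f := unbump i0) (J := iota 0 p.+2) wl (wreath_rl le_l)) => //.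
- exact: size_msz.
- by move=> u lt_u; apply: blk_rl.
- by move=> u lt_u; rewrite mem_iota add0n lt_rl.
- exact: iota_uniq.
exact: xsspl_adm.
Qed.

Lemma admG_Pcomp_rl l : (l <= tnth r i0)%N ->
  admG (WrG (Mtot r qs) (msz r qs) (dlab (rl l) qs'))
    (Pcomp e comp x [seq nth 0 [seq xsspl j | j <- enum 'I_p.+2] (blk (rl l) u)
                       | u <- iota 0 (sumn r)]).
Proof.
move=> le_l.
apply: (admG_Pcomp (z := fun j => nth 0 [seq xsspl j | j <- enum 'I_p.+2] j) (wreath_rl le_l)).
- exact: size_msz.
- by apply: admG_sub Ax; apply: sub_Sig => t t' E; rewrite !(blk_rl le_l) // E.
move=> u lt_u; rewrite -blk_rl //; apply: xsspl_adm => //; last by rewrite -blk_rl.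
by rewrite mem_iota add0n; apply: blk_ltT; rewrite sumn_rl.
Qed.

End Split.

(** * The two functors *)

Lemma blk_cons0 (r : seq nat) t : blk (0%N :: r) t = (blk r t).+1.
Proof. by rewrite blk_cons ltn0 subn0. Qed.

Lemma Sig_cons0 N (r : seq nat) : Sig N (blk (0%N :: r)) = Sig N (blk r).
Proof. by apply: eq_Sig => t t'; rewrite !blk_cons0 eqSS. Qed.

Lemma Sig_qr N s p (q : s.-tuple nat) (r : p.-tuple nat) :
  N = sumn r -> sumn q = p -> Sig N (blk r) \subset Sig N (blk (qr q r)).
Proof. by move=> -> sq; apply: sub_Sig => t t' E; rewrite !blk_qr // E. Qed.

Lemma pact_Osum_lab N (lab lab' : nat -> nat) (s : 'S_N) b :
  (forall t t' : 'I_N, (lab' (s t) == lab' (s t')) = (lab t == lab t')) ->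
  ar b = N -> pact act s (Osum act F (Sig N lab) b) = Osum act F (Sig N lab') (act s b).
Proof. by move=> /Sig_conj -> arb; rewrite pact_Osum. Qed.

Lemma pact_Osum_bperm p (r : p.-tuple nat) (rho : 'S_p) b :
  ar b = sumn r ->
  pact act (bperm rho r) (Osum act F (Sig (sumn r) (blk r)) b)
  = Osum act F (Sig (sumn r) (blk (rtw rho r))) (act (bperm rho r) b).
Proof.
move=> arb; apply: pact_Osum_lab => // t t'.
by rewrite -!pnE !blk_bperm // (inj_eq (@pn_inj _ rho)).
Qed.

Lemma bump_inj h : injective (bump h). Proof. exact: can_inj (bumpK h). Qed.

Lemma ar_e : ar e = 1%N. Proof. by case: op => [[]]. Qed.

Lemma Osum_unit :
  Osum act F (Sig (sumn [tuple 1%N]) (blk [tuple 1%N])) e = << e >>.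
Proof.
apply/malgP=> b; rewrite mcoeff_Osum mcoeffU; congr (1 *+ nat_of_bool _).
apply/orbitP/eqP => [[s _ ->]|<-]; last by exists 1%g; rewrite ?group1 ?act1 ?ar_e.
suff -> : s = 1%g by rewrite act1 ?ar_e.
apply: eq_pn => i lt_i; have := pn_lt s lt_i; rewrite pn1.
by move: (pn s i) lt_i => v /=; lia.
Qed.

Lemma head_subclass_ar N (H G : {group 'S_N}) b C :
  ar b = N -> C \in subclasses act H G b -> ar (head b (enum_fset C)) = N.
Proof.
move=> arb; rewrite mem_undup => /mapP[d d_in ->].
have ard := orbit_ar arb d_in.
exact: (orbit_ar ard (crep_orbit H b ard)).
Qed.

(** * From beta structures to gamma structures *)

Section FromBeta.
Variables (A : lmodType F) (be : betaOps T A).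
Hypothesis beP : is_beta' ar act e comp be.

Let beta := let: And3 H _ _ := beP in H.

Lemma adm_Osum N p (r : p.-tuple nat) b :
  N = sumn r -> ar b = N -> adm ar act r (Osum act F (Sig N (blk r)) b).
Proof. by move=> -> arb; apply: (@admG_Osum _ (Sig_group _ _)). Qed.

Lemma be_scale p (r : p.-tuple nat) (a : p.-tuple A) (c : F) x :
  adm ar act r x -> be r (c *: x) a = c *: be r x a.
Proof.
move=> Ax.
have := @be_sum A be beta p r a unit [:: tt] xpredT (fun=> c) (fun=> x) (fun _ _ => Ax).
by rewrite !big_seq1.
Qed.

(** Lets the orbit sum be taken in any ['S_N] with [N = sumn r], as needed when [r] is permuted,
    merged or split. *)
Lemma PfunE N p (r : p.-tuple nat) b a :
  N = sumn r -> Pfun act be r b a = be r (Osum act F (Sig N (blk r)) b) a.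
Proof. by move->. Qed.

Lemma is_gamma_Pfun : is_gamma ar act (Pfun act be).
Proof.
case: beta => b1 b2 b3 b4 [b5 _]; split.
- move=> p r b s a arb sS; rewrite /Pfun; congr (be _ _ _).
  by apply: (@Osum_orbit _ (Sig_group _ _)) => //; apply/orbitP; exists s.
- move=> p r b rho a arb; rewrite [RHS](@PfunE (sumn r)) ?sumn_rtw //.
  rewrite -pact_Osum_bperm //; apply: b1; exact: adm_Osum.
- move=> p r b a0 a arb; rewrite (@PfunE (sumn r) _ [tuple of 0%N :: r]) // Sig_cons0.
  by apply: b2; apply: adm_Osum.
- by move=> p r b c a0 a arb; apply: b3; apply: adm_Osum.
split.
  move=> s p q r b a sq arb; rewrite [in RHS](@PfunE (sumn r)) ?sumn_qr //.
  rewrite -be_scale; last by apply: adm_Osum; rewrite ?sumn_qr.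
  rewrite -(@Tr_Osum _ (Sig_group _ _) (Sig_group _ _)) ?Sig_qr //.
  by apply: b4 => //; apply: adm_Osum.
move=> p r b a0 a1 a arb; rewrite {1}/Pfun b5; last exact: adm_Osum.
apply: eq_bigr => l _; have le_l : (l <= thead r)%N by rewrite -ltnS.
set d := split1 r l _; have sum_d : sumn r = sumn d by rewrite sumn_split1.
rewrite (@Osum_subclasses _ (Sig_group _ (blk d)) (Sig_group _ (blk r))) //; last exact: Sig_split1.
rewrite big_seq [RHS]big_seq.
rewrite (eq_bigr (fun C : {fset T} =>
   1 *: Osum act F (Sig (sumn r) (blk d)) (head b (enum_fset C)))); last first.
  by move=> C _; rewrite scale1r.
rewrite (be_sum beta) => [|C C_in]; last first.
  by apply: adm_Osum => //; apply: head_subclass_ar C_in.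
by apply: eq_bigr => C _; rewrite scale1r (@PfunE (sumn r) _ d).
Qed.

Lemma is_gamma'_Pfun : is_gamma' ar act e comp (Pfun act be).
Proof.
split; first exact: is_gamma_Pfun.
  by move=> a; rewrite /Pfun Osum_unit; case: beP.
move=> p r b k qs xs bs arb arxs xl X tau Htau.
have [K1 arX] := Tr_diamond_Osum arb arxs.
case: beP => _ _ /(_ p r (Osum act F (Sig (sumn r) (blk r)) b) k qs
  (fun i => Osum act F (Sig (sumn (qs i)) (blk (qs i))) (xs i)) bs).
move/(_ (adm_Osum erefl arb) (fun i => adm_Osum erefl (arxs i)) tau Htau).
rewrite /= -/(Tr _ _ _) K1 => E; rewrite {1}/Pfun; apply: etrans E _.
have sum_d := sumn_dseq r qs.
rewrite pactZ /Sdiam (pact_Osum_lab (lab' := blk (dcomp r qs))) //; last first.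
  by move=> t t'; rewrite !Htau.
rewrite be_scale; first by rewrite (@PfunE (Mtot r qs)).
by apply: adm_Osum; rewrite ?sum_d //; apply: ar_act.
Qed.

End FromBeta.

(** * The inverse construction and axiom (7b) *)

Section FromGamma.
Variables (A : lmodType F) (ga : gammaOps T A).
Hypothesis gaP : is_gamma' ar act e comp ga.

(** Each orbit in the support of an invariant is counted once, at the element that is its own
    representative. The formula is linear on all of [{malg F[T]}], so linearity needs no
    admissibility side conditions. *)
Definition beta_of : betaOps T A := fun p r x a =>
  lin x (fun b => if b == crep (Sig (sumn r) (blk r)) b then ga r b a else 0).

Lemma beta_ofP p (r : p.-tuple nat) c x y a :
  beta_of r (c *: x + y) a = c *: beta_of r x a + beta_of r y a.
Proof. exact: linP. Qed.

Lemma beta_of0 p (r : p.-tuple nat) a : beta_of r 0 a = 0.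
Proof. exact: lin0. Qed.

Lemma beta_ofZ p (r : p.-tuple nat) c x a : beta_of r (c *: x) a = c *: beta_of r x a.
Proof. exact: linZ. Qed.

Lemma beta_of_sum p (r : p.-tuple nat) a I (s : seq I) (Q : pred I) (g : I -> P) :
  beta_of r (\sum_(i <- s | Q i) g i) a = \sum_(i <- s | Q i) beta_of r (g i) a.
Proof. exact: lin_sum. Qed.

Lemma beta_of_Osum N p (r : p.-tuple nat) b a :
  N = sumn r -> ar b = N -> beta_of r (Osum act F (Sig N (blk r)) b) a = ga r b a.
Proof.
move=> -> arb; rewrite /beta_of {1}/Osum lin_sum; set G := Sig_group (sumn r) (blk r).
have c_in : crep G b \in orbit act G b := crep_orbit G b arb.
rewrite (bigD1_seq _ c_in) ?undup_uniq //= linU big_seq_cond big1 ?addr0; last first.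
  by move=> d /andP[d_in ne_d]; rewrite linU (@crep_eq _ G b d) // (negbTE ne_d).
rewrite (@crep_eq _ G b (crep G b)) // eqxx.
by case/orbitP: c_in => s sG ->; case: gaP => -[g0 _ _ _ _] _ _; apply: g0.
Qed.

Lemma is_beta_of : is_beta ar act beta_of.
Proof.
case: gaP => -[_ g1 g2 g3 [g4 g5]] _ _; split.
- move=> p r x rho a; apply: (@admG_ind _ (Sig_group (sumn r) (blk r))
    (fun x => beta_of r x a = beta_of (rtw rho r) (pact act (bperm rho r) x) (atw rho a))).
  + by rewrite pact0 !beta_of0.
  + by move=> c x1 x2 _ _ E1 E2; rewrite pactP !beta_ofP E1 E2.
  move=> b arb; rewrite pact_Osum_bperm // !beta_of_Osum ?sumn_rtw ?ar_act //.
  exact: g1.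
- move=> p r x a0 a; apply: (@admG_ind _ (Sig_group (sumn r) (blk r))
    (fun x => beta_of [tuple of 0%N :: r] x [tuple of a0 :: a] = beta_of r x a)).
  + by rewrite !beta_of0.
  + by move=> c x1 x2 _ _ E1 E2; rewrite !beta_ofP E1 E2.
  move=> b arb; rewrite [RHS]beta_of_Osum // -(g2 _ _ _ a0) //.
  have := @beta_of_Osum (sumn r) _ [tuple of 0%N :: r] b [tuple of a0 :: a] erefl arb.
  by rewrite Sig_cons0.
- move=> p r x c a0 a; apply: (@admG_ind _ (Sig_group (sumn r) (blk r))
    (fun x => beta_of r x [tuple of c *: a0 :: a]
      = c ^+ thead r *: beta_of r x [tuple of a0 :: a])).
  + by rewrite !beta_of0 scaler0.
  + by move=> d x1 x2 _ _ E1 E2; rewrite !beta_ofP E1 E2 scalerDr !scalerA mulrC.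
  by move=> b arb; rewrite !beta_of_Osum // g3.
- move=> s p q r x a sq; apply: (@admG_ind _ (Sig_group (sumn r) (blk r))
    (fun x => beta_of r x (rep p q a)
      = beta_of (qr q r) (Tr (Sig (sumn r) (blk r)) (Sig (sumn r) (blk (qr q r))) x) a)).
  + by rewrite Tr0 !beta_of0.
  + by move=> c x1 x2 _ _ E1 E2; rewrite TrP !beta_ofP E1 E2.
  move=> b arb; rewrite (@Tr_Osum _ (Sig_group _ _) (Sig_group _ _)) ?Sig_qr //.
  by rewrite beta_ofZ !beta_of_Osum ?sumn_qr // g4.
split; last by move=> *; apply: beta_ofP.
move=> p r x a0 a1 a; apply: (@admG_ind _ (Sig_group (sumn r) (blk r))
  (fun x => beta_of r x [tuple of (a0 + a1) :: a]
    = \sum_(l < (thead r).+1)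
        beta_of (split1 r l (thead r - l)%N) x [tuple of a0 :: a1 :: a])).
- by rewrite beta_of0 big1 // => l _; rewrite beta_of0.
- move=> c x1 x2 _ _ E1 E2; rewrite beta_ofP E1 E2 scaler_sumr -big_split /=.
  by apply: eq_bigr => l _; rewrite beta_ofP.
move=> b arb; rewrite beta_of_Osum // g5 //; apply: eq_bigr => l _.
have le_l : (l <= thead r)%N by rewrite -ltnS.
set d := split1 r l _; have sum_d : sumn r = sumn d by rewrite sumn_split1.
rewrite (@Osum_subclasses _ (Sig_group _ (blk d)) (Sig_group _ (blk r))) //; last exact: Sig_split1.
rewrite beta_of_sum; apply: eq_big_seq => C C_in; rewrite beta_of_Osum //.
exact: head_subclass_ar C_in.
Qed.

(** Axiom (7b) for one choice of data. The size [N] is a variable so that instances for different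
    [r] and [qs] can share one symmetric group in the induction. *)
Definition beta7b p (r : p.-tuple nat) x (k : 'I_p -> nat)
    (qs : forall i, (k i).-tuple nat) (xs : 'I_p -> P) (bs : forall i, (k i).-tuple A) :=
  forall N (tau : 'S_N), N = Mtot r qs ->
  (forall t : 'I_N, blk (dcomp r qs) (tau t) = dlab r qs t) ->
  beta_of r x [tuple beta_of (qs i) (xs i) (bs i) | i < p]
  = beta_of (dcomp r qs)
      (pact act tau (Tr (WrG N (msz r qs) (dlab r qs)) (Sig N (dlab r qs))
         (Pcomp e comp x [seq nth 0 [seq xs i | i <- enum 'I_p] (blk r j)
                            | j <- iota 0 (sumn r)])))
      (dargs r qs bs).

Lemma beta7b_zero p (r : p.-tuple nat) x (k : 'I_p -> nat)
    (qs : forall i, (k i).-tuple nat) (xs : 'I_p -> P)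
    (bs : forall i, (k i).-tuple A) (i0 : 'I_p) :
  adm ar act r x -> (0 < tnth r i0)%N -> xs i0 = 0 -> @beta7b p r x k qs xs bs.
Proof.
move=> Ax r_gt0 xs0 N tau EN Htau.
rewrite (beta_zero is_beta_of (i0 := i0)) //; last by rewrite tnth_mktuple xs0 beta_of0.
have lt_o : (0 < nth 0%N r i0)%N by rewrite nth_tnth.
have lt_u := off_add_lt lt_o.
(* The first input of colour [i0]; it exists because [r_i0 > 0], and it makes the composite
   vanish. *)
rewrite (@Pcomp_zero _ _ (off r i0 + 0)%N); first by rewrite Tr0 pact0 beta_of0.
  by rewrite size_map size_iota.
rewrite (nth_map 0%N) ?size_iota // nth_iota // add0n blk_offE //.
by rewrite nth_map_ord.
Qed.

(** Once the inner elements are orbit sums, both sides are linear in [x]; so [x] may be taken to be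
    an orbit sum as well, and (gamma6b) applies. *)
Lemma beta7b_base p (r : p.-tuple nat) x (k : 'I_p -> nat)
    (qs : forall i, (k i).-tuple nat) (xs : 'I_p -> P)
    (bs : forall i, (k i).-tuple A) (xt : 'I_p -> T) :
  adm ar act r x -> (forall i, ar (xt i) = sumn (qs i)) ->
  (forall i, xs i = Osum act F (Sig (sumn (qs i)) (blk (qs i))) (xt i)) ->
  @beta7b p r x k qs xs bs.
Proof.
move=> Ax arxt Exs N tau EN; subst N => Htau.
have -> : [tuple beta_of (qs i) (xs i) (bs i) | i < p] = [tuple ga (qs i) (xt i) (bs i) | i < p].
  by apply: eq_from_tnth => i; rewrite !tnth_mktuple Exs beta_of_Osum.
have -> : [seq xs i | i <- enum 'I_p]
    = [seq Osum act F (Sig (sumn (qs i)) (blk (qs i))) (xt i) | i <- enum 'I_p].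
  exact: eq_map.
move: x Ax; apply: (@admG_ind _ (Sig_group (sumn r) (blk r))).
- by rewrite Pcomp0 Tr0 pact0 !beta_of0.
- by move=> c x1 x2 _ _ E1 E2; rewrite PcompP TrP pactP !beta_ofP E1 E2.
move=> b0 arb0; have [K1 arX] := Tr_diamond_Osum arb0 arxt.
rewrite -[WrG _ _ _]/(Wr r qs) -[Sig _ (dlab _ _)]/(Sdiam r qs) K1 beta_of_Osum //.
case: gaP => _ _ /(_ p r b0 k qs xt bs arb0 arxt tau Htau) ->.
have sum_d := sumn_dseq r qs.
rewrite pactZ beta_ofZ /Sdiam (pact_Osum_lab (lab' := blk (dcomp r qs))) //; last first.
  by move=> t t'; rewrite !Htau.
by rewrite beta_of_Osum ?sum_d // ar_act.
Qed.

Lemma beta7b_split p (r : p.+1.-tuple nat) x (k : 'I_p.+1 -> nat)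
    (qs : forall i, (k i).-tuple nat) (xs : 'I_p.+1 -> P)
    (bs : forall i, (k i).-tuple A) i0 a z0 z1 :
  xs i0 = a *: z0 + z1 ->
  adm ar act r x -> (forall i, adm ar act (qs i) (xs i)) ->
  adm ar act (qs i0) z0 -> adm ar act (qs i0) z1 ->
  (forall i, 0 < sumn (qs i))%N ->
  (forall l, (l <= tnth r i0)%N -> adm ar act (spl r i0 l (tnth r i0 - l)%N) x ->
     beta7b (spl r i0 l (tnth r i0 - l)%N) x (fun j => qs (fspl i0 j))
       (xsspl i0 xs z0 z1) (fun j => bs (fspl i0 j))) ->
  @beta7b _ r x k qs xs bs.
Proof.
move=> xs0 Ax Axs Az0 Az1 q_gt0 IH N tau EN; subst N => Htau.
rewrite (beta_split is_beta_of (i0 := i0) (c := a) (A0 := beta_of (qs i0) z0 (bs i0))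
  (A1 := beta_of (qs i0) z1 (bs i0))) //; last by rewrite tnth_mktuple xs0 beta_ofP.
have -> : spl [tuple beta_of (qs i) (xs i) (bs i) | i < p.+1] i0
       (beta_of (qs i0) z0 (bs i0)) (beta_of (qs i0) z1 (bs i0))
    = [tuple beta_of (qs (fspl i0 j)) (xsspl i0 xs z0 z1 j) (bs (fspl i0 j)) | j < p.+2].
  apply: eq_from_tnth => j; rewrite !tnth_mktuple /xsspl tnth_mktuple /fspl.
  case: (unlift _ _) => [i|] //=; rewrite !tnth_mktuple.
  by case: eqP => [->|].
rewrite (Pcomp_split xs0 Ax Axs Az0 Az1 q_gt0) Tr_sum pact_sum beta_of_sum.
apply: eq_bigr => l _; have le_l : (l <= tnth r i0)%N by rewrite -ltnS.
set rl := spl r i0 l _; set qs' := fun j => qs (fspl i0 j).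
have sum_rl : sumn rl = sumn r by exact: sumn_spl.
have blk_rl u : (u < sumn r)%N -> blk r u = unbump i0 (blk rl u) by exact: blk_spl.
have Ems : msz rl qs' = msz r qs := merge_msz qs (fsplE i0) sum_rl blk_rl.
have EM : Mtot r qs = Mtot rl qs' by rewrite /Mtot Ems.
have [tl Htl] := exists_dsort EM.
rewrite TrZ pactZ beta_ofZ; congr (_ *: _).
have wl := wreath_diam (r := r) (fun i _ => q_gt0 i).
have wl' := wreath_rl q_gt0 le_l.
have sub : WrG (Mtot r qs) (msz r qs) (dlab rl qs')
           \subset WrG (Mtot r qs) (msz r qs) (dlab r qs).
  apply/subsetP=> w /(WrG_refine w wl wl'); case=> //.
  by rewrite size_msz.
have AZ := admG_Pcomp_rl Ax Axs Az0 Az1 q_gt0 le_l.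
(* The trace from the stabilizer of the splitting to the wreath group composes with the outer one;
   the result is the shape that [beta_merge] produces from the induction hypothesis. *)
rewrite (@Tr_tower _ (WrG_group _ _ _) (WrG_group _ _ _) (Sig_group _ _)) ?WrG_Sig //.
have Arl : adm ar act rl x.
  apply/(admE _ (esym sum_rl)); apply: admG_sub Ax.
  by apply: sub_Sig => t t' E; rewrite !blk_rl // E.
rewrite (IH l le_l Arl _ tl EM Htl) Ems -/rl sum_rl.
exact: (beta_merge (fsplE i0) sum_rl blk_rl bs is_beta_of erefl Htau Htl AZ).
Qed.

(** No block has colour [i0], so the composite and its wreath group do not see this index, whatever
    [x_i0] and [q_i0] are. *)
Lemma beta7b_remove p (r : p.+1.-tuple nat) x (k : 'I_p.+1 -> nat)
    (qs : forall i, (k i).-tuple nat) (xs : 'I_p.+1 -> P)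
    (bs : forall i, (k i).-tuple A) i0 :
  tnth r i0 = 0%N ->
  adm ar act r x -> (forall i, adm ar act (qs i) (xs i)) ->
  (forall i, 0 < tnth r i -> 0 < sumn (qs i))%N ->
  (adm ar act [tuple tnth r (lift i0 j) | j < p] x ->
   beta7b [tuple tnth r (lift i0 j) | j < p] x (fun j => qs (lift i0 j))
       (fun j => xs (lift i0 j)) (fun j => bs (lift i0 j))) ->
  @beta7b _ r x k qs xs bs.
Proof.
move=> r0 Ax Axs q_gt0 IH N tau EN; subst N => Htau.
set r' := [tuple tnth r (lift i0 j) | j < p] in IH; set qs' := fun j => qs (lift i0 j) in IH.
have sum_r' : sumn r' = sumn r.
  rewrite !sumn_tuple (bigD1_ord i0) //= r0 add0n.
  by apply: eq_bigr => j _; rewrite tnth_mktuple.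
have nth_r i : nth 0%N r i = (\sum_(j < size r' | bump i0 j == i) nth 0%N r' j)%N.
  rewrite size_tuple; have [lt_i|le_i] := ltnP i p.+1; last first.
    rewrite nth_default ?size_tuple // big_pred0 // => j.
    by apply: contra_leqF le_i => /eqP <-; apply: ltn_ord (lift i0 j).
  case: (unliftP i0 (Ordinal lt_i)) => [j|] Ei.
    rewrite (big_pred1 j) => [|j']; last first.
      by rewrite /= -[i]/(val (Ordinal lt_i)) Ei /= (inj_eq (@bump_inj i0)).
    by rewrite (nth_tnth r (Ordinal lt_i)) Ei nth_tnth tnth_mktuple.
  rewrite (nth_tnth r (Ordinal lt_i)) Ei r0 big_pred0 // => j.
  by rewrite -[i]/(val (Ordinal lt_i)) Ei eq_sym (negbTE (neq_bump _ _)).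
have blk_r' u : (u < sumn r)%N -> blk r u = bump i0 (blk r' u).
  move=> lt_u; apply: blk_merge => //; last by rewrite sum_r'.
  by move=> i j /andP[le_ij _]; rewrite leq_bump2.
have Ef (j : 'I_p) : bump i0 j = lift i0 j by [].
have Ems : msz r' qs' = msz r qs := merge_msz qs Ef sum_r' blk_r'.
have EM : Mtot r qs = Mtot r' qs' by rewrite /Mtot Ems.
have [t' Ht'] := exists_dsort EM.
have wl := wreath_diam (r := r) q_gt0.
have q'_gt0 j : (0 < tnth r' j -> 0 < sumn (qs (lift i0 j)))%N.
  by rewrite tnth_mktuple; apply: q_gt0.
have wl' := wreath_merge Ef sum_r' blk_r' q'_gt0.
have EW : WrG (Mtot r qs) (msz r qs) (dlab r' qs') = WrG (Mtot r qs) (msz r qs) (dlab r qs).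
  apply/setP=> w; rewrite !inE; congr andb; apply: eq_forallb => t.
  rewrite (wreath_lab_eq wl) // (wreath_lab_eq wl') //.
  have lt_b (v : 'I_(Mtot r qs)) : (blk (msz r qs) v < sumn r)%N.
    by rewrite -(size_msz r qs) blk_lt.
  by rewrite !blk_r' // (inj_eq (@bump_inj i0)).
have Ezs : [seq nth 0 [seq xs (lift i0 j) | j <- enum 'I_p] (blk r' u) | u <- iota 0 (sumn r')]
   = [seq nth 0 [seq xs i | i <- enum 'I_p.+1] (blk r u) | u <- iota 0 (sumn r)].
  rewrite sum_r'; apply/eq_in_map=> u; rewrite mem_iota add0n => lt_u.
  have lt_u' : (u < sumn r')%N by rewrite sum_r'.
  rewrite blk_r' // -[blk r' u]/(val (Ordinal (blk_ltT lt_u'))).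
  by rewrite Ef !nth_map_ord.
have AZ : admG (WrG (Mtot r qs) (msz r qs) (dlab r' qs'))
   (Pcomp e comp x [seq nth 0 [seq xs i | i <- enum 'I_p.+1] (blk r u) | u <- iota 0 (sumn r)]).
  rewrite EW; apply: (admG_Pcomp (z := fun i => nth 0 [seq xs i | i <- enum 'I_p.+1] i) wl) => //.
    exact: size_msz.
  move=> u lt_u; rewrite nth_msz // -[blk r u]/(val (Ordinal (blk_ltT lt_u))).
  by rewrite nth_qseq nth_map_ord; apply: Axs.
have [Px _] := Ax.
have Ax' : admG (Sig (sumn r) (blk r')) x.
  by apply: admG_sub Ax; apply: sub_Sig => t t'' E; rewrite !blk_r' // E.
have -> : beta_of r x [tuple beta_of (qs i) (xs i) (bs i) | i < p.+1]
  = beta_of r' x [tuple beta_of (qs (lift i0 j)) (xs (lift i0 j)) (bs (lift i0 j)) | j < p].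
  (* Inserting an argument of multiplicity 0 is a relabelling along the injection [bump i0], with
     trivial sorting permutations. *)
  rewrite -[in LHS](pact1 Px) -[in RHS](pact1 Px); apply/esym.
  apply: (beta_relabel_inj is_beta_of (lab := blk r') (f := bump i0)) => //.
  - by move=> t; rewrite perm1.
  - by move=> t; rewrite perm1 blk_r'.
  - by move=> L lt_L; apply: ltn_ord (lift i0 (Ordinal lt_L)).
  - move=> L lt_L; rewrite -[L]/(val (Ordinal lt_L)) Ef -!tnth_nth !tnth_mktuple.
    by [].
  exact: bump_inj.
rewrite (IH (iffRL (admE _ (esym sum_r')) Ax') _ t' EM Ht') Ems Ezs -EW.
exact: (beta_merge Ef sum_r' blk_r' bs is_beta_of erefl Htau Ht' AZ).
Qed.

(* Part of the termination measure: zero exactly on 0 and on orbit sums, where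
   [beta7b] needs no further splitting. *)
Definition nu N (G : {set 'S_N}) (z : P) : nat :=
  if (z == 0) || has (fun b => z == Osum act F G b) (enum_fset (msupp z))
  then 0%N else #|` msupp z|.

Lemma nu_Osum N (G : {group 'S_N}) b : ar b = N -> nu G (Osum act F G b) = 0%N.
Proof.
move=> arb; rewrite /nu; case: ifP => // /norP[_ /hasPn/(_ b)].
rewrite eqxx => H; have: b \in msupp (Osum act F G b); last by move/H.
by rewrite -mcoeff_neq0 mcoeff_Osum orbit_refl // oner_neq0.
Qed.

Lemma nu_le N (G : {set 'S_N}) z : (nu G z <= #|` msupp z|)%N.
Proof. by rewrite /nu; case: ifP. Qed.

Lemma msupp_ex (z : P) : z != 0 -> exists b, b \in msupp z.
Proof.
case E: (enum_fset (msupp z)) => [|b s]; last by exists b; rewrite -[_ \in _]/(b \in enum_fset _) E mem_head.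
by rewrite -[z]lin_id /lin E big_nil eqxx.
Qed.

(** The factor 2 makes both reductions decrease the measure: a split lowers the sum of [nu] by at
    least 1 while raising [p] by 1, and a removal lowers [p] without raising the sum. *)
Lemma beta7b_all m p (r : p.-tuple nat) x (k : 'I_p -> nat)
    (qs : forall i, (k i).-tuple nat) (xs : 'I_p -> P)
    (bs : forall i, (k i).-tuple A) :
  (2 * (\sum_(i < p) nu (Sig (sumn (qs i)) (blk (qs i))) (xs i)) + p < m)%N ->
  adm ar act r x -> (forall i, adm ar act (qs i) (xs i)) ->
  @beta7b p r x k qs xs bs.
Proof.
elim: m p r x k qs xs bs => // m IHm p r x k qs xs bs lt_m Ax Axs.
have [/existsP[i0 /andP[r_gt0 /eqP xs0]]|Hz] := boolP [exists i, (0 < tnth r i)%N && (xs i == 0)].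
  exact: beta7b_zero r_gt0 xs0.
have xs_n0 i : (0 < tnth r i)%N -> xs i != 0.
  by move=> r_gt0; move/existsPn/(_ i): Hz; rewrite r_gt0.
(* A nonzero [x_i] has an element of arity [sumn (qs i)] in its support, and no element has arity
   0. *)
have q_gt0 i : (0 < tnth r i -> 0 < sumn (qs i))%N.
  move=> /xs_n0/msupp_ex[b0 b0_in]; have [Pxi _] := Axs i.
  by rewrite -(Pxi _ b0_in) lt0n; apply/eqP/red.
case: p => [|p] in r k qs xs bs lt_m Ax Axs xs_n0 q_gt0 {Hz} *.
  (* With no inner operation there is nothing to be an orbit sum; [e] only inhabits the type. *)
  by apply: (@beta7b_base _ _ _ _ _ _ _ (fun=> e)) => // -[].
have [/existsP[i0 /eqP r0]|Hr] := boolP [exists i, tnth r i == 0%N].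
  apply: (beta7b_remove r0) => // Ar'; apply: IHm => //.
  move: lt_m; rewrite (bigD1_ord i0) //=; lia.
have r_gt0 i : (0 < tnth r i)%N by rewrite lt0n; move/existsPn: Hr; apply.
have [/existsP[i0 nu_i0]|Hnu] :=
  boolP [exists i, nu (Sig (sumn (qs i)) (blk (qs i))) (xs i) != 0%N]; last first.
  have nu0 i : exists b, ar b = sumn (qs i)
      /\ xs i = Osum act F (Sig (sumn (qs i)) (blk (qs i))) b.
    move/existsPn/(_ i)/negPn/eqP: Hnu; rewrite /nu (negbTE (xs_n0 i (r_gt0 i))) /=.
    have [Pxi _] := Axs i; case: ifP => [/hasP[b /Pxi arb /eqP Eb] _|_ /cardfs0_eq E].
      by exists b.
    by have [b] := msupp_ex (xs_n0 i (r_gt0 i)); rewrite E inE.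
  have [xt Hxt] := fin_all_exists nu0.
  by apply: (@beta7b_base _ _ _ _ _ _ _ xt) => // i; case: (Hxt i).
set G := Sig_group (sumn (qs i0)) (blk (qs i0)).
have [Pz _] := Axs i0; have Az : admG G (xs i0) := Axs i0.
have nuE : nu G (xs i0) = #|` msupp (xs i0)|.
  by move: nu_i0; rewrite /nu; case: ifP.
have [b1 b1_in] := msupp_ex (xs_n0 i0 (r_gt0 i0)); have arb1 := Pz _ b1_in.
(* Subtracting the part of [x_i0] on the orbit of [b1] removes at least [b1] from the support and
   adds nothing to it; the other summand [O] has [nu] equal to 0. *)
pose O := Osum act F G b1; pose z1 := xs i0 - (xs i0)@_b1 *: O.
have AO : admG G O := admG_Osum G arb1.
have xs0 : xs i0 = (xs i0)@_b1 *: O + z1 by rewrite /z1 addrC subrK.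
have Az1 : admG G z1 by rewrite /z1 addrC -scaleNr; apply: admGP.
have lt_nu : (nu G z1 < nu G (xs i0))%N.
  rewrite nuE (cardfsD1 b1) b1_in add1n ltnS; apply: leq_trans (nu_le _ _) _.
  apply: fsubset_leq_card; apply/fsubsetP=> b; rewrite -mcoeff_neq0 in_fsetD1.
  rewrite /z1 mcoeffB mcoeffZ mcoeff_Osum => nz.
  have [Eb|ne_b] := eqVneq b b1.
    by move: nz; rewrite Eb orbit_refl // mulr1 subrr eqxx.
  rewrite /=; apply: contraNT nz => b_nin; rewrite (mcoeff_outdom b_nin) sub0r oppr_eq0.
  have [/orbitP[s sG Eb]|_] := boolP (b \in orbit act G b1); last by rewrite mulr0.
  by rewrite mulr1 -(admG_coeff Az sG arb1) -Eb (mcoeff_outdom b_nin).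
apply: (beta7b_split xs0) => // [i|l le_l Arl]; first exact: q_gt0.
apply: IHm => // [|j]; last exact: adm_xsspl.
have E : (\sum_(j < p.+2) nu (Sig (sumn (qs (fspl i0 j))) (blk (qs (fspl i0 j))))
                              (xsspl i0 xs O z1 j)
   = nu G z1 + \sum_(i < p.+1 | i != i0) nu (Sig (sumn (qs i)) (blk (qs i))) (xs i))%N.
  rewrite (bigD1_ord (lift ord0 i0)) //; congr (_ + _)%N.
    by rewrite /fspl /xsspl tnth_mktuple unlift_none.
  rewrite [RHS]big_mkcond; apply: eq_bigr => i _.
  rewrite /fspl /xsspl tnth_mktuple liftK tnth_mktuple /=.
  by case: eqP => [->|//]; apply: (nu_Osum G arb1).
move: lt_m lt_nu; rewrite E (bigD1 i0) //= -/G.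
by move: (nu G z1) (nu G (xs i0)) (\sum_(i < _ | _) _)%N; lia.
Qed.

Lemma is_beta'_of : is_beta' ar act e comp beta_of.
Proof.
split; first exact: is_beta_of.
  by move=> a; rewrite -Osum_unit beta_of_Osum ?ar_e //; case: gaP => _ ->.
move=> p r x k qs xs bs Ax Axs xl X Y tau Htau.
exact: (@beta7b_all _ p r x k qs xs bs (leqnn _) Ax Axs _ tau erefl Htau).
Qed.

End FromGamma.

Lemma beta_eq_Osum (A : lmodType F) (be1 be2 : betaOps T A) :
  is_beta ar act be1 -> is_beta ar act be2 ->
  gamma_eq ar (Pfun act be1) (Pfun act be2) -> beta_eq ar act be1 be2.
Proof.
move=> b1 b2 E p r x a; move: x.
apply: (@admG_ind _ (Sig_group (sumn r) (blk r))); first by rewrite !be0.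
  move=> c x y Ax Ay Ex Ey; case: b1 => _ _ _ _ [_ l1]; case: b2 => _ _ _ _ [_ l2].
  by rewrite l1 // l2 // Ex Ey.
by move=> b arb; apply: E.
Qed.

Lemma beta_mor_Pfun (A A' : lmodType F) (be : betaOps T A) (be' : betaOps T A')
    (f : {linear A -> A'}) :
  is_beta ar act be -> is_beta ar act be' ->
  beta_mor ar act f be be' <-> gamma_mor ar f (Pfun act be) (Pfun act be').
Proof.
move=> b1 b2; split=> [H p r b a arb|H p r x a].
  by apply: H; apply: (@admG_Osum _ (Sig_group _ _)).
move: x; apply: (@admG_ind _ (Sig_group (sumn r) (blk r))).
- by rewrite !be0 // linear0.
- move=> c x y Ax Ay Ex Ey; case: b1 => _ _ _ _ [_ l1]; case: b2 => _ _ _ _ [_ l2].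
  by rewrite l1 // l2 // linearP Ex Ey.
by move=> b arb; apply: H.
Qed.

End OperadLaws.
End Action.

Theorem theorem4p9 (F : fieldType) (T : choiceType) (ar : T -> nat)
  (act : forall n, 'S_n -> T -> T) (e : T) (comp : T -> seq T -> T) :
  set_operad ar act e comp -> reduced ar ->
  (* P_P maps beta'(P) into gamma'(P) *)
  (forall (A : lmodType F) (be : betaOps T A),
     is_beta' ar act e comp be -> is_gamma' ar act e comp (Pfun act be)) /\
  (* surjective on objects *)
  (forall (A : lmodType F) (ga : gammaOps T A),
     is_gamma' ar act e comp ga ->
     exists be : betaOps T A,
       is_beta' ar act e comp be /\ gamma_eq ar (Pfun act be) ga) /\
  (* injective on objects *)
  (forall (A : lmodType F) (be1 be2 : betaOps T A),
     is_beta' ar act e comp be1 -> is_beta' ar act e comp be2 ->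
     gamma_eq ar (Pfun act be1) (Pfun act be2) -> beta_eq ar act be1 be2) /\
  (* bijective on morphisms (P_P is the identity on underlying linear maps) *)
  (forall (A A' : lmodType F) (be : betaOps T A) (be' : betaOps T A')
          (f : {linear A -> A'}),
     is_beta' ar act e comp be -> is_beta' ar act e comp be' ->
     (beta_mor ar act f be be' <-> gamma_mor ar f (Pfun act be) (Pfun act be'))).
Proof.
move=> op red; have [[ar_act act1 actM _ _] _] := op.
split; first by move=> A be; apply: is_gamma'_Pfun.
split.
  move=> A ga gaP; exists (beta_of act ga); split; first exact: is_beta'_of.
  by move=> p r x a arx; rewrite /Pfun (beta_of_Osum act1 actM gaP).
split=> [A be1 be2 [b1 _ _] [b2 _ _]|A A' be be' f [b1 _ _] [b2 _ _]].
  exact: beta_eq_Osum.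
exact: beta_mor_Pfun.
Qed.
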